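(* Let $C:f=0$ be a reduced curve of degree $d\geq 3$ in $\mathbb{P}^2$ (over $\mathbb{C}$) of type $2$. Then one of the following two cases occurs. (1) $C$ is a $3$-syzygy curve and $\varepsilon_1=2$. If $(d_1,d_2,d_3)$ are the exponents of $C$, then $$\tau(C)=d_1^2+d_1d_2+d_2^2-2d_1-2d_2-2d_3.$$ (2) $C$ is a $4$-syzygy curve and $\varepsilon_1=\varepsilon_2=1$. If $(d_1,d_2,d_3,d_4)$ are the exponents of $C$, then $$\tau(C)=d_1^2+d_1d_2+d_2^2-2d_1-2d_2-d_3-d_4+1.$$ Conversely, for a non-free reduced curve $C$ of degree $d \geq 3$, if $m=3$ and $\varepsilon_1=2$, or $m=4$ and $\varepsilon_1=\varepsilon_2=1$, then $t(C)=2$.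
   Context: Let $S=\mathbb{C}[x,y,z]$ with its standard grading. For a reduced curve $C:f=0$ of degree $d$ in $\mathbb{P}^2=\mathbb{P}^2_{\mathbb{C}}$, let $$D_0(f)=\{(a,b,c)\in S^3 : af_x+bf_y+cf_z=0\}$$ be the graded $S$-module of Jacobian syzygies, where a homogeneous element $(a,b,c)$ has degree $k$ if $a,b,c$ are homogeneous of degree $k$. Let $d_1\leq d_2\leq\dots\leq d_m$ be the degrees of the elements of a minimal system of homogeneous generators of $D_0(f)$. Then $C$ is called an $m$-syzygy curve, $(d_1,\dots,d_m)$ are called its exponents, and the type of $C$ is $t(C)=d_1+d_2+1-d$. The curve is free if $D_0(f)$ is a free $S$-module, equivalently $t(C)=0$. Let $J_f=(f_x,f_y,f_z)$ be the Jacobian ideal and $M(f)=S/J_f$. If $C$ is not free, the minimal graded free resolution of $M(f)$ has the form $$0\to\bigoplus_{i=1}^{m-2}S(-c_i)\to\bigoplus_{j=1}^{m}S(1-d-d_j)\to S^3(1-d)\to S,$$ with $c_1\leq\dots\leq c_{m-2}$ and $d_1\leq\dots\leq d_m$, and the integers $\varepsilon_j$ are defined by $c_j=d+d_{j+2}-1+\varepsilon_j$ for $j=1,\dots,m-2$ (it is known that $\varepsilon_j\geq 1$). The total Tjurina number $\tau(C)$ is the sum of the Tjurina numbers of all singular points of $C$. *)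

(* Defs.v *)
From HB Require Import structures.
From mathcomp Require Import all_boot all_order all_algebra.
From mathcomp Require Import reals.
From mathcomp Require Import complex.
From mathcomp Require Import mpoly.

Set Implicit Arguments.
Unset Strict Implicit.
Unset Printing Implicit Defensive.

Import GRing.Theory.
Local Open Scope ring_scope.

(* Elements of S^n are row vectors over S = {mpoly C[3]}; a matrix with m rows
   and n columns is the S-linear map S^m -> S^n, u |-> u *m A, and also the
   family of its rows in S^n. *)

Definition reduced_curve (C : fieldType) (d : nat) (f : {mpoly C[3]}) : Prop :=
  [/\ f != 0, f \is d.-homog
    & forall g h : {mpoly C[3]}, f = g ^+ 2 * h -> g \is a GRing.unit].

Definition gradient (C : fieldType) (f : {mpoly C[3]}) : 'cV[{mpoly C[3]}]_3 :=
  \col_i f^`M(i).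

Definition D0 (C : fieldType) (f : {mpoly C[3]}) (v : 'rV[{mpoly C[3]}]_3) :
    Prop :=
  \sum_i v 0 i * f^`M(i) = 0.

Definition generates_D0 (C : fieldType) (f : {mpoly C[3]}) (m : nat)
    (A : 'M[{mpoly C[3]}]_(m, 3)) : Prop :=
  forall v, D0 f v <-> exists u : 'rV_m, v = u *m A.

Definition free_curve (C : fieldType) (f : {mpoly C[3]}) : Prop :=
  exists (m : nat) (A : 'M[{mpoly C[3]}]_(m, 3)),
    generates_D0 f A /\ forall u : 'rV_m, u *m A = 0 -> u = 0.

(* Since a family containing a generating family of elements of D0 f is again
   generating, it suffices for minimality to remove one generator at a time. *)
Definition minimal_generators (C : fieldType) (f : {mpoly C[3]}) (ds : seq nat)
    (A : 'M[{mpoly C[3]}]_(size ds, 3)) : Prop :=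
  [/\ forall j k, A j k \is (nth 0%N ds j).-homog,
      generates_D0 f A
    & forall j, ~ generates_D0 f (row' j A)].

Definition exponents (C : fieldType) (f : {mpoly C[3]}) (ds : seq nat) : Prop :=
  sorted leq ds /\ exists A, @minimal_generators C f ds A.

Definition syzygy_curve (C : fieldType) (f : {mpoly C[3]}) (m : nat) : Prop :=
  exists2 ds, exponents f ds & size ds = m.

Definition curve_type (C : fieldType) (d : nat) (f : {mpoly C[3]}) (t : int) :
    Prop :=
  exists (d1 d2 : nat) (ds : seq nat),
    exponents f [:: d1, d2 & ds] /\ t = d1%:Z + d2%:Z + 1 - d%:Z.

Definition homogz (C : fieldType) (k : int) (p : {mpoly C[3]}) : Prop :=
  match k with Posz n => p \is n.-homog | Negz _ => p = 0 end.

(* M is a degree-preserving map from the sum of the S(- a i) to the sum of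
   the S(- b j). *)
Definition graded_mx (C : fieldType) (m n : nat) (a : 'I_m -> int)
    (b : 'I_n -> int) (M : 'M[{mpoly C[3]}]_(m, n)) : Prop :=
  forall i j, homogz (a i - b j) (M i j).

(* The image of the map M lies in (x, y, z) S^n. *)
Definition minimal_mx (C : fieldType) (m n : nat)
    (M : 'M[{mpoly C[3]}]_(m, n)) : Prop :=
  forall i j, (M i j)@_0%MM = 0.

Definition exact_mx (C : fieldType) (m n p : nat)
    (M : 'M[{mpoly C[3]}]_(m, n)) (N : 'M[{mpoly C[3]}]_(n, p)) : Prop :=
  forall u : 'rV_n, u *m N = 0 <-> exists w : 'rV_m, u = w *m M.

(* 0 -> (+)_i S(- c_i) -B-> (+)_j S(1 - d - d_j) -A-> S(1 - d)^3 -> S is the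
   minimal graded free resolution of S / J_f; the last map is the gradient,
   whose cokernel is S / J_f. *)
Definition minimal_resolution (C : fieldType) (d : nat) (f : {mpoly C[3]})
    (ds cs : seq nat) : Prop :=
  [/\ sorted leq ds, sorted leq cs, size ds = (size cs).+2
    & exists (B : 'M[{mpoly C[3]}]_(size cs, size ds))
             (A : 'M[{mpoly C[3]}]_(size ds, 3)),
      let twist0 (_ : 'I_1) : int := 0 in
      let twist1 (_ : 'I_3) : int := d%:Z - 1 in
      let twist2 (j : 'I_(size ds)) : int := d%:Z + (nth 0%N ds j)%:Z - 1 in
      let twist3 (i : 'I_(size cs)) : int := (nth 0%N cs i)%:Z in
      [/\ [/\ graded_mx twist3 twist2 B, graded_mx twist2 twist1 A
            & graded_mx twist1 twist0 (gradient f)],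
          [/\ minimal_mx B, minimal_mx A & minimal_mx (gradient f)]
        & [/\ forall w : 'rV_(size cs), w *m B = 0 -> w = 0,
              exact_mx B A & exact_mx A (gradient f)]]].

(* eps = [:: eps_1; ...; eps_(m-2)], where
   c_j = d + d_(j+2) - 1 + eps_j; sequences are indexed from 0. *)
Definition epsilons (C : fieldType) (d : nat) (f : {mpoly C[3]})
    (eps : seq int) : Prop :=
  exists ds cs : seq nat,
    [/\ minimal_resolution d f ds cs, size eps = size cs
      & forall j, (j < size cs)%N ->
          (nth 0%N cs j)%:Z = d%:Z + (nth 0%N ds j.+2)%:Z - 1 + nth 0 eps j].

(* The local ring of the affine n-space at q, inside its function field. *)
Definition local_ring (C : fieldType) (n : nat) (q : 'rV[C]_n)
    (h : {fraction {mpoly C[n]}}) : Prop :=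
  exists a b : {mpoly C[n]}, b.@[q 0] != 0 /\ h = tofrac a / tofrac b.

(* The ideal generated by g and its partial derivatives in the local ring. *)
Definition tjurina_ideal (C : fieldType) (n : nat) (g : {mpoly C[n]})
    (q : 'rV[C]_n) (h : {fraction {mpoly C[n]}}) : Prop :=
  exists (u : {fraction {mpoly C[n]}}) (w : 'I_n -> {fraction {mpoly C[n]}}),
    [/\ local_ring q u, forall k, local_ring q (w k)
      & h = u * tofrac g + \sum_k w k * tofrac g^`M(k)].

(* The C-vector space local_ring q / tjurina_ideal g q has a basis with t
   elements, the classes of the e k. *)
Definition tjurina_number (C : fieldType) (n : nat) (g : {mpoly C[n]})
    (q : 'rV[C]_n) (t : nat) : Prop :=
  exists e : 'I_t -> {fraction {mpoly C[n]}},
    (forall k, local_ring q (e k)) /\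
    forall h, local_ring q h ->
      exists! c : 'rV[C]_t,
        tjurina_ideal g q (h - \sum_k tofrac (c 0 k)%:MP * e k).

(* The index of the first nonzero coordinate of p (2 if p = 0). *)
Definition chart (C : fieldType) (p : 'rV[C]_3) : 'I_3 :=
  if p 0 0 != 0 then 0 else if p 0 1 != 0 then 1 else ord_max.

(* Each point of the projective plane has exactly one representative whose
   first nonzero coordinate is 1. *)
Definition P2_point (C : fieldType) (p : 'rV[C]_3) : Prop :=
  p 0 (chart p) = 1.

Definition singular_point (C : fieldType) (f : {mpoly C[3]}) (p : 'rV[C]_3) :
    Prop :=
  [/\ P2_point p, f.@[p 0] = 0 & forall i, f^`M(i).@[p 0] = 0].

Definition dehomogenize (C : fieldType) (i : 'I_3) (f : {mpoly C[3]}) :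
    {mpoly C[2]} :=
  f \mPo [tuple if unlift i k is Some j then 'X_j else 1 | k < 3].

Definition affine_coord (C : fieldType) (i : 'I_3) (p : 'rV[C]_3) : 'rV[C]_2 :=
  \row_j p 0 (lift i j).

Definition point_tjurina (C : fieldType) (f : {mpoly C[3]}) (p : 'rV[C]_3)
    (t : nat) : Prop :=
  tjurina_number (dehomogenize (chart p) f) (affine_coord (chart p) p) t.

Definition total_tjurina (C : fieldType) (f : {mpoly C[3]}) (tau : nat) :
    Prop :=
  exists (s : seq 'rV[C]_3) (t : 'rV[C]_3 -> nat),
    [/\ uniq s, forall p, p \in s <-> singular_point f p,
        forall p, p \in s -> point_tjurina f p (t p)
      & tau = (\sum_(p <- s) t p)%N].

(* Main.v *)
Require Import Defs.
From HB Require Import structures.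
From mathcomp Require Import all_boot all_order all_algebra.
From mathcomp Require Import reals.
From mathcomp Require Import complex.
From mathcomp Require Import mpoly.
From mathcomp Require Import boolp ring zify perm.

Set Implicit Arguments.
Unset Strict Implicit.
Unset Printing Implicit Defensive.

Import Order.TTheory GRing.Theory Num.Theory.
Local Open Scope ring_scope.

(** Let D = d - 1, and let J be the Jacobian ideal of f.

    Numerical part. The kernel of a generating family of D0 f is a second
    syzygy module over a polynomial ring in three variables, so the variables
    form a regular sequence on it and a minimal system of generators of it is
    a basis (minimal_rows_independent, graded_syzygy_basis). This produces the
    minimal resolution. The alternating sum of the Hilbert functions of its
    terms is a quadratic polynomial in high degrees; it is the Hilbert function
    of S / J, which is bounded because J contains two coprime forms, the
    equation and a general combination of its derivatives (jacobian_bounded).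
    Hence the two leading coefficients vanish, which gives m = (m - 2) + 2 and
    the relation c_1 + ... + c_(m-2) = (D + d_1) + ... + (D + d_m) - 3 D, while
    the Hilbert function has a constant value t in high degrees, half of the
    difference of the sums of squares (resolution_numerics). In terms of the
    epsilons the linear relation says that their sum is d_1 + d_2 - D, that is,
    the type of the curve. Since every epsilon is at least 1
    (second_syzygy_degree, by a count of ranks), type two forces either one
    epsilon equal to 2 or two of them equal to 1, and conversely. Exponents do
    not depend on the choice of generators (exponents_unique), so t can be
    computed from them.

    Geometric part. It remains to see that t is the total Tjurina number. A
    general linear form l acts surjectively, hence bijectively, on the high
    degree part of S / J (exists_linear_form, mul_l_inj). Over an algebraically
    closed field, an ideal containing J without a power of l has a zero
    (nullstellensatz); so a form of high degree lies in J as soon as it does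
    locally at each singular point (jacobian_of_local), and together with the
    Chinese remainder theorem t is the sum of the dimensions of the local
    quotients (jacobian_decomposition). Dehomogenization in the chart of a
    singular point identifies such a quotient with the Tjurina algebra, Euler's
    identity expressing the derivative that is lost in the chart by the
    equation and the other two (tjurina_idealE, point_tjurina_of_local). *)

(** * Unique factorization in polynomial rings *)

Section Divisibility.
Variable R : idomainType.
Implicit Types (a b c p q : R) (s : seq R).

Definition divides a b := exists c, b = c * a.

Definition prime_elt p :=
  [/\ p != 0, p \isn't a GRing.unit
    & forall a b, divides p (a * b) -> divides p a \/ divides p b].

(** The factors are prime and not merely irreducible, so that existence of a
    factorization already makes it unique. *)
Definition factors a s := exists u, u \is a GRing.unit /\
  (forall p, p \in s -> prime_elt p) /\ a = u * \prod_(p <- s) p.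

Lemma divides_mull a b c : divides a b -> divides a (c * b).
Proof. by case=> e ->; exists (c * e); rewrite mulrA. Qed.

Lemma divides_mulr a b c : divides a b -> divides a (b * c).
Proof. by rewrite mulrC; apply: divides_mull. Qed.

Lemma dividesD a b c : divides a b -> divides a c -> divides a (b + c).
Proof. by move=> [x ->] [y ->]; exists (x + y); rewrite mulrDl. Qed.

Lemma dividesN a b : divides a b -> divides a (- b).
Proof. by move=> [x ->]; exists (- x); rewrite mulNr. Qed.

Lemma divides0 a : divides a 0.
Proof. by exists 0; rewrite mul0r. Qed.

Lemma divides_trans a b c : divides a b -> divides b c -> divides a c.
Proof. by move=> [x ->] [y ->]; exists (y * x); rewrite mulrA. Qed.

Lemma prime_ndvd_unit p u : prime_elt p -> u \is a GRing.unit -> ~ divides p u.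
Proof.
case=> _ /negP np _ uu [c uE]; apply: np.
by move: uu; rewrite uE unitrM => /andP[].
Qed.

Lemma prime_dvd_prod p s : prime_elt p -> divides p (\prod_(q <- s) q) ->
  exists2 q, q \in s & divides p q.
Proof.
move=> pp; elim: s => [|x s IHs].
  by rewrite big_nil => /(prime_ndvd_unit pp)[]; rewrite unitr1.
rewrite big_cons; case: (pp) => _ _ /[apply] -[px|/IHs [q qs pq]].
  by exists x; rewrite ?mem_head.
by exists q; rewrite // inE qs orbT.
Qed.

Lemma prime_dvd_factors p a s : prime_elt p -> factors a s -> divides p a ->
  exists2 q, q \in s & divides p q.
Proof.
move=> pp [u [uu [_ ->]]]; case: (pp) => _ _ /[apply] -[/(prime_ndvd_unit pp)//|].
exact: prime_dvd_prod.
Qed.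

Lemma prime_dvd_prime p q : prime_elt p -> prime_elt q -> divides p q ->
  exists2 u, u \is a GRing.unit & q = u * p.
Proof.
move=> [p0 pnu _] [q0 qnu qP] [c qE]; exists c => //.
have : divides q (c * p) by exists 1; rewrite -qE mul1r.
case/qP=> -[e eE].
  have : p \is a GRing.unit.
    apply/unitrPr; exists e; apply: (mulIf q0).
    by rewrite mul1r [RHS]qE eE; ring.
  by move=> pu; rewrite pu in pnu.
apply/unitrPr; exists e; apply: (mulIf p0).
by rewrite mul1r [RHS]eE qE; ring.
Qed.

Lemma factorsM a b s t : factors a s -> factors b t -> factors (a * b) (s ++ t).
Proof.
move=> [u [uu [us ->]]] [v [vv [vt ->]]]; exists (u * v); split.
  by rewrite unitrM uu vv.
split; last by rewrite big_cat /= mulrACA.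
by move=> p; rewrite mem_cat => /orP[/us|/vt].
Qed.

Lemma factors_prime p : prime_elt p -> factors p [:: p].
Proof.
move=> pp; exists 1; split; rewrite ?unitr1 // big_seq1 mul1r; split=> //.
by move=> q; rewrite inE => /eqP ->.
Qed.

Lemma factors_cons p s a : factors a (p :: s) ->
  prime_elt p /\ exists2 b, factors b s & a = p * b.
Proof.
case=> u [uu [us ->]]; split; first by apply: us; rewrite mem_head.
exists (u * \prod_(q <- s) q); last by rewrite big_cons mulrCA.
by exists u; split=> //; split=> // q qs; apply: us; rewrite inE qs orbT.
Qed.

Lemma factors_nil a : factors a [::] -> a \is a GRing.unit.
Proof. by case=> u [uu [_ ->]]; rewrite big_nil mulr1. Qed.

Lemma factors_remove p a s : prime_elt p -> factors a s -> divides p a ->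
  exists b t, [/\ factors b t, (size t < size s)%N & a = p * b].
Proof.
move=> pp fa /(prime_dvd_factors pp fa) [q qs pq].
case: fa => u [uu [us aE]].
case: (prime_dvd_prime pp (us _ qs) pq) => v vv qE.
exists (u * v * \prod_(r <- rem q s) r), (rem q s); split.
- exists (u * v); split; first by rewrite unitrM uu vv.
  by split=> // r /mem_rem /us.
- by rewrite size_rem //; case: (s) qs.
- by rewrite aE (perm_big _ (perm_to_rem qs)) big_cons /= qE -!mulrA mulrCA
             [p * _]mulrCA.
Qed.

(** Coprimality is meant in the sense of having no common prime divisor, which
    in a factorial ring is what allows cancellation in divisibility. *)
Definition coprime_elt a b := forall p, prime_elt p -> divides p a -> ~ divides p b.

Lemma coprime_cancel a b c : (exists s, factors a s) -> coprime_elt a b ->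
  divides a (b * c) -> divides a c.
Proof.
case=> s; elim: s a c => [|p s IHs] a c.
  by move/factors_nil => ua _ _; exists (c / a); rewrite divrK.
case/factors_cons => pp [a' fa' ->] cop [e eE].
have npb : ~ divides p b.
  by apply: cop => //; exists a'; rewrite mulrC.
have : divides p (b * c) by exists (e * a'); rewrite eE -mulrA [a' * p]mulrC.
case: (pp) => p0 _ /[apply] -[//|[c' cE]].
have : divides a' (b * c').
  exists e; apply: (mulIf p0); rewrite -mulrA -cE eE.
  by rewrite -mulrA [a' * p]mulrC.
case/(IHs _ _ fa').
  by move=> q pq qa; apply: cop => //; apply: divides_mull.
by move=> g gE; exists g; rewrite cE gE mulrAC mulrA.
Qed.

Lemma lowest_terms a b : (exists s, factors a s) ->
  exists g a' b', [/\ a = g * a', b = g * b', coprime_elt a' b'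
                    & exists s, factors a' s].
Proof.
case=> s; have [n] := ubnP (size s); elim: n => // n IHn in s a b *.
rewrite ltnS => sn fa.
have [cop|/existsNP [p /not_implyP [pp /not_implyP [pa /contrapT pb]]]] :=
    pselect (coprime_elt a b).
  by exists 1, a, b; split; rewrite ?mul1r //; exists s.
have [a1 [t [fa1 ts aE]]] := factors_remove pp fa pa.
case: pb => b1 bE.
have [g [a' [b' [a1E b1E cop fa']]]] := IHn t a1 b1 (leq_trans ts sn) fa1.
exists (p * g), a', b'; split=> //; first by rewrite aE a1E mulrA.
by rewrite bE b1E mulrC mulrA.
Qed.

End Divisibility.

Definition factorial_ring (R : idomainType) :=
  forall a : R, a != 0 -> exists s, factors a s.

Section Gauss.
Variable R : idomainType.
Hypothesis ufdR : factorial_ring R.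
Implicit Types (p q g h : {poly R}) (a c : R).

Lemma divides_polyC a p : divides a%:P p <-> forall i, divides a p`_i.
Proof.
split=> [[q ->] i|H]; first by rewrite coefMC; exists q`_i.
have {}H i : exists c, p`_i == c * a by case: (H i) => c ->; exists c.
exists (\poly_(i < size p) xchoose (H i)); apply/polyP => i.
rewrite coefMC coef_poly; case: ltnP => [_|si].
  exact: (eqP (xchooseP (H i))).
by rewrite mul0r nth_default.
Qed.

(** Gauss's lemma in its simplest form: compare leading coefficients after
    deleting the leading terms that the prime divides. *)
Lemma prime_polyC a : prime_elt a -> prime_elt a%:P.
Proof.
case=> a0 anu aP; split; first by rewrite polyC_eq0.
  by rewrite poly_unitE coefC eqxx size_polyC a0.
move=> p q; have [n] := ubnP (size p + size q).
elim: n => // n IHn in p q *; rewrite ltnS => sn apq.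
have [->|p0] := eqVneq p 0; first by left; apply: divides0.
have [->|q0] := eqVneq q 0; first by right; apply: divides0.
have drop (r : {poly R}) : r != 0 -> divides a (lead_coef r) ->
    exists r' : {poly R}, (size r' < size r)%N /\ divides a%:P (r - r').
  move=> r0 [c cE]; exists (r - (lead_coef r)%:P * 'X^((size r).-1)).
  rewrite subKr; split; last first.
    by exists (c%:P * 'X^((size r).-1)); rewrite cE polyCM mulrAC.
  rewrite -[X in (_ < X)%N]prednK ?size_poly_gt0 // ltnS.
  apply/leq_sizeP => j; rewrite leq_eqVlt => /orP[/eqP <-|ltj].
    by rewrite coefB coefCM coefXn eqxx mulr1 lead_coefE subrr.
  rewrite coefB coefCM coefXn gtn_eqF // mulr0 subr0 nth_default //.
  by rewrite -[size r]prednK ?size_poly_gt0.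
have : divides a (lead_coef p * lead_coef q).
  by move/divides_polyC: apq => /(_ (size (p * q)).-1); rewrite -lead_coefE lead_coefM.
case/aP => [/(drop _ p0)|/(drop _ q0)] [r [sr ar]].
- have arq : divides a%:P (r * q).
    rewrite -[r](subrK p) -[r - p]opprB mulrDl mulNr.
    by apply: dividesD => //; apply: dividesN; apply: divides_mulr.
  have [|ar'|?] := IHn r q _ arq; last by right.
    by apply: leq_trans sn; rewrite ltn_add2r.
  by left; rewrite -[p](subrK r); apply: dividesD.
- have arq : divides a%:P (p * r).
    rewrite -[r](subrK q) -[r - q]opprB mulrDr mulrN.
    by apply: dividesD => //; apply: dividesN; apply: divides_mull.
  have [|?|ar'] := IHn p r _ arq; first by apply: leq_trans sn; rewrite ltn_add2l.
    by left.
  by right; rewrite -[q](subrK r); apply: dividesD.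
Qed.

Definition primitive p := forall a, prime_elt a -> ~ divides a%:P p.

Lemma primitive_part p : p != 0 ->
  exists c q, [/\ c != 0, p = c%:P * q & primitive q].
Proof.
move=> p0; have := ufdR (a := lead_coef p); rewrite lead_coef_eq0 => /(_ p0)[s].
have [n] := ubnP (size s); elim: n => // n IHn in s p p0 *; rewrite ltnS => sn fs.
have [prim|/existsNP [a /not_implyP [pa /contrapT [q qE]]]] := pselect (primitive p).
  by exists 1, p; rewrite oner_neq0 mul1r.
have lE : lead_coef p = a * lead_coef q by rewrite qE lead_coefM lead_coefC mulrC.
have [|b [t [fb ts bE]]] := factors_remove pa fs.
  by exists (lead_coef q); rewrite lE mulrC.
have a0 : a != 0 by case: pa.
have lqE : lead_coef q = b by apply: (mulfI a0); rewrite -lE.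
have q0 : q != 0 by apply: contraNneq p0 => q0; rewrite qE q0 mul0r.
rewrite -lqE in fb.
have [c [r [c0 rE pr]]] := IHn t q q0 (leq_trans ts sn) fb.
exists (c * a), r; split; rewrite ?mulf_neq0 //.
by rewrite qE rE polyCM mulrAC.
Qed.

(** The prime factors of c cannot divide the primitive p, so they divide h. *)
Lemma primitive_cancel p q h c : c != 0 -> primitive p -> c%:P * q = h * p ->
  divides p q.
Proof.
move=> /ufdR [s]; elim: s c h => [|a s IHs] c h.
  move=> /factors_nil uc _ E; exists ((c^-1)%:P * h).
  by rewrite -mulrA -E mulrA -polyCM mulVr // mul1r.
case/factors_cons => pa [b fb ->] prim E.
have pa' := prime_polyC pa; case: (pa') => a0 _ aP.
have : divides a%:P (h * p).
  by exists (b%:P * q); rewrite -E polyCM; ring.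
case/aP => [[g gE]|/(prim _ pa)//].
apply: (IHs b g) => //; apply: (mulfI a0).
by rewrite mulrA -polyCM E gE; ring.
Qed.

(** A factorization up to a constant becomes a factorization when the prime
    factors of the constant are removed from one of the two factors in turn. *)
Lemma gauss p g h c : c != 0 -> c%:P * p = g * h ->
  exists g' h', [/\ p = g' * h', size g' = size g & size h' = size h].
Proof.
move=> /ufdR [s]; elim: s c g h => [|a s IHs] c g h.
  move=> /factors_nil uc E; exists ((c^-1)%:P * g), h; split=> //.
    by rewrite -mulrA -E mulrA -polyCM mulVr // mul1r.
  by rewrite mul_polyC size_scale // invr_eq0; apply: contraTneq uc => ->; rewrite unitr0.
case/factors_cons => pa [b fb ->] E.
have pa' := prime_polyC pa; case: (pa') => aP0 _ aP.
have a0 : a != 0 by case: pa.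
have : divides a%:P (g * h).
  by exists (b%:P * p); rewrite -E polyCM; ring.
case/aP => [[r rE]|[r rE]].
- have [|g' [h' [pE sg sh]]] := IHs b r h fb.
    by apply: (mulfI aP0); rewrite mulrA -polyCM E rE; ring.
  exists g', h'; split=> //.
  by rewrite rE mulrC mul_polyC size_scale.
- have [|g' [h' [pE sg sh]]] := IHs b g r fb.
    by apply: (mulfI aP0); rewrite mulrA -polyCM E rE; ring.
  exists g', h'; split=> //.
  by rewrite rE mulrC mul_polyC size_scale.
Qed.

Lemma factors_polyC c : c != 0 -> exists s, factors c%:P s.
Proof.
case/ufdR=> s [u [uu [us ->]]]; exists (map polyC s), u%:P.
split; first exact: rmorph_unit.
split; first by move=> _ /mapP[a /us pa ->]; apply: prime_polyC.
by rewrite polyCM rmorph_prod /= big_map.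
Qed.

(** Over the fraction field, a primitive polynomial without proper factors is
    irreducible, hence prime; pseudo-division expresses this without leaving
    the ring, and the denominators are then removed by primitivity. *)
Lemma primitive_irreducible_prime p : primitive p -> (1 < size p)%N ->
  (forall g h, p = g * h -> (size g <= 1)%N \/ (size h <= 1)%N) ->
  prime_elt p.
Proof.
move=> prim sp irr.
have p0 : p != 0 by rewrite -size_poly_gt0 ltnW.
split=> //; first by rewrite poly_unitE gtn_eqF.
move=> a b [q qE].
have back r : p %| r -> divides p r.
  case/Pdiv.Idomain.dvdpP => -[c k] /= c0; rewrite -mul_polyC => E.
  exact: primitive_cancel E.
have pab : p %| a * b by rewrite qE dvdp_mull.
have /Pdiv.Idomain.dvdpP [[c k] /= c0] := dvdp_gcdl p a.
rewrite -mul_polyC => /(gauss c0) [k' [g' [pE sk sg]]].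
have sz := irr _ _ pE.
have g0 : gcdp p a != 0 by rewrite gcdp_eq0 negb_and p0.
case: sz => [sk1|sg1]; last first.
  right; apply: back; rewrite -(Gauss_dvdpr _ (q := a)) //.
  by rewrite /coprimep eqn_leq -sg sg1 sg size_poly_gt0.
left; apply: back; apply: dvdp_trans (dvdp_gcdr p a).
have k0 : size k' = 1%N.
  apply/eqP; rewrite eqn_leq sk1 size_poly_gt0.
  by apply: contraNneq p0 => k0; rewrite pE k0 mul0r.
have szE : size (gcdp p a) = size p.
  by rewrite [in RHS]pE size_mul -?size_poly_gt0 ?k0 ?sg ?size_poly_gt0 ?g0.
have := dvdp_size_eqp (dvdp_gcdl p a); rewrite szE eqxx => /esym.
by rewrite /eqp => /andP[].
Qed.

(** By induction on the degree, as the content factors in the ring of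
    coefficients and a primitive polynomial either splits into factors of
    smaller degree or is prime. *)
Lemma factorial_poly : factorial_ring {poly R}.
Proof.
move=> p; have [n] := ubnP (size p); elim: n => // n IHn in p *.
rewrite ltnS => sn p0; have [c [q [c0 pE prim]]] := primitive_part p0.
have sq : size q = size p by rewrite pE mul_polyC size_scale.
have q0 : q != 0 by rewrite -size_poly_gt0 sq size_poly_gt0.
suff [s fs] : exists s, factors q s.
  have [t ft] := factors_polyC c0.
  by exists (t ++ s); rewrite pE; apply: factorsM.
have [s1|s1] := leqP (size q) 1.
  by rewrite [q]size1_polyC //; apply: factors_polyC; rewrite -polyC_eq0 -size1_polyC.
have [irr|] := pselect (forall g h, q = g * h -> (size g <= 1)%N \/ (size h <= 1)%N).
  by exists [:: q]; apply/factors_prime/primitive_irreducible_prime.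
move=> /existsNP [g /existsNP [h /not_implyP [qE /not_orP [/negP + /negP]]]].
rewrite -!ltnNge => sg sh.
have g0 : g != 0 by rewrite -size_poly_gt0 ltnW.
have h0 : h != 0 by rewrite -size_poly_gt0 ltnW.
move: sq; rewrite qE size_mul // => sgh.
have [||s fs] := IHn g; [lia|by []|].
have [||t ft] := IHn h; [lia|by []|].
by exists (s ++ t); apply: factorsM.
Qed.

End Gauss.

Lemma factorial_iso (R S : idomainType) (phi : {rmorphism R -> S})
  (psi : {rmorphism S -> R}) : cancel phi psi -> cancel psi phi ->
  factorial_ring S -> factorial_ring R.
Proof.
move=> phiK psiK ufd a a0.
have dvd x y : divides (psi x) y <-> divides x (phi y).
  split=> -[c cE]; first by exists (phi c); rewrite cE rmorphM psiK.
  by exists (psi c); rewrite -[y]phiK cE rmorphM.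
have [|s [u [uu [us aE]]]] := ufd (phi a).
  by apply: contraNneq a0 => /(congr1 psi); rewrite phiK rmorph0 => ->.
exists (map psi s), (psi u); split; first exact: rmorph_unit.
split; last by rewrite -[a]phiK aE rmorphM rmorph_prod /= big_map.
move=> _ /mapP[p /us [p0 pnu pP] ->]; split.
- by apply: contraNneq p0 => /(congr1 phi); rewrite psiK rmorph0 => ->.
- by apply: contraNN pnu => /(rmorph_unit phi); rewrite psiK.
- by move=> x y /dvd; rewrite rmorphM => /pP [] /dvd; [left|right].
Qed.

Section MPolyFactorial.
Variables (n : nat) (K : fieldType).

(** The inverse of the identification muni of polynomials in n + 1 variables with
    polynomials in the last variable over those in the first n. *)
Definition muni_inv (p : {poly {mpoly K[n]}}) : {mpoly K[n.+1]} :=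
  (map_poly (@mwiden n K) p).['X_ord_max].

Fact muni_inv_additive : additive muni_inv.
Proof. by move=> p q; rewrite /muni_inv raddfB /= hornerD hornerN. Qed.

Fact muni_inv_multiplicative : multiplicative muni_inv.
Proof.
split=> [p q|]; first by rewrite /muni_inv rmorphM hornerM.
by rewrite /muni_inv rmorph1 hornerC.
Qed.

HB.instance Definition _ := GRing.isAdditive.Build _ _ muni_inv muni_inv_additive.
HB.instance Definition _ :=
  GRing.isMultiplicative.Build _ _ muni_inv muni_inv_multiplicative.

Lemma muniX (m : 'X_{1..n.+1}) : muni 'X_[m] =
  'X_[[multinom m (widen_ord (leqnSn n) i) | i < n]] *: 'X^(m ord_max)
  :> {poly {mpoly K[n]}}.
Proof. by rewrite muniE msuppX big_seq1 mcoeffX eqxx scale1r. Qed.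

Lemma muniK : cancel (@muni n K) muni_inv.
Proof.
move=> p; rewrite {2}[p]mpolyE {1}[p]mpolyE (raddf_sum (@muni n K)).
rewrite (raddf_sum muni_inv); apply: eq_bigr => m _ /=.
rewrite muniZ -mul_polyC rmorphM /= [in X in X * _]/muni_inv map_polyC hornerC /=.
rewrite mwidenC mul_mpolyC; congr (_ *: _).
rewrite muniX -mul_polyC rmorphM /= /muni_inv map_polyC hornerC /=.
rewrite map_polyXn hornerXn mwidenX mpolyXn -mpolyXD; congr 'X_[_].
apply/mnmP => i; rewrite mnmDE mulmnE mnm1E.
case: (unliftP ord_max i) => [j|] ->; last first.
  by rewrite mnmwiden_ordmax eqxx mul1n add0n.
have -> : lift ord_max j = widen_ord (leqnSn n) j.
  by apply: val_inj; exact: lift_max.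
rewrite mnmwiden_widen mnmE -val_eqE /= gtn_eqF ?mul0n ?addn0 //.
Qed.

Lemma muni_mwiden (q : {mpoly K[n]}) : muni (mwiden q) = q%:P.
Proof.
rewrite {1}[q]mpolyE [in RHS](mpolyE q) (raddf_sum (@mwiden n K)).
rewrite (raddf_sum (@muni n K)) (raddf_sum polyC); apply: eq_bigr => m _ /=.
rewrite mwidenZ muniZ mwidenX muniX mnmwiden_ordmax expr0 alg_polyC.
rewrite -mul_mpolyC polyCM -mul_polyC; congr (_ * _%:P); congr 'X_[_].
by apply/mnmP => i; rewrite mnmE mnmwiden_widen.
Qed.

Lemma muni_invK : cancel muni_inv (@muni n K).
Proof.
move=> p; rewrite -{1}[p]coefK -[in RHS](coefK p) !poly_def (raddf_sum muni_inv).
rewrite (raddf_sum (@muni n K)); apply: eq_bigr => i _.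
rewrite -mul_polyC /=.
rewrite rmorphM rmorphM /=
  /muni_inv map_polyC hornerC muni_mwiden; congr (_ * _).
rewrite map_polyXn hornerXn rmorphXn /=; congr (_ ^+ _).
rewrite muniX mnm1E eqxx expr1.
have -> : [multinom U_(ord_max)%MM (widen_ord (leqnSn n) j) | j < n] = 0%MM.
  by apply/mnmP => j; rewrite mnmE mnm1E mnm0E -val_eqE /= gtn_eqF.
by rewrite mpolyX0 scale1r.
Qed.

End MPolyFactorial.

Lemma factorial_mpoly (K : fieldType) n : factorial_ring {mpoly K[n]}.
Proof.
elim: n => [|n IHn]; last first.
  exact: factorial_iso (@muniK n K) (@muni_invK n K) (factorial_poly IHn).
move=> p p0; exists [::], p; rewrite big_nil mulr1; split=> //.
rewrite [p]nvar0_mpolyC; apply: rmorph_unit; rewrite unitfE.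
by apply: contraNneq p0 => p0; rewrite [p]nvar0_mpolyC p0 mpolyC0.
Qed.

(** * Dimensions of quotients of subspaces *)

Section QuotientDimension.
Variable K : fieldType.

Section OneSpace.
Variable V : lmodType K.
Implicit Types (P U W : V -> Prop).

Definition subspace P := P 0 /\ forall a u v, P u -> P v -> P (a *: u + v).

Definition lincomb n (e : 'I_n -> V) (c : 'rV[K]_n) := \sum_k c 0 k *: e k.

(** The dimension of the image of P in the quotient by U. Stating it by unique
    coordinates, as for a Tjurina number, avoids forming the quotient. *)
Definition qdim P U n := exists e : 'I_n -> V, (forall k, P (e k)) /\
  forall h, P h -> exists! c : 'rV[K]_n, U (h - lincomb e c).

Definition qfree P U n (e : 'I_n -> V) := (forall k, P (e k)) /\
  forall c : 'rV[K]_n, U (lincomb e c) -> c = 0.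

Definition qspan P U n (e : 'I_n -> V) :=
  forall h, P h -> exists c : 'rV[K]_n, U (h - lincomb e c).

Section Subspace.
Variable P : V -> Prop.
Hypothesis sP : subspace P.

Lemma sub0 : P 0. Proof. by case: sP. Qed.

Lemma subZ a u : P u -> P (a *: u).
Proof. by move=> Pu; rewrite -[_ *: _]addr0; apply: sP.2 => //; apply: sub0. Qed.

Lemma subD u v : P u -> P v -> P (u + v).
Proof. by move=> Pu Pv; rewrite -[u]scale1r; apply: sP.2. Qed.

Lemma subN u : P u -> P (- u).
Proof. by move=> Pu; rewrite -scaleN1r; apply: subZ. Qed.

Lemma subB u v : P u -> P v -> P (u - v).
Proof. by move=> Pu Pv; apply: subD => //; apply: subN. Qed.

Lemma sub_sum (I : Type) (r : seq I) (Q : pred I) (F : I -> V) :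
  (forall i, Q i -> P (F i)) -> P (\sum_(i <- r | Q i) F i).
Proof. by move=> H; elim/big_ind: _; [apply: sub0|apply: subD|]. Qed.

Lemma sub_lincomb n (e : 'I_n -> V) c : (forall k, P (e k)) -> P (lincomb e c).
Proof. by move=> H; apply: sub_sum => i _; apply: subZ. Qed.

Lemma subBC u v : P (u - v) -> P (v - u).
Proof. by move=> H; rewrite -opprB; apply: subN. Qed.

Lemma subB_trans v u w : P (u - v) -> P (v - w) -> P (u - w).
Proof. by move=> H1 H2; rewrite -[u](subrK v) -addrA; apply: subD. Qed.

End Subspace.

Lemma subspaceI P Q : subspace P -> subspace Q -> subspace (fun v => P v /\ Q v).
Proof.
move=> [P0 PD] [Q0 QD]; split=> // a u v [Pu Qu] [Pv Qv].
by split; [apply: PD|apply: QD].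
Qed.

Lemma subspace0 : subspace (fun v : V => v = 0).
Proof. by split=> // a u v -> ->; rewrite scaler0 addr0. Qed.

Lemma lincomb0 n (e : 'I_n -> V) : lincomb e 0 = 0.
Proof. by rewrite /lincomb big1 // => k _; rewrite mxE scale0r. Qed.

Lemma lincombB n (e : 'I_n -> V) c c' : lincomb e (c - c') = lincomb e c - lincomb e c'.
Proof. by rewrite /lincomb -sumrB; apply: eq_bigr => k _; rewrite !mxE scalerBl. Qed.

Lemma lincomb_mul m n (e : 'I_n -> V) (M : 'M_(m, n)) c :
  lincomb e (c *m M) = lincomb (fun i => lincomb e (row i M)) c.
Proof.
rewrite /lincomb; under eq_bigr do rewrite mxE scaler_suml.
rewrite exchange_big /=; apply: eq_bigr => i _; rewrite scaler_sumr.
by apply: eq_bigr => k _; rewrite scalerA mxE.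
Qed.

Definition ecat m n (e : 'I_m -> V) (e' : 'I_n -> V) (i : 'I_(m + n)) :=
  match split i with inl j => e j | inr k => e' k end.

Lemma lincomb_cat m n (e : 'I_m -> V) (e' : 'I_n -> V) c :
  lincomb (ecat e e') c = lincomb e (lsubmx c) + lincomb e' (rsubmx c).
Proof.
rewrite /lincomb big_split_ord /=; congr (_ + _); apply: eq_bigr => i _.
  by rewrite mxE /ecat (unsplitK (inl i)).
by rewrite mxE /ecat (unsplitK (inr i)).
Qed.

Lemma ecatP P m n (e : 'I_m -> V) (e' : 'I_n -> V) :
  (forall k, P (e k)) -> (forall k, P (e' k)) -> forall k, P (ecat e e' k).
Proof. by move=> H H' k; rewrite /ecat; case: splitP. Qed.

Lemma qdimP P U n : subspace P -> subspace U ->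
  qdim P U n <-> exists e : 'I_n -> V, qfree P U e /\ qspan P U e.
Proof.
move=> sP sU; split=> [[e [Pe He]]|[e [[Pe fe] spe]]]; exists e.
  split; last by move=> h /He [c [Uc _]]; exists c.
  split=> // c Uc; have [c0 [_ uc]] := He _ (sub_lincomb sP c Pe).
  have <- : c0 = c by apply: uc; rewrite subrr; apply: sub0.
  by apply: uc; rewrite lincomb0 subr0.
split=> // h /spe [c Uc]; exists c; split=> // c' Uc'.
apply/esym/eqP; rewrite -subr_eq0; apply/eqP/fe; rewrite lincombB.
by have := subB sU Uc Uc'; rewrite opprB addrC addrA subrK.
Qed.

Lemma qdim_equiv P U P' U' n : (forall v, P v <-> P' v) ->
  (forall v, U v <-> U' v) -> qdim P U n -> qdim P' U' n.
Proof.
move=> PP' UU' [e [Pe He]]; exists e; split=> [k|h /PP' /He [c [Uc uc]]].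
  exact/PP'.
by exists c; split; [exact/UU'|move=> c' /UU'; apply: uc].
Qed.

(** The coordinates of a free family in a basis are the rows of a matrix of full
    row rank, which is invertible when the sizes agree. *)
Lemma qfree_le P U n n' (e : 'I_n -> V) : subspace P -> subspace U ->
  qdim P U n' -> qfree P U e -> (n <= n')%N /\ (n = n' -> qspan P U e).
Proof.
move=> sP sU /(qdimP _ sP sU) [e' [[Pe' _] spe']] [Pe fe].
have /choice [r rP] : forall i, exists c : 'rV_n', U (e i - lincomb e' c).
  by move=> i; apply: spe'.
pose M := \matrix_i r i.
have UM c : U (lincomb e c - lincomb e' (c *m M)).
  rewrite lincomb_mul /lincomb -sumrB; apply: sub_sum => // i _.
  by rewrite -scalerBr rowK; apply: subZ.
have fM : row_free M.
  apply: inj_row_free => c cM; apply: fe; have := UM c.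
  by rewrite cM lincomb0 subr0.
split; first by rewrite -(eqP fM) rank_leq_col.
move=> nn' h /spe' [c Uc]; subst n'.
exists (c *m invmx M); apply: (subB_trans sU Uc); apply: (subBC sU).
by have := UM (c *m invmx M); rewrite mulmxKV // -row_free_unit.
Qed.

Lemma qdim_uniq P U n n' : subspace P -> subspace U ->
  qdim P U n -> qdim P U n' -> n = n'.
Proof.
move=> sP sU d d'; apply/eqP; rewrite eqn_leq.
have [e [fe _]] := (qdimP _ sP sU).1 d; have [e' [fe' _]] := (qdimP _ sP sU).1 d'.
by rewrite (qfree_le sP sU d' fe).1 (qfree_le sP sU d fe').1.
Qed.

Lemma qfree_extend P U n (e : 'I_n -> V) h : subspace U ->
  qfree P U e -> P h -> (forall c, ~ U (h - lincomb e c)) ->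
  qfree P U (ecat e (fun _ : 'I_1 => h)).
Proof.
move=> sU [Pe fe] Ph nh; split; first exact: ecatP.
move=> c; rewrite lincomb_cat [X in _ + X]/lincomb big_ord1.
set t := rsubmx c 0 0 => Uc.
have t0 : t = 0.
  apply/eqP; apply: contra_notT (nh (- t^-1 *: lsubmx c)) => t0.
  suff -> : h - lincomb e (- t^-1 *: lsubmx c) = t^-1 *: (lincomb e (lsubmx c) + t *: h).
    exact: subZ.
  rewrite scalerDr scalerA mulVf // scale1r addrC; congr (_ + _).
  rewrite /lincomb -sumrN scaler_sumr; apply: eq_bigr => i _.
  by rewrite !mxE mulNr scaleNr opprK scalerA.
move: Uc; rewrite t0 scale0r addr0 => /fe lc0.
rewrite -[c]hsubmxK lc0; apply/rowP => i; rewrite mxE [RHS]mxE.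
by case: splitP => j _; rewrite ?mxE // ord1 -t0 /t mxE.
Qed.

(** A family that is free and does not span can be enlarged, and this stops at the
    bound N. *)
Lemma qdim_exists P U N : subspace P -> subspace U ->
  (forall n (e : 'I_n -> V), qfree P U e -> (n <= N)%N) ->
  exists2 n, (n <= N)%N & qdim P U n.
Proof.
move=> sP sU bnd.
suff H k n (e : 'I_n -> V) : (N - n <= k)%N -> qfree P U e ->
    exists2 n, (n <= N)%N & qdim P U n.
  apply: (H N 0%N (fun i => 0)); first by rewrite leq_subr.
  by split=> [[]//|c _]; apply/rowP => -[].
elim: k n e => [|k IHk] n e kn fe;
  have [spe|/existsNP[h /not_implyP[Ph /forallNP nh]]] := pselect (qspan P U e).
- by exists n; [exact: bnd fe | apply/qdimP => //; exists e].
- by have := bnd _ _ (qfree_extend sU fe Ph nh); lia.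
- by exists n; [exact: bnd fe | apply/qdimP => //; exists e].
- have fe' := qfree_extend sU fe Ph nh; have := bnd _ _ fe' => bn.
  by apply: IHk fe'; lia.
Qed.

Lemma qdim_add P W U a b : subspace P -> subspace W -> subspace U ->
  (forall v, U v -> W v) -> (forall v, W v -> P v) ->
  qdim P W a -> qdim W U b -> qdim P U (a + b).
Proof.
move=> sP sW sU UW WP /(qdimP _ sP sW) [e [[Pe fe] spe]].
case/(qdimP _ sW sU) => [e' [[We' fe'] spe']]; apply/qdimP => //.
exists (ecat e e'); split.
  split; first by apply: ecatP => // k; apply: WP.
  move=> c; rewrite lincomb_cat => Uc.
  have lc0 : lsubmx c = 0.
    apply: fe; rewrite -[lincomb _ _](addrK (lincomb e' (rsubmx c))).
    by apply: subB => //; [apply: UW|apply: sub_lincomb].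
  move: Uc; rewrite lc0 lincomb0 add0r => /fe' rc0.
  by rewrite -[c]hsubmxK lc0 rc0 row_mx0.
move=> h /spe [c Wc]; have [c' Uc'] := spe' _ Wc.
exists (row_mx c c'); rewrite lincomb_cat row_mxKl row_mxKr.
by rewrite opprD addrA.
Qed.

Lemma qdim0 P U : subspace P -> subspace U -> (forall v, P v -> U v) -> qdim P U 0.
Proof.
move=> sP sU PU; apply/qdimP => //; exists (fun _ => 0); split.
  by split=> [[]//|c _]; apply/rowP => -[].
by move=> h Ph; exists 0; rewrite lincomb0 subr0; apply: PU.
Qed.

Lemma qdim0_sub P U : subspace U -> qdim P U 0 -> forall v, P v -> U v.
Proof.
move=> sU [e [_ He]] v /He [c [+ _]].
by rewrite /lincomb big_ord0 subr0.
Qed.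

Lemma qdim_chain (P : nat -> V -> Prop) (n : nat -> nat) m :
  (forall i, subspace (P i)) -> (forall i v, P i.+1 v -> P i v) ->
  (forall i, (i < m)%N -> qdim (P i) (P i.+1) (n i)) ->
  qdim (P 0) (P m) (\sum_(i < m) n i).
Proof.
move=> sP dP; elim: m => [|m IHm] H; first by rewrite big_ord0; apply: qdim0.
have sub0m v : P m v -> P 0 v.
  by elim: m {IHm H} => // m IHm /dP.
rewrite big_ord_recr /=; apply: (@qdim_add _ (P m)) => //; last exact: H.
  exact: dP.
by apply: IHm => i im; apply: H; apply: ltnW.
Qed.

End OneSpace.

Section TwoSpaces.
Variables (V V' : lmodType K) (phi : V -> V').
Hypothesis phiL : linear phi.
Variables (P U : V -> Prop) (P' U' : V' -> Prop).
Hypotheses (sP : subspace P) (sU : subspace U) (sP' : subspace P') (sU' : subspace U').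

Let psi : {linear V -> V'} := HB.pack phi (GRing.isLinear.Build _ _ _ _ phi phiL).

Lemma linear_fun0 : phi 0 = 0. Proof. exact: (raddf0 psi). Qed.

Lemma linear_funB u v : phi (u - v) = phi u - phi v.
Proof. exact: (raddfB psi). Qed.

Lemma lincomb_linear n (e : 'I_n -> V) c : phi (lincomb e c) = lincomb (phi \o e) c.
Proof.
rewrite -[phi]/(psi : V -> V') /lincomb raddf_sum; apply: eq_bigr => k _.
by rewrite /= -[phi]/(psi : V -> V') linearZ.
Qed.

Lemma subspace_preim : subspace (fun v => U' (phi v)).
Proof.
split=> [|a u v]; first by rewrite linear_fun0; apply: sub0.
by rewrite phiL; apply: sU'.2.
Qed.

Hypothesis PP' : forall a, P a -> P' (phi a).
Hypothesis UU' : forall a, P a -> U' (phi a) -> U a.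

Lemma qfree_map n (e : 'I_n -> V) : qfree P U e -> qfree P' U' (phi \o e).
Proof.
case=> Pe fe; split=> [k|c]; first exact: PP'.
by rewrite -lincomb_linear => /(UU' (sub_lincomb sP c Pe)); apply: fe.
Qed.

Lemma qdim_inj n' : qdim P' U' n' -> exists2 n, (n <= n')%N & qdim P U n.
Proof.
move=> d; apply: qdim_exists => // n e /qfree_map fe.
exact: (qfree_le sP' sU' d fe).1.
Qed.

Lemma qdim_inj_le n n' : qdim P U n -> qdim P' U' n' -> (n <= n')%N.
Proof.
move=> d /qdim_inj [m mn /(qdim_uniq sP sU d) ->]; exact: mn.
Qed.

Lemma qdim_inj_surj n : qdim P U n -> qdim P' U' n ->
  forall h, P' h -> exists2 a, P a & U' (h - phi a).
Proof.
move=> /(qdimP _ sP sU) [e [fe _]] d'; have fe' := qfree_map fe.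
have [_ /(_ erefl) spe] := qfree_le sP' sU' d' fe'.
move=> h /spe [c]; rewrite -lincomb_linear => Uc; exists (lincomb e c) => //.
by apply: sub_lincomb => //; case: fe.
Qed.

Hypothesis U'U : forall a, P a -> U a -> U' (phi a).
Hypothesis surj : forall h, P' h -> exists2 a, P a & U' (h - phi a).

(** The hypotheses say that phi induces an isomorphism from the quotient of P by U
    to the quotient of P' by U'. *)
Lemma qdim_iso n : qdim P U n <-> qdim P' U' n.
Proof.
have fwd m : qdim P U m -> qdim P' U' m.
  move=> /(qdimP _ sP sU) [e [fe spe]]; apply/qdimP => //; exists (phi \o e).
  split; first exact: qfree_map.
  move=> h /surj [a Pa Uh]; have [c Uc] := spe _ Pa; exists c.
  apply: (subB_trans sU' Uh); rewrite -lincomb_linear -linear_funB; apply: U'U => //.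
  by apply: subB => //; apply: sub_lincomb => //; case: fe.
split=> [|d']; first exact: fwd.
by have [m _ d] := qdim_inj d'; rewrite -(qdim_uniq sP' sU' (fwd _ d) d').
Qed.

End TwoSpaces.

Lemma qdim_quotient (V : lmodType K) (P U W : V -> Prop) n : subspace P ->
  subspace U -> subspace W -> (forall v, U v -> W v) -> qdim P U n ->
  exists2 m, (m <= n)%N & qdim P W m.
Proof.
move=> sP sU sW UW; apply: (@qdim_inj V V idfun) => // a _; exact: UW.
Qed.

Lemma qdim_restrict (V : lmodType K) (P U : V -> Prop) n : subspace P ->
  qdim P (fun v => P v /\ U v) n <-> qdim P U n.
Proof.
move=> sP; split=> -[e [Pe He]]; exists e; split=> // h Ph.
  have [c [[_ Uc] uc]] := He h Ph; exists c; split=> // c' Uc'; apply: uc; split=> //.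
  by apply: subB => //; apply: sub_lincomb.
have [c [Uc uc]] := He h Ph; exists c; split; last by move=> c' [_]; apply: uc.
by split=> //; apply: subB => //; apply: sub_lincomb.
Qed.

Lemma qdim_subspace (V : lmodType K) (P P' U : V -> Prop) n : subspace P ->
  subspace P' -> subspace U -> (forall v, P v -> P' v) -> qdim P' U n ->
  exists2 m, (m <= n)%N & qdim P U m.
Proof. by move=> sP sP' sU PP'; apply: (@qdim_inj V V idfun). Qed.

End QuotientDimension.

(** * Graded pieces of free modules *)

Section Grading.
Variable K : fieldType.
Local Notation S := {mpoly K[3]}.
Implicit Types (p q : S) (y z : int).

Definition hcomp z p : S := if z is Posz n then pihomog mdeg n p else 0.

Lemma homogz0 z : homogz z (0 : S).
Proof. by case: z => n //=; apply: rpred0. Qed.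

Lemma homogzD z p q : homogz z p -> homogz z q -> homogz z (p + q).
Proof. by case: z => n /=; [apply: rpredD|move=> -> ->; rewrite addr0]. Qed.

Lemma homogzZ z c p : homogz z p -> homogz z (c *: p).
Proof. by case: z => n /=; [apply: rpredZ|move=> ->; rewrite scaler0]. Qed.

Lemma homogzN z p : homogz z p -> homogz z (- p).
Proof. by rewrite -scaleN1r; apply: homogzZ. Qed.

Lemma homogzM y z p q : homogz y p -> homogz z q -> homogz (y + z) (p * q).
Proof.
case: y z => [m|m] [n|n] /=; first exact: dhomogM.
- by move=> _ ->; rewrite mulr0; apply: homogz0.
- by move=> ->; rewrite mul0r; move=> _; apply: homogz0.
- by move=> -> _; rewrite mul0r.
Qed.

Lemma subspace_homogz z : subspace (homogz z : S -> Prop).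
Proof. by split=> [|c p q hp hq]; [apply: homogz0|apply/homogzD/hq/homogzZ]. Qed.

Lemma hcomp0 z : hcomp z 0 = 0.
Proof. by case: z => n //=; rewrite raddf0. Qed.

Lemma hcompD z p q : hcomp z (p + q) = hcomp z p + hcomp z q.
Proof. by case: z => n /=; rewrite ?addr0 // raddfD. Qed.

Lemma hcompB z p q : hcomp z (p - q) = hcomp z p - hcomp z q.
Proof. by case: z => n /=; rewrite ?subr0 // raddfB. Qed.

Lemma hcomp_sum z (I : Type) (r : seq I) (Q : pred I) (F : I -> S) :
  hcomp z (\sum_(i <- r | Q i) F i) = \sum_(i <- r | Q i) hcomp z (F i).
Proof. by apply: big_morph; [apply: hcompD|apply: hcomp0]. Qed.

Lemma homogz_hcomp z p : homogz z (hcomp z p).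
Proof. by case: z => n //=; apply: pihomogP. Qed.

Lemma hcompE y z p : homogz y p -> hcomp z p = if y == z then p else 0.
Proof.
case: eqP => [<-|/eqP yz]; first by case: y => n //=; apply: pihomog_dE.
case: y yz => [m|m] yz /=; last by move=> ->; rewrite hcomp0.
by case: z yz => n //= mn; apply: pihomog_ne0.
Qed.

Lemma hcomp_id z p : homogz z p -> hcomp z p = p.
Proof. by move/(hcompE z); rewrite eqxx. Qed.

Lemma sum_hcomp p : p = \sum_(k < msize p) hcomp k p.
Proof. exact: pihomog_partitionE. Qed.

(** This is what makes graded maps commute with taking homogeneous components, and
    so allows every relation to be replaced by a homogeneous one. *)
Lemma hcompM z e p q : homogz e q -> hcomp z (p * q) = hcomp (z - e) p * q.
Proof.
move=> hq; rewrite {1}[p]sum_hcomp [in RHS](sum_hcomp p) mulr_suml !hcomp_sum mulr_suml.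
apply: eq_bigr => k _; have hk := homogz_hcomp k p.
rewrite (hcompE _ (homogzM hk hq)) (hcompE _ hk) eq_sym -subr_eq eq_sym.
by case: eqP; rewrite ?mul0r.
Qed.

(** The degree k part of the direct sum of the S(- a j). *)
Definition piece m (a : 'I_m -> int) (k : int) (u : 'rV[S]_m) :=
  forall j, homogz (k - a j) (u 0 j).

Definition rcomp m (a : 'I_m -> int) (k : int) (u : 'rV[S]_m) :=
  \row_j hcomp (k - a j) (u 0 j).

Lemma piece_rcomp m (a : 'I_m -> int) k u : piece a k (rcomp a k u).
Proof. by move=> j; rewrite mxE; apply: homogz_hcomp. Qed.

Lemma rcomp_id m (a : 'I_m -> int) k u : piece a k u -> rcomp a k u = u.
Proof. by move=> H; apply/rowP => j; rewrite mxE hcomp_id. Qed.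

Lemma rcompM m n (a : 'I_m -> int) (b : 'I_n -> int) (M : 'M_(m, n)) k u :
  graded_mx a b M -> rcomp b k (u *m M) = rcomp a k u *m M.
Proof.
move=> gM; apply/rowP => i; rewrite mxE !mxE hcomp_sum; apply: eq_bigr => j _.
by rewrite (hcompM _ _ (gM j i)) mxE; congr (hcomp _ _ * _); ring.
Qed.

Lemma pieceM m n (a : 'I_m -> int) (b : 'I_n -> int) (M : 'M_(m, n)) k u :
  graded_mx a b M -> piece a k u -> piece b k (u *m M).
Proof. by move=> gM pu; rewrite -(rcomp_id pu) -(rcompM _ _ gM); apply: piece_rcomp. Qed.

End Grading.

(** An alias of the type of row vectors, on which the scalars are the elements of
    the field instead of the polynomials. *)
Definition polyrow (K : fieldType) m : Type := 'rV[{mpoly K[3]}]_m.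

Section RowSpace.
Variables (K : fieldType) (m : nat).
Local Notation S := {mpoly K[3]}.

HB.instance Definition _ := GRing.Zmodule.on (polyrow K m).

Definition polyrow_scale (c : K) (v : polyrow K m) : polyrow K m := c%:MP *: (v : 'rV[S]_m).

Fact polyrow_scaleA a b v : polyrow_scale a (polyrow_scale b v) = polyrow_scale (a * b) v.
Proof. by rewrite /polyrow_scale scalerA mpolyCM. Qed.
Fact polyrow_scale1 : left_id 1 polyrow_scale.
Proof. by move=> v; rewrite /polyrow_scale mpolyC1 scale1r. Qed.
Fact polyrow_scaleDr : right_distributive polyrow_scale +%R.
Proof. by move=> a u v; rewrite /polyrow_scale scalerDr. Qed.
Fact polyrow_scaleDl v : {morph polyrow_scale^~ v : a b / a + b}.
Proof. by move=> a b; rewrite /polyrow_scale mpolyCD scalerDl. Qed.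

HB.instance Definition _ := GRing.Zmodule_isLmodule.Build K (polyrow K m)
  polyrow_scaleA polyrow_scale1 polyrow_scaleDr polyrow_scaleDl.

Lemma polyrow_lin (c : K) (u v : polyrow K m) i :
  (c *: u + v : polyrow K m) 0 i = c *: (u 0 i) + v 0 i.
Proof. by rewrite !mxE mul_mpolyC. Qed.

Lemma subspace_piece (a : 'I_m -> int) k :
  subspace (piece a k : polyrow K m -> Prop).
Proof.
split=> [j|c u v pu pv j]; first by rewrite mxE; apply: homogz0.
by rewrite polyrow_lin; apply/homogzD/pv/homogzZ.
Qed.

End RowSpace.

Lemma polyrow_mulmx_linear (K : fieldType) m n (M : 'M[{mpoly K[3]}]_(m, n)) :
  linear (fun u : polyrow K m => u *m M : polyrow K n).
Proof. by move=> c u v; rewrite mulmxDl; congr (_ + _); apply/esym/scalemxAl. Qed.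

(** The dimension of the space of ternary forms of degree z. *)
Definition binomz (z : int) : nat := if z is Posz n then 'C(n + 2, 2) else 0.

Section Hilbert.
Variable K : fieldType.
Local Notation S := {mpoly K[3]}.

Lemma qdim_homogz (z : int) : qdim (homogz z : S -> Prop) (fun p => p = 0) (binomz z).
Proof.
case: z => [k|k]; last first.
  apply: qdim0; [exact: subspace_homogz|exact: subspace0|by []].
have [f fL [g fK gK]] := dhomog_vecaxiom 2 K k.
rewrite /binomz -bin_sub ?leq_addl // addnK.
have gL : linear g.
  move=> c u v; apply: (can_inj fK); rewrite gK.
  by rewrite (fL : linear f) !gK.
apply/qdimP; [exact: subspace_homogz|exact: subspace0|].
exists (fun i => val (g (delta_mx 0 i))).
have lcE c : lincomb (fun i => val (g (delta_mx 0 i))) c = val (g c).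
  have vgL : linear (fun r => val (g r)) by move=> a u v; rewrite gL.
  rewrite -[RHS](_ : val (g (lincomb (delta_mx 0) c)) = _).
    by rewrite (lincomb_linear vgL).
  by congr (val (g _)); rewrite [RHS]row_sum_delta.
split; [split=> [i|c]|move=> p hp].
- exact: valP.
- rewrite lcE => gc0; rewrite -[c]gK.
  have -> : g c = 0 by apply: val_inj.
  by have := linear_funB fL 0 0; rewrite !subrr.
- by exists (f (DHomog hp)); rewrite lcE fK subrr.
Qed.

(** The Hilbert function of the direct sum of the S(- a j). *)
Definition hilb m (a : 'I_m -> int) (k : int) : nat := (\sum_j binomz (k - a j)%R)%N.

(** In the filtration by the vanishing of the first i coordinates, the successive
    quotients are the degree k parts of the summands. *)
Lemma qdim_piece m (a : 'I_m -> int) k :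
  qdim (piece a k : polyrow K m -> Prop) (fun u => u = 0) (hilb a k).
Proof.
pose P (i : nat) (u : polyrow K m) := piece a k u /\ forall j : 'I_m, (j < i)%N -> u 0 j = 0.
have sP i : subspace (P i).
  apply: subspaceI; first exact: subspace_piece.
  split=> [j _|c u v u0 v0 j ji]; first by rewrite mxE.
  by rewrite polyrow_lin u0 // v0 // scaler0 addr0.
have dP i v : P i.+1 v -> P i v.
  by case=> pv v0; split=> // j ji; apply: v0; apply: ltnW.
pose n i := if insub i is Some j then binomz (k - a j) else 0%N.
rewrite /hilb (eq_bigr (fun j : 'I_m => n j)); last first.
  by move=> j _; rewrite /n valK.
have P0 u : P 0 u <-> piece a k u by split=> [[]//|pu]; split.
have Pm u : P m u <-> u = 0.
  split=> [[_ u0]|->]; first by apply/rowP => j; rewrite u0 // mxE.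
  by have [? ?] := sub0 (sP m).
apply: (qdim_equiv P0 Pm); apply: qdim_chain => // i im; pose j := Ordinal im.
have -> : n i = binomz (k - a j) by rewrite /n insubT.
apply/(@qdim_iso _ _ S (fun u : polyrow K m => u 0 j) _ _ _ (homogz (k - a j)) (fun p => p = 0)).
- by move=> c u v; rewrite polyrow_lin.
- exact: sP.
- exact: sP.
- exact: subspace_homogz.
- exact: subspace0.
- by move=> u [pu _]; apply: pu.
- move=> u [pu u0] uj; split=> // l; rewrite ltnS leq_eqVlt => /orP[/eqP li|/u0//].
  by rewrite (_ : l = j) //; apply: val_inj.
- by move=> u _ [_ ->//].
- move=> h hh; exists (\row_l if l == j then h else 0); last by rewrite mxE eqxx subrr.
  split=> l; first by rewrite mxE; case: eqP => [->//|_]; apply: homogz0.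
  by move=> li; rewrite mxE -val_eqE /= ltn_eqF.
- exact: qdim_homogz.
Qed.

Lemma subspace_image m n (b : 'I_n -> int) (M : 'M[S]_(m, n)) k :
  subspace (fun v : polyrow K n => piece b k v /\ exists u : 'rV_m, v = u *m M).
Proof.
apply: subspaceI; first exact: subspace_piece.
split=> [|c u v [u' ->] [v' ->]]; first by exists 0; rewrite mul0mx.
by exists (c *: (u' : polyrow K m) + v' : polyrow K m); rewrite (polyrow_mulmx_linear M).
Qed.

Lemma subspace_kernel m n (a : 'I_m -> int) (M : 'M[S]_(m, n)) k :
  subspace (fun u : polyrow K m => piece a k u /\ u *m M = 0).
Proof.
apply: subspaceI; first exact: subspace_piece.
exact: (@subspace_preim _ _ _ _ (polyrow_mulmx_linear M) (fun v => v = 0) (@subspace0 _ _)).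
Qed.

(** Rank-nullity in each degree for a graded map. *)
Lemma qdim_image m n (a : 'I_m -> int) (b : 'I_n -> int) (M : 'M[S]_(m, n)) k :
  graded_mx a b M ->
  exists r s : nat, [/\ (r + s)%N = hilb a k,
    qdim (fun v : polyrow K n => piece b k v /\ exists u : 'rV_m, v = u *m M)
         (fun v => v = 0) r
  & qdim (fun u : polyrow K m => piece a k u /\ u *m M = 0) (fun u => u = 0) s].
Proof.
move=> gM.
have sI := subspace_image b M k; have sK := subspace_kernel a M k.
have s0 := @subspace0 K (polyrow K m); have s0' := @subspace0 K (polyrow K n).
have sP := subspace_piece K a k.
have [s _ ds] : exists2 s, (s <= hilb a k)%N &
    qdim (fun u : polyrow K m => piece a k u /\ u *m M = 0) (fun u => u = 0) s.
  by apply: qdim_subspace (qdim_piece a k) => // u [].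
have [r _ dr] : exists2 r, (r <= hilb a k)%N &
    qdim (piece a k : polyrow K m -> Prop) (fun u : polyrow K m => piece a k u /\ u *m M = 0) r.
  apply: qdim_quotient (qdim_piece a k) => // v ->; exact: sub0 sK.
exists r, s; split=> //.
  apply: (qdim_uniq sP s0 _ (qdim_piece a k)).
  by apply: qdim_add dr ds => // v; [move->; exact: sub0 sK|case].
refine ((qdim_iso (polyrow_mulmx_linear M) sP sK sI s0' _ _ _ _ _).1 dr).
- by move=> u pu; split; [exact: pieceM gM pu|exists u].
- by move=> u pu uM.
- by move=> u _ [].
- move=> v [pv [u vE]]; exists (rcomp a k u); first exact: piece_rcomp.
  by rewrite -(rcompM _ _ gM) -vE (rcomp_id pv) subrr.
Qed.

End Hilbert.

(** * The Hilbert function of the Jacobian ring from a resolution *)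

Definition jacobian_ideal (K : fieldType) (f p : {mpoly K[3]}) :=
  exists v : 'rV[{mpoly K[3]}]_3, p = \sum_i v 0 i * f^`M(i).

(** What determines the Hilbert function of the Jacobian ring. *)
Definition resolution (K : fieldType) (d : nat) (f : {mpoly K[3]}) (ds cs : seq nat) :=
  exists (B : 'M[{mpoly K[3]}]_(size cs, size ds)) (A : 'M[{mpoly K[3]}]_(size ds, 3)),
    [/\ graded_mx (fun i => (nth 0%N cs i)%:Z) (fun j => d%:Z + (nth 0%N ds j)%:Z - 1) B,
        graded_mx (fun j => d%:Z + (nth 0%N ds j)%:Z - 1) (fun _ => d%:Z - 1) A,
        (forall w : 'rV_(size cs), w *m B = 0 -> w = 0),
        exact_mx B A & exact_mx A (gradient f)].

Section JacobianHilbert.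
Variables (K : fieldType) (d : nat) (f : {mpoly K[3]}).
Local Notation S := {mpoly K[3]}.

Lemma jacobianP p : jacobian_ideal f p <->
  exists v : 'rV[S]_3, (p%:M : 'rV_1) = v *m gradient f.
Proof.
split=> -[v vE]; exists v.
  apply/rowP => j; rewrite ord1 !mxE eqxx mulr1n vE.
  by apply: eq_bigr => i _; rewrite mxE.
have /rowP/(_ 0) := vE; rewrite !mxE eqxx mulr1n => ->.
by apply: eq_bigr => i _; rewrite mxE.
Qed.

Lemma D0_gradient (v : 'rV[S]_3) : D0 f v <-> v *m gradient f = 0.
Proof.
split=> [vf|/rowP/(_ 0)]; [apply/rowP => j; rewrite ord1|]; rewrite !mxE.
  by rewrite -[RHS]vf; apply: eq_bigr => i _; rewrite mxE.
by move=> vf; rewrite /D0 -[RHS]vf; apply: eq_bigr => i _; rewrite mxE.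
Qed.

Lemma jacobianD p q : jacobian_ideal f p -> jacobian_ideal f q -> jacobian_ideal f (p + q).
Proof.
move=> [v ->] [w ->]; exists (v + w); rewrite -big_split.
by apply: eq_bigr => i _; rewrite mxE mulrDl.
Qed.

Lemma jacobian0 : jacobian_ideal f 0.
Proof. by exists 0; rewrite big1 // => i _; rewrite mxE mul0r. Qed.

Lemma jacobianM p q : jacobian_ideal f q -> jacobian_ideal f (p * q).
Proof.
move=> [v ->]; exists (p *: v); rewrite mulr_sumr.
by apply: eq_bigr => i _; rewrite mxE mulrA.
Qed.

Lemma jacobianZ c p : jacobian_ideal f p -> jacobian_ideal f (c *: p).
Proof. by rewrite -mul_mpolyC; apply: jacobianM. Qed.

Lemma subspace_jacobian : subspace (jacobian_ideal f).
Proof. by split=> [|c p q Jp Jq]; [apply: jacobian0|apply/jacobianD/Jq/jacobianZ]. Qed.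

Lemma jacobian_deriv i : jacobian_ideal f f^`M(i).
Proof.
exists (delta_mx 0 i); rewrite (bigD1 i) //= mxE !eqxx mul1r big1 ?addr0 // => j ji.
by rewrite mxE (negPf ji) mul0r.
Qed.

Lemma homog_deriv (e : nat) (g : S) i : g \is e.-homog -> homogz (e%:Z - 1) g^`M(i).
Proof.
move=> /dhomogP hg; case: e hg => [|e] hg.
  have -> : g = (g@_0)%:MP.
    apply/mpolyP => m; rewrite mcoeffC; have [->|m0] := eqVneq m 0%MM.
      by rewrite mulr1.
    rewrite mulr0; apply/eqP; rewrite mcoeff_eq0; apply: contraNN m0 => /hg.
    by move/eqP; rewrite mdeg_eq0.
  by rewrite mderivC; apply: homogz0.
have -> : e.+1%:Z - 1 = e by lia.
apply/dhomogP => m; rewrite mcoeff_msupp mcoeff_deriv => nz.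
have /hg : (m + U_(i))%MM \in msupp g.
  by rewrite mcoeff_msupp; apply: contraNneq nz => ->; rewrite mul0rn.
by rewrite /= mdegD mdeg1 addn1 => -[].
Qed.

Lemma graded_gradient : f \is d.-homog ->
  graded_mx (fun _ : 'I_3 => d%:Z - 1) (fun _ : 'I_1 => 0) (gradient f).
Proof. by move=> hf i j; rewrite mxE subr0; apply: homog_deriv. Qed.

Lemma qdim_jacobian (k : int) r1 : f \is d.-homog ->
  qdim (fun v : polyrow K 1 => piece (fun=> 0) k v /\ exists u : 'rV_3, v = u *m gradient f)
       (fun v => v = 0) r1 ->
  exists t, qdim (homogz k) (jacobian_ideal f) t /\ (t + r1)%N = binomz k.
Proof.
move=> hf dr1.
have sJ : subspace (fun p : S => homogz k p /\ jacobian_ideal f p).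
  by apply: subspaceI; [exact: subspace_homogz|exact: subspace_jacobian].
have sH := subspace_homogz K k; have s0 := @subspace0 K S.
have dJ : qdim (fun p : S => homogz k p /\ jacobian_ideal f p) (fun p => p = 0) r1.
  have phiL : linear (fun p : S => p%:M : polyrow K 1).
    move=> c p q; apply/rowP => j.
    by rewrite ord1 [RHS]polyrow_lin !mxE eqxx !mulr1n.
  refine ((qdim_iso phiL sJ (@subspace0 _ _) (subspace_image _ (gradient f) k)
    (@subspace0 _ _) _ _ _ _ _).2 dr1) => [p [hp Jp]|p _|p _ ->|v [pv [u vE]]].
  - split; last exact/jacobianP.
    by move=> j; rewrite ord1 mxE eqxx mulr1n subr0.
  - by move=> /rowP/(_ 0); rewrite !mxE eqxx mulr1n.
  - by apply/rowP => j; rewrite !mxE mul0rn.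
  - have vS : v = (v 0 0)%:M by apply/rowP => j; rewrite ord1 mxE eqxx mulr1n.
    exists (v 0 0); last by rewrite -vS subrr.
    split; first by have := pv 0; rewrite subr0.
    by apply/jacobianP; exists u; rewrite -vS.
have [t _ dt] : exists2 t, (t <= binomz k)%N &
    qdim (homogz k) (fun p : S => homogz k p /\ jacobian_ideal f p) t.
  by apply: qdim_quotient (qdim_homogz K k) => // v ->; exact: sub0 sJ.
exists t; split; first exact/(qdim_restrict _ _ sH).
apply: (qdim_uniq sH (@subspace0 _ _) _ (qdim_homogz K k)).
by apply: (qdim_add sH sJ s0 _ _ dt dJ) => [v ->|v []//]; exact: sub0 sJ.
Qed.

(** The Euler characteristic of the degree k part of the resolution is zero;
    subtractions are avoided by moving terms to the other side. *)
Lemma hilbert_of_resolution (ds cs : seq nat) (k : int) : f \is d.-homog ->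
  resolution d f ds cs -> exists t : nat, qdim (homogz k) (jacobian_ideal f) t /\
  (t + hilb (fun _ : 'I_3 => (d%:Z - 1)%R) k +
     hilb (fun i : 'I_(size cs) => (nth 0 cs i)%:Z) k = binomz k +
     hilb (fun j : 'I_(size ds) => (d%:Z + (nth 0 ds j)%:Z - 1)%R) k)%N.
Proof.
move=> hf [B [A [gB gA injB exBA exA]]].
have [r1 [s1 [E1 dr1 ds1]]] := qdim_image k (graded_gradient hf).
have [r2 [s2 [E2 dr2 ds2]]] := qdim_image k gA.
have [r3 [s3 [E3 dr3 ds3]]] := qdim_image k gB.
have s3E : s3 = 0%N.
  apply: (qdim_uniq (subspace_kernel _ B k) (@subspace0 _ _) ds3).
  apply: qdim0 => [||v [_ /injB]//]; [exact: subspace_kernel|exact: subspace0].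
have r3E : r3 = s2.
  apply: (qdim_uniq (subspace_kernel _ A k) (@subspace0 _ _) _ ds2).
  by apply: qdim_equiv dr3 => // v; split=> -[pv] /exBA.
have r2E : r2 = s1.
  apply: (qdim_uniq (subspace_kernel _ (gradient f) k) (@subspace0 _ _) _ ds1).
  by apply: qdim_equiv dr2 => // v; split=> -[pv] /exA.
have [t [dt Et]] := qdim_jacobian hf dr1.
exists t; split=> //.
by rewrite -Et -E1 -E2 -E3 s3E r3E r2E; ring.
Qed.

(** The Hilbert functions of free modules are explicit polynomials in degrees
    beyond all the twists; the factor 2 clears the denominator. *)
Lemma sum_binomz (k : int) (s : seq int) : (forall a, a \in s -> a <= k) ->
  2 * (\sum_(a <- s) binomz (k - a)%R)%N%:Z =
  (size s)%:Z * (k ^+ 2 + 3 * k + 2) - (2 * k + 3) * (\sum_(a <- s) a)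
  + \sum_(a <- s) a ^+ 2.
Proof.
elim: s => [|a s IHs] H; first by rewrite !big_nil !mulr0 mul0r subr0 addr0.
rewrite !big_cons PoszD mulrDr IHs; last by move=> b bs; apply: H; rewrite inE bs orbT.
have : a <= k by apply: H; rewrite mem_head.
rewrite -subr_ge0; case E : (k - a) => [n|n] // _.
have -> : k = n%:Z + a by rewrite -E; ring.
have Ex : 2 * ('C(n + 2, 2))%:Z = (n%:Z + 2) * (n%:Z + 1).
  have := mul_bin_diag n.+2 1; rewrite bin1 addn2 /=; lia.
by rewrite /binomz Ex /= -[(size s).+1]addn1 PoszD; ring.
Qed.

End JacobianHilbert.

(** * Reduced curves have finitely supported Jacobian ring *)

Section Reduced.
Variable K : numFieldType.
Local Notation S := {mpoly K[3]}.
Implicit Types (f g p : S).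

Lemma euler_identity (d : nat) f : f \is d.-homog ->
  \sum_i 'X_i * f^`M(i) = d%:R *: f.
Proof.
move=> /dhomogP hf.
transitivity (\sum_(m <- msupp f) \sum_i 'X_i * (f@_m *: ('X_[m])^`M(i))).
  rewrite exchange_big /=; apply: eq_bigr => i _.
  rewrite {1}[f]mpolyE raddf_sum mulr_sumr; apply: eq_bigr => m _ /=.
  by rewrite mderivZ.
rewrite [in RHS](mpolyE f) scaler_sumr big_seq [in RHS]big_seq.
apply: eq_bigr => m /hf mE; rewrite -mE /= mdegE natr_sum scaler_suml.
apply: eq_bigr => i _; rewrite mderivX -!scalerAr scalerA mulrC -scalerA.
have [mi|mi] := eqVneq (m i) 0%N; first by rewrite mi !scale0r.
congr (_ *: (_ *: _)); rewrite -mpolyXD addmC submK //.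
by rewrite lep1mP.
Qed.

Lemma jacobian_self d f : (0 < d)%N -> f \is d.-homog -> jacobian_ideal f f.
Proof.
move=> d0 hf; have nz : d%:R != 0 :> K by rewrite pnatr_eq0 -lt0n.
have : jacobian_ideal f (d%:R *: f).
  rewrite -(euler_identity hf); elim/big_ind: _ => [||i _].
  - exact: jacobian0.
  - exact: jacobianD.
  - exact/jacobianM/jacobian_deriv.
by move/(jacobianZ d%:R^-1); rewrite scalerK.
Qed.

Lemma deriv_eq0_const p : (forall i, p^`M(i) = 0) -> p = (p@_0)%:MP.
Proof.
move=> p0; apply/mpolyP => m; rewrite mcoeffC.
have [->|m0] := eqVneq m 0%MM; first by rewrite mulr1.
have [i mi] : exists i, m i != 0%N.
  apply/existsP; apply: contraNT m0 => /existsPn m0; apply/eqP/mnmP => i.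
  by rewrite mnm0E; apply/eqP; have := m0 i; rewrite negbK.
have /mpolyP/(_ (m - U_(i))%MM) := p0 i.
rewrite mcoeff_deriv mcoeff0 submK ?lep1mP // => /eqP.
by rewrite mulrn_eq0 /= => /eqP ->; rewrite mulr0.
Qed.

Lemma msize_deriv p i : p^`M(i) != 0 -> (msize p^`M(i) < msize p)%N.
Proof.
move=> p0; rewrite -(mlead_deg p0).
have := mlead_supp p0; rewrite mcoeff_msupp mcoeff_deriv => nz.
have : (mlead p^`M(i) + U_(i))%MM \in msupp p.
  by rewrite mcoeff_msupp; apply: contraNneq nz => ->; rewrite mul0rn.
by move/msize_mdeg_lt; rewrite mdegD mdeg1 addn1.
Qed.

Lemma divides_msize p g : g != 0 -> divides p g -> (msize p <= msize g)%N.
Proof.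
move=> g0 [c gE]; have c0 : c != 0 by apply: contraNneq g0 => c0; rewrite gE c0 mul0r.
have p0 : p != 0 by apply: contraNneq g0 => p0; rewrite gE p0 mulr0.
by rewrite gE msizeM // -(mlead_deg c0) addSn /= leq_addl.
Qed.

(** Derivatives have smaller degree, so they would all vanish, which in
    characteristic zero happens for constants only. *)
Lemma prime_ndvd_derivs p : prime_elt p -> exists i, ~ divides p p^`M(i).
Proof.
move=> [p0 pnu _]; apply/existsNP => pd; move/negP: pnu; apply.
have dp0 i : p^`M(i) = 0.
  apply/eqP; apply: contraT => pi0.
  by have := divides_msize pi0 (pd i); rewrite leqNgt msize_deriv.
rewrite (deriv_eq0_const dp0); apply: rmorph_unit; rewrite unitfE.
by apply: contraNneq p0 => p0; rewrite (deriv_eq0_const dp0) p0.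
Qed.

(** A prime dividing all partial derivatives divides the curve by Euler's
    identity, and then divides it twice since it cannot divide all of its own
    derivatives. *)
Lemma reduced_gradient d f p : (0 < d)%N -> reduced_curve d f -> prime_elt p ->
  exists i, ~ divides p f^`M(i).
Proof.
move=> d0 [f0 hf sqf] pp; apply/existsNP => pd.
have [h fE] : divides p f.
  have -> : f = (d%:R^-1)%:MP * \sum_i 'X_i * f^`M(i).
    rewrite (euler_identity hf) mul_mpolyC scalerA mulVf ?scale1r //.
    by rewrite pnatr_eq0 -lt0n.
  apply: divides_mull; elim/big_ind: _ => [||i _]; first exact: divides0.
    exact: dividesD.
  exact: divides_mull.
have [i npi] := prime_ndvd_derivs pp.
case: (pp) => p0 /negP pnu pP.
have : divides p (h * p^`M(i)).
  have := pd i; rewrite {1}fE mderivM => H.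
  rewrite -[h * _](addKr (h^`M(i) * p)); apply: dividesD => //.
  by apply/dividesN/divides_mull; exists 1; rewrite mul1r.
case/pP => // -[h' hE]; apply: pnu; apply: (sqf p h').
by rewrite fE hE expr2; ring.
Qed.

(** Three of the combinations divisible by p would recover a, b and c by inverting a
    Vandermonde matrix. *)
Lemma generic_avoid (p a b c : S) : prime_elt p ->
  ~ (divides p a /\ divides p b /\ divides p c) ->
  exists N, forall t : nat, (N <= t)%N ->
    ~ divides p (a + t%:R *: b + (t%:R ^+ 2) *: c).
Proof.
move=> pp nabc; apply/not_existsP => H; apply: nabc.
have {}H N : exists2 t, (N <= t)%N & divides p (a + t%:R *: b + (t%:R ^+ 2) *: c).
  by apply: contra_notP (H N) => /forall2NP nt t Nt; case: (nt t).
have unscale (x : K) g : x != 0 -> divides p (x *: g) -> divides p g.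
  move=> x0 [e eE]; exists (x^-1 *: e); rewrite -scalerAl -eE scalerA mulVf //.
  by rewrite scale1r.
have [r _ dr] := H 0%N; have [s rs ds] := H r.+1; have [t st dt] := H s.+1.
have sub (u v : nat) : (u < v)%N -> divides p (a + u%:R *: b + (u%:R ^+ 2) *: c) ->
    divides p (a + v%:R *: b + (v%:R ^+ 2) *: c) -> divides p (b + (u + v)%:R *: c).
  move=> uv du dv; apply: (unscale (v%:R - u%:R)).
    by rewrite -natrB ?(ltnW uv) // pnatr_eq0 subn_eq0 -ltnNge.
  rewrite (_ : (_ - _) *: _ = (a + v%:R *: b + (v%:R ^+ 2) *: c) - (a + u%:R *: b + (u%:R ^+ 2) *: c)).
    by apply: dividesD => //; apply: dividesN.
  by rewrite -!mul_mpolyC natrD !mpolyCD mpolyCN !rmorphXn /=; ring.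
have d1 := sub _ _ rs dr ds; have d2 := sub _ _ st ds dt.
have dc : divides p c.
  apply: (unscale (t%:R - r%:R)).
    have rt : (r < t)%N by lia.
    by rewrite -natrB ?(ltnW rt) // pnatr_eq0 subn_eq0 -ltnNge.
  rewrite (_ : (_ - _) *: _ = (b + (s + t)%:R *: c) - (b + (r + s)%:R *: c)).
    by apply: dividesD => //; apply: dividesN.
  by rewrite -!mul_mpolyC !natrD !mpolyCD mpolyCN; ring.
have dZ (x : K) g : divides p g -> divides p (x *: g).
  by move=> dg; rewrite -mul_mpolyC; apply: divides_mull.
have db : divides p b.
  rewrite -[b](addrK ((r + s)%:R *: c)); apply: dividesD => //.
  exact/dividesN/dZ.
split=> //; rewrite -[a](addrK (r%:R *: b)) -[a + _](addrK (r%:R ^+ 2 *: c)).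
by apply: dividesD; [apply: dividesD => //|]; apply/dividesN/dZ.
Qed.

(** The finitely many prime factors of f each exclude only finitely many
    combinations of the derivatives along the curve (1, t, t^2). *)
Lemma coprime_derivative d f : (0 < d)%N -> reduced_curve d f ->
  exists g, [/\ homogz (d%:Z - 1) g, coprime_elt f g
              & exists v : 'rV[S]_3, g = \sum_i v 0 i * f^`M(i)].
Proof.
move=> d0 redf; have [f0 hf _] := redf.
pose g (t : nat) := f^`M(0) + t%:R *: f^`M(1) + (t%:R ^+ 2) *: f^`M(ord_max).
have Jg t : jacobian_ideal f (g t).
  apply: jacobianD; last exact/jacobianZ/jacobian_deriv.
  by apply: jacobianD; [|apply: jacobianZ]; apply: jacobian_deriv.
have hg t : homogz (d%:Z - 1) (g t).
  by apply: homogzD; [apply: homogzD; [|apply: homogzZ]|apply: homogzZ]; apply: homog_deriv.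
have [s fs] := factorial_mpoly f0.
have [N HN] : exists N, forall t, (N <= t)%N -> forall p, p \in s -> ~ divides p (g t).
  have [_ [_ [ps _]]] := fs; elim: s ps {fs} => [|p s IHs] ps; first by exists 0%N.
  have [|N1 H1] := IHs; first by move=> q qs; apply: ps; rewrite inE qs orbT.
  have pp : prime_elt p by apply: ps; rewrite mem_head.
  have [|N2 H2] := @generic_avoid p f^`M(0) f^`M(1) f^`M(ord_max) pp.
    have [i ni] := reduced_gradient d0 redf pp => -[p0 [p1 p2]]; apply: ni.
    case: i => [[|[|[|//]]] ilt].
    - by rewrite (_ : Ordinal ilt = 0) //; apply: val_inj.
    - by rewrite (_ : Ordinal ilt = 1) //; apply: val_inj.
    - by rewrite (_ : Ordinal ilt = ord_max) //; apply: val_inj.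
  exists (maxn N1 N2) => t; rewrite geq_max => /andP[t1 t2] q.
  by rewrite inE => /orP[/eqP ->|qs]; [apply: H2|apply: H1].
exists (g N); split; [exact: hg | | exact: Jg].
move=> p pp /(prime_dvd_factors pp fs) [q qs pq] pg.
have qp : prime_elt q by case: fs => _ [_ [ps _]]; apply: ps.
have [u uu qE] := prime_dvd_prime pp qp pq.
apply: (HN N (leqnn N) q qs); case: pg => c ->; exists (c / u).
by rewrite qE mulrA divrK.
Qed.

(** The equation and a general combination of its derivatives are coprime of
    degrees d and d - 1, so by the Koszul resolution they cut out a quotient
    whose Hilbert function is at most d (d - 1), as in the theorem of
    Bezout. *)
Lemma jacobian_bounded d f : (1 < d)%N -> reduced_curve d f ->
  exists C : nat, forall (k t : nat), (2 * d <= k)%N ->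
    qdim (homogz k) (jacobian_ideal f) t -> (t <= C)%N.
Proof.
move=> d1 redf; have d0 : (0 < d)%N := ltnW d1; have [f0 hf _] := redf.
have [g [hg cop [w gE]]] := coprime_derivative d0 redf.
have [sf fs] := factorial_mpoly f0.
pose a (i : 'I_2) : int := if i == 0 then d%:Z else d%:Z - 1.
pose M : 'M[S]_(2, 1) := \col_i (if i == 0 then f else g).
have gM : graded_mx a (fun=> 0) M.
  by move=> i j; rewrite mxE /a subr0; case: ifP.
have ME (u : 'rV_2) : u *m M = (u 0 0 * f + u 0 1 * g)%:M.
  apply/rowP => j; rewrite ord1 !mxE eqxx mulr1n big_ord_recl big_ord1 !mxE /=.
  by congr (_ + u _ _ * _); apply: val_inj.
exists (d * (d - 1))%N => k t kd dt.
have [r [s [Ers dr ds]]] := qdim_image k gM.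
have [r1 [s1 [_ dr1 _]]] := qdim_image k (graded_gradient hf).
have [t' [dt' Et]] := qdim_jacobian hf dr1.
have -> : t = t' by apply: (qdim_uniq (subspace_homogz K k) (subspace_jacobian f) dt dt').
have rr1 : (r <= r1)%N.
  have s0 := @subspace0 K (polyrow K 1).
  have sI := subspace_image (fun=> 0) M k.
  have sI' := subspace_image (fun=> 0) (gradient f) k.
  apply: (@qdim_inj_le _ _ _ idfun _ _ _ _ _ sI s0 sI' s0 _ _ _ _ dr dr1) => // v [pv [u vE]].
  split=> //; have : jacobian_ideal f (u 0 0 * f + u 0 1 * g).
    apply: jacobianD; apply: jacobianM; last by exists w.
    exact: jacobian_self d0 hf.
  by move/jacobianP => [u' u'E]; exists u'; rewrite vE ME u'E.
have sE : s = binomz (k%:Z - 2 * d%:Z + 1).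
  apply: (qdim_uniq (subspace_kernel a M k) (@subspace0 _ _) ds).
  pose phi (p : S) : polyrow K 2 := \row_i (if i == 0 then p * g else - p * f).
  have phiL : linear phi.
    move=> c p q; apply/rowP => i; rewrite polyrow_lin !mxE; case: ifP => _.
      by rewrite mulrDl scalerAl.
    by rewrite opprD mulrDl -scalerN scalerAl.
  have hphi p : homogz (k%:Z - 2 * d%:Z + 1) p -> piece a k (phi p).
    move=> hp i; rewrite mxE /a; case: ifP => _.
      by have := homogzM hp hg; congr homogz; ring.
    by have := homogzM (homogzN hp) (hf : homogz d%:Z f); congr homogz; ring.
  refine ((qdim_iso phiL (subspace_homogz K _) (@subspace0 _ _)
    (subspace_kernel a M k) (@subspace0 _ _) _ _ _ _ _).1 (qdim_homogz K _)).
  - move=> p hp; split; first exact: hphi.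
    by rewrite ME !mxE /= (_ : _ + _ = 0) ?raddf0 //; ring.
  - move=> p _ /rowP/(_ 1); rewrite !mxE /= => /eqP.
    by rewrite mulf_eq0 (negPf f0) orbF oppr_eq0 => /eqP.
  - by move=> p _ ->; apply/rowP => i; rewrite !mxE oppr0 !mul0r if_same.
  - move=> u [pu]; rewrite ME => /matrixP/(_ 0 0); rewrite !mxE eqxx mulr1n => uE.
    have [p pE] : divides f (u 0 1).
      apply: (coprime_cancel (b := g)) => //; first by exists sf.
      by exists (- u 0 0); rewrite mulrC mulNr; apply/eqP; rewrite -subr_eq0 opprK addrC uE.
    have p'E : u 0 1 = hcomp (k%:Z - 2 * d%:Z + 1) p * f.
      have := pu 1; rewrite /a /= => /hcomp_id; rewrite pE (hcompM _ _ (hf : homogz d%:Z f)).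
      by move=> <-; congr (hcomp _ _ * _); ring.
    set q := hcomp _ p in p'E.
    exists (- q); first by rewrite -scaleN1r; apply/homogzZ/homogz_hcomp.
    apply/eqP; rewrite subr_eq0; apply/eqP/rowP => i; rewrite mxE.
    case: i => [[|[|//]]] ilt /=.
      rewrite (_ : Ordinal ilt = 0); last exact: val_inj.
      apply: (mulIf f0); apply/eqP; rewrite -subr_eq0 -uE p'E; apply/eqP; ring.
    rewrite (_ : Ordinal ilt = 1); last exact: val_inj.
    by rewrite p'E opprK.
rewrite sE /hilb big_ord_recl big_ord1 /a /= in Ers.
have kE : k = (2 * d + (k - 2 * d))%N by lia.
move: (k - 2 * d)%N kE => n kE; subst k; clear kd dt dr dr1 sE dt' ds.
move: Ers Et.
have -> : (2 * d + n)%N%:Z - 2 * d%:Z + 1 = n.+1 by lia.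
have -> : (2 * d + n)%N%:Z - d%:Z = (d + n)%N by lia.
have -> : (2 * d + n)%N%:Z - (d%:Z - 1) = (d + n).+1 by lia.
rewrite /binomz => Ers Et.
have b2 m : (2 * 'C(m + 2, 2) = (m + 2) * (m + 1))%N.
  by have := mul_bin_diag m.+2 1; rewrite bin1 addn2 addn1 /= => <-; ring.
have H : (2 * 'C(2 * d + n + 2, 2) + 2 * 'C(n.+1 + 2, 2) =
          2 * (d * (d - 1)) + 2 * 'C(d + n + 2, 2) + 2 * 'C((d + n).+1 + 2, 2))%N.
  have e1 := b2 (2 * d + n)%N; have e2 := b2 n.+1.
  have e3 := b2 (d + n)%N; have e4 := b2 (d + n).+1.
  rewrite e1 e2 e3 e4 {e1 e2 e3 e4}.
  by case: (d) d0 => // e _; rewrite subSS subn0; ring.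
move: H Ers Et rr1; move: 'C(n.+1 + 2, 2) 'C(2 * d + n + 2, 2) => A1 A2.
move: 'C(d + n + 2, 2) 'C((d + n).+1 + 2, 2) => A3 A4.
by lia.
Qed.

End Reduced.

(** * Numerical consequences of a resolution *)

(** The second differences at step N are 2 a N^2 and are bounded by 2 C, so a
    vanishes when N is large; then so does b. *)
Lemma bounded_quadratic (a b c : int) (C k0 : nat) :
  (forall k : nat, (k0 <= k)%N -> 0 <= a * k%:Z ^+ 2 + b * k%:Z + c <= C%:Z) ->
  a = 0 /\ b = 0.
Proof.
move=> H; pose N := (C + C).+1.
have := H k0 (leqnn _); have := H (k0 + N)%N (leq_addr _ _).
have := H (k0 + (N + N))%N (leq_addr _ _).
rewrite !PoszD !expr2; have : N%:Z = 2 * C%:Z + 1 by rewrite /N; lia.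
move: (N%:Z) (k0%:Z) => n x nC H2 H1 H0.
have nC0 : 0 <= C%:Z by [].
have E2 : 0 <= 2 * C%:Z + 2 * (a * (n * n)) /\ 2 * (a * (n * n)) <= 2 * C%:Z by nia.
have nn : n <= n * n by nia.
have a0 : a = 0.
  have [a1|a1|//] := ltrgtP a 0.
  - have : a * (n * n) <= (-1) * (n * n) by apply: ler_wpM2r; lia.
    by lia.
  - have : 1 * (n * n) <= a * (n * n) by apply: ler_wpM2r; lia.
    by lia.
split=> //; subst a; rewrite !mul0r !add0r in H0 H1.
have E1 : - C%:Z <= b * n <= C%:Z by nia.
have [b1|b1|//] := ltrgtP b 0.
- have : b * n <= (-1) * n by apply: ler_wpM2r; lia.
  by lia.
- have : 1 * n <= b * n by apply: ler_wpM2r; lia.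
  by lia.
Qed.

Lemma hilb_nth (s : seq nat) (F : nat -> int) (k : int) :
  hilb (fun j : 'I_(size s) => F (nth 0%N s j)) k =
  (\sum_(a <- [seq F x | x <- s]) binomz (k - a)%R)%N.
Proof. by rewrite /hilb big_map (big_nth 0%N) big_mkord. Qed.

Lemma row'_mulmx (R : pzRingType) m n (j : 'I_m) (A : 'M[R]_(m, n)) :
  row' j A = row' j 1%:M *m A.
Proof.
apply/matrixP => i k; rewrite !mxE (bigD1 (lift j i)) //= !mxE eqxx mul1r big1 ?addr0 //.
by move=> l li; rewrite !mxE eq_sym (negPf li) mul0r.
Qed.

Section Numerics.
Variables (K : numFieldType) (d : nat) (f : {mpoly K[3]}).
Hypotheses (d1 : (1 < d)%N) (redf : reduced_curve d f).
Local Notation D := (d%:Z - 1).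

(** The Hilbert function of the Jacobian ring is a polynomial in high degrees,
    and it is bounded: so its leading coefficients vanish. These are the rank
    and first Chern class relations for the resolution, and the remaining
    constant is half of the difference of the sums of squares. *)
Lemma resolution_numerics ds cs : resolution d f ds cs ->
  [/\ size ds = (size cs).+2,
      \sum_(c <- cs) c%:Z = \sum_(x <- ds) (D + x%:Z) - 3 * D
    & exists k0 : nat, forall k : nat, (k0 <= k)%N ->
      exists2 t : nat, qdim (homogz k%:Z) (jacobian_ideal f) t &
        2 * t%:Z = \sum_(x <- ds) (D + x%:Z) ^+ 2 - \sum_(c <- cs) c%:Z ^+ 2 - 3 * D ^+ 2].
Proof.
move=> res; have [f0 hf _] := redf.
have [C HC] := jacobian_bounded d1 redf.
pose as1 := nseq 3 D; pose as2 := [seq D + x%:Z | x <- ds]; pose as3 := [seq c%:Z | c <- cs].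
(* Beyond the twists of the resolution and the range of the bound on the
   Hilbert function. *)
pose k0 := (2 * d + \sum_(x <- ds) x + \sum_(c <- cs) c)%N.
have le_sum (s : seq nat) x : x \in s -> (x <= \sum_(y <- s) y)%N.
  by move=> xs; rewrite (big_rem x) //= leq_addr.
have Hk (k : nat) : (k0 <= k)%N -> exists2 t : nat,
    qdim (homogz k%:Z) (jacobian_ideal f) t &
    2 * t%:Z = (1 - 3 + (size ds)%:Z - (size cs)%:Z) * (k%:Z ^+ 2 + 3 * k%:Z + 2)
      - (2 * k%:Z + 3) * (\sum_(a <- as2) a - \sum_(a <- as3) a - 3 * D)
      + (\sum_(a <- as2) a ^+ 2 - \sum_(a <- as3) a ^+ 2 - 3 * D ^+ 2).
  move=> k0k; have [t [dt Et]] := hilbert_of_resolution k%:Z hf res.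
  exists t => //.
  rewrite (hilb_nth cs (fun x => x%:Z)) (hilb_nth ds (fun x => (d%:Z + x%:Z - 1)%R)) in Et.
  rewrite (eq_map (_ : (fun x : nat => d%:Z + x%:Z - 1) =1 (fun x => D + x%:Z))) in Et; last first.
    by move=> x /=; ring.
  rewrite -/as2 -/as3 in Et.
  have b0 := @sum_binomz k%:Z [:: 0]; have b1 := @sum_binomz k%:Z as1.
  have b2 := @sum_binomz k%:Z as2; have b3 := @sum_binomz k%:Z as3.
  have {}b0 := b0 _; rewrite !big_seq1 subr0 in b0.
  have {}b0 : 2 * (binomz k)%:Z = k%:Z ^+ 2 + 3 * k%:Z + 2.
    by rewrite b0 ?expr0n /= => [|a]; [ring|rewrite inE => /eqP ->].
  have {}b1 : 2 * (hilb (fun _ : 'I_3 => D) k)%:Z =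
      3 * (k%:Z ^+ 2 + 3 * k%:Z + 2) - (2 * k%:Z + 3) * (3 * D) + 3 * D ^+ 2.
    have h1 : hilb (fun _ : 'I_3 => D) k = (\sum_(a <- as1) binomz (k%:Z - a)%R)%N.
      by rewrite /hilb !big_ord_recl big_ord0 /as1 /= !big_cons big_nil.
    rewrite h1 b1; first by rewrite /as1 /= !big_cons !big_nil; ring.
    by move=> a; rewrite !inE !orbb => /eqP ->; rewrite /k0 in k0k; lia.
  rewrite size_map in b2; rewrite size_map in b3.
  have le2 a : a \in as2 -> a <= k.
    by case/mapP => x /le_sum xs ->; rewrite /k0 in k0k; lia.
  have le3 a : a \in as3 -> a <= k.
    by case/mapP => x /le_sum xs ->; rewrite /k0 in k0k; lia.
  have {le2}b2 := b2 le2; have {le3}b3 := b3 le3.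
  move: Et => /(congr1 (fun n : nat => 2 * n%:Z)); rewrite !PoszD !mulrDr b0 b1 b2 b3.
  move=> /eqP; rewrite -subr_eq0 => /eqP E.
  by apply/eqP; rewrite -subr_eq0 -[X in _ == X]E; apply/eqP; ring.
set n := 1 - 3 + _ - _ in Hk; set L := _ - _ - 3 * D in Hk.
set Q := _ - _ - 3 * D ^+ 2 in Hk.
(* n is the alternating sum of the ranks and L that of the degrees. *)
have [n0 L0] : n = 0 /\ 3 * n - 2 * L = 0.
  apply: (@bounded_quadratic _ _ (2 * n - 3 * L + Q) (C + C)%N k0) => k k0k.
  have [t dt Et] := Hk _ k0k; have tC : (t <= C)%N.
    by apply: (HC k t _ dt); rewrite /k0 in k0k; lia.
  have -> : n * k%:Z ^+ 2 + (3 * n - 2 * L) * k%:Z + (2 * n - 3 * L + Q) = 2 * t%:Z.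
    by rewrite Et; ring.
  by clear -tC; lia.
have {}L0 : L = 0 by move: L0; rewrite n0; lia.
split; first by move: n0; rewrite /n; lia.
  by move/eqP: L0; rewrite /L /as2 /as3 !big_map subr_eq0 => /eqP <-; rewrite subKr.
exists k0 => k /Hk [t dt Et]; exists t => //.
by rewrite Et n0 L0 /Q /as2 /as3 !big_map; ring.
Qed.

Lemma minimal_resolution_resolution ds cs :
  minimal_resolution d f ds cs -> resolution d f ds cs.
Proof.
by move=> [_ _ _ [B [A [[gB gA _] _ [iB eB eA]]]]]; exists B, A.
Qed.

(** A redundant generator would give a syzygy with an entry 1, against the
    minimality of the resolution. *)
Lemma minimal_resolution_exponents ds cs :
  minimal_resolution d f ds cs -> exponents f ds.
Proof.
move=> [sds _ _ [B [A [[gB gA _] [mB _ _] [_ eB eA]]]]]; split=> //; exists A.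
have genA : generates_D0 f A by move=> v; split=> [/D0_gradient/eA|/eA/D0_gradient].
split=> // [j k|j gen].
  by have := gA j k; rewrite (_ : _ - _ = (nth 0%N ds j)%:Z) //; ring.
have /gen [u uE] : D0 f (row j A).
  by apply/genA; exists (delta_mx 0 j); rewrite rowE.
have /eB [x] : (delta_mx 0 j - u *m row' j 1%:M) *m A = 0.
  by rewrite mulmxBl -rowE uE -mulmxA -row'_mulmx subrr.
move=> /rowP/(_ j)/(congr1 (mcoeff 0%MM))/eqP; apply/negP.
rewrite !mxE !eqxx big1 => [|k _]; last first.
  by rewrite !mxE (_ : lift j k == j = false) ?mulr0 // eq_sym (negPf (neq_lift j k)).
rewrite subr0 mcoeff1 eqxx raddf_sum big1 ?oner_eq0 // => k _ /=.
by rewrite rmorphM /= mB mulr0.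
Qed.

End Numerics.

(** * Second syzygies are free *)

Section VariableIdeals.
Variable K : fieldType.
Local Notation S := {mpoly K[3]}.
Implicit Types p q : S.

(** The ideal generated by the first k variables. Membership is read off from the
    monomials, so that no generators have to be chosen. *)
Definition var_ideal (k : nat) p :=
  forall m : 'X_{1..3}, (forall i : 'I_3, (i < k)%N -> m i = 0%N) -> p@_m = 0.

Lemma var_ideal0 p : var_ideal 0 p -> p = 0.
Proof. by move=> H; apply/mpolyP => m; rewrite H // mcoeff0. Qed.

Lemma var_ideal3 p : p@_0 = 0 -> var_ideal 3 p.
Proof.
move=> p0 m m0; rewrite (_ : m = 0%MM) //; apply/mnmP => i.
by rewrite m0 // mnm0E.
Qed.

Lemma mcoeffXM i p (m : 'X_{1..3}) :
  ('X_i * p)@_m = if m i == 0%N then 0 else p@_(m - U_(i)).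
Proof.
case: eqP => [mi|/eqP mi].
  apply/eqP; rewrite mcoeff_eq0; apply: contraT; rewrite negbK.
  move/msuppM_le/allpairsP => -[[m1 m2] /= [m1X _ mE]].
  move: mi; rewrite mE mnmDE; move: m1X; rewrite msuppX inE => /eqP ->.
  by rewrite mnm1E eqxx.
by rewrite -[RHS](mcoeffMX p U_(i)%MM) addmC submK ?lep1mP // mulrC.
Qed.

Lemma var_idealX (k : nat) (i : 'I_3) p : (i < k)%N -> var_ideal k ('X_i * p).
Proof. by move=> ik m m0; rewrite mcoeffXM m0. Qed.

Lemma var_idealD k p q : var_ideal k p -> var_ideal k q -> var_ideal k (p + q).
Proof. by move=> Hp Hq m m0; rewrite mcoeffD Hp // Hq // addr0. Qed.

Lemma var_ideal_regular (k : 'I_3) p : var_ideal k ('X_k * p) -> var_ideal k p.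
Proof.
move=> H m m0; have := H (U_(k) + m)%MM; rewrite mulrC mcoeffMX; apply=> i ik.
by rewrite mnmDE mnm1E m0 // addn0 -val_eqE /= gtn_eqF.
Qed.

(** The quotient in the division by the variable i, which discards the monomials
    free of it. *)
Definition mquo (i : 'I_3) p : S := \sum_(m <- msupp p | m i != 0%N) p@_m *: 'X_[m - U_(i)].

Lemma mcoeff_mquo i p m : (mquo i p)@_m = p@_(m + U_(i)).
Proof.
rewrite /mquo raddf_sum /=; under eq_bigr do rewrite mcoeffZ mcoeffX.
have [mp|mp] := boolP ((m + U_(i))%MM \in msupp p); last first.
  rewrite (memN_msupp_eq0 mp) big1_seq // => l /andP[li lp].
  case: eqP => [lE|_]; last by rewrite mulr0.
  by move: mp; rewrite -lE submK ?lep1mP // lp.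
rewrite big_mkcond (bigD1_seq (m + U_(i))%MM) ?msupp_uniq //=.
rewrite mnmDE mnm1E eqxx addn1 addmK eqxx mulr1 big1 ?addr0 // => l lm.
case: ifP => // li; case: eqP => [lE|_]; last by rewrite mulr0.
by move: lm; rewrite -lE submK ?lep1mP // eqxx.
Qed.

Lemma msize_mquo i p N : (msize p <= N.+1)%N -> (msize (mquo i p) <= N)%N.
Proof.
move=> pN; rewrite msizeE; apply/bigmax_leqP_seq => m.
rewrite mcoeff_msupp mcoeff_mquo -mcoeff_msupp => /msize_mdeg_lt H _.
by have := leq_trans H pN; rewrite mdegD mdeg1 addn1 ltnS.
Qed.

(** Division with remainder by a variable. *)
Lemma var_ideal_quo (k : 'I_3) p : var_ideal k.+1 p -> var_ideal k (p - 'X_k * mquo k p).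
Proof.
move=> H m m0; rewrite mcoeffB mcoeffXM mcoeff_mquo.
case: eqP => [mk|/eqP mk]; last by rewrite submK ?lep1mP ?subrr.
rewrite subr0; apply: H => i; rewrite ltnS leq_eqVlt => /orP[/eqP ik|]; last exact: m0.
by rewrite (_ : i = k) //; apply: val_inj.
Qed.

End VariableIdeals.

Section SecondSyzygies.
Variables (K : fieldType) (m : nat) (f : {mpoly K[3]}).
Local Notation S := {mpoly K[3]}.
Variable A : 'M[S]_(m, 3).
Hypothesis exA : exact_mx A (gradient f).

(** The product of the ideal of the first k variables with the kernel of A. *)
Definition syzygies_mod (k : nat) (u : 'rV[S]_m) := exists w : 'I_3 -> 'rV[S]_m,
  (forall i, w i *m A = 0) /\ u = \sum_(i < 3 | (i < k)%N) 'X_i *: w i.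

Lemma syzygies_modD k u v : syzygies_mod k u -> syzygies_mod k v ->
  syzygies_mod k (u + v).
Proof.
move=> [w [Kw ->]] [x [Kx ->]]; exists (fun i => w i + x i); split.
  by move=> i; rewrite mulmxDl Kw Kx addr0.
by rewrite -big_split; apply: eq_bigr => i _; rewrite scalerDr.
Qed.

Lemma syzygies_modM k p u : u *m A = 0 -> var_ideal k p -> syzygies_mod k (p *: u).
Proof.
move=> Ku; elim: k p => [|k IHk] p Hp.
  rewrite (var_ideal0 Hp) scale0r; exists (fun=> 0); split=> [i|]; first by rewrite mul0mx.
  by rewrite big1.
have [k3|k3] := ltnP k 3; last first.
  have [|w [Kw uE]] := IHk p.
    by move=> l l0; apply: Hp => i _; apply: l0; apply: leq_trans k3.
  exists w; split=> //; rewrite uE; apply: eq_bigl => i.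
  by rewrite (leq_trans (ltn_ord i) k3) (leq_trans (ltn_ord i) (leqW k3)).
pose i := Ordinal k3; have := IHk _ (@var_ideal_quo _ i p Hp).
move=> [w [Kw uE]]; exists (fun j => if j == i then mquo i p *: u else w j); split.
  by move=> j; case: eqP => // _; rewrite -scalemxAl Ku scaler0.
rewrite (bigD1 i) //= eqxx scalerA -[p in LHS](subrK ('X_i * mquo i p)) scalerDl addrC uE.
congr (_ + _); apply: eq_big => [j|j ji]; last by case: eqP ji => // ->; rewrite ltnn.
by rewrite ltnS [(j <= k)%N]leq_eqVlt -val_eqE /=; case: ltngtP.
Qed.

Lemma var_ideal1_row n (u : 'rV[S]_n) : (forall j, var_ideal 1 (u 0 j)) ->
  u = 'X_0 *: map_mx (mquo 0) u.
Proof.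
move=> H; apply/rowP => j; rewrite !mxE; apply/eqP; rewrite -subr_eq0; apply/eqP.
exact/var_ideal0/(@var_ideal_quo _ 0)/H.
Qed.

Lemma var_ideal2_row n (u : 'rV[S]_n) : (forall j, var_ideal 2 (u 0 j)) ->
  exists a b, u = 'X_0 *: a + 'X_1 *: b.
Proof.
move=> H; exists (map_mx (mquo 0) (u - 'X_1 *: map_mx (mquo 1) u)), (map_mx (mquo 1) u).
rewrite -var_ideal1_row ?subrK // => j; rewrite !mxE.
exact/(@var_ideal_quo _ 1)/H.
Qed.

Lemma syzygies_mod_entries k u : syzygies_mod k u -> forall j, var_ideal k (u 0 j).
Proof.
move=> [w [_ ->]] j; rewrite summxE; elim/big_ind: _ => [i _|p q|i ik].
- exact: mcoeff0.
- exact: var_idealD.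
- by rewrite mxE; apply: var_idealX.
Qed.

Lemma scale_row_inj n (p : S) (u v : 'rV[S]_n) : p != 0 -> p *: u = p *: v -> u = v.
Proof.
by move=> p0 /rowP H; apply/rowP => j; apply: (mulfI p0); have := H j; rewrite !mxE.
Qed.

Lemma var_neq0 (i : 'I_3) : 'X_i != 0 :> S.
Proof. by rewrite -msupp_eq0 msuppX. Qed.

(** The three variables form a regular sequence on the module of syzygies of A;
    for the last variable this uses that A resolves a module of first syzygies,
    which lets two rows be corrected by a Koszul relation. *)
Lemma syzygies_regular (k : 'I_3) u : u *m A = 0 ->
  syzygies_mod k ('X_k *: u) -> syzygies_mod k u.
Proof.
move=> Ku Su.
have Hu j : var_ideal k (u 0 j).
  by apply/var_ideal_regular; have := syzygies_mod_entries Su j; rewrite mxE.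
have k012 : [\/ k = 0, k = 1 | k = ord_max].
  case: (k) => [[|[|[|//]]] kl]; [constructor 1|constructor 2|constructor 3]; exact: val_inj.
have exactX0 (v : 'rV_m) : 'X_0 *: v *m A = 0 -> v *m A = 0.
  by rewrite -scalemxAl => H; apply: (scale_row_inj (var_neq0 0)); rewrite H scaler0.
case: k012 => kE; rewrite {k}kE in Su Hu *.
- have u0 : u = 0 by apply/rowP => j; rewrite mxE; apply: var_ideal0; exact: Hu.
  exists (fun=> 0); split=> [i|]; first by rewrite mul0mx.
  by rewrite big1 // => i _; rewrite scaler0.
- have uE := var_ideal1_row Hu; set w := map_mx _ u in uE.
  exists (fun=> w); split; first by move=> i; apply: exactX0; rewrite -uE.
  rewrite [in LHS]uE (bigD1 0) //= big1 ?addr0 // => i /andP[i1 i0].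
  by move: i1 i0; rewrite -val_eqE /=; case: (val i).
- have [a [b uE]] := var_ideal2_row Hu.
  have E : 'X_0 *: (a *m A) + 'X_1 *: (b *m A) = 0.
    by rewrite !scalemxAl -mulmxDl -uE.
  (* Modulo the first variable, the second one is regular on polynomials; the
     common quotient e is a first syzygy, hence in the image of A. *)
  have bAE : b *m A = 'X_0 *: map_mx (mquo 0) (b *m A).
    apply: var_ideal1_row => j; apply: (@var_ideal_regular _ 1).
    have /rowP/(_ j) := E; rewrite [X in X = _]mxE [X in X + _]mxE [X in _ + X]mxE [RHS]mxE.
    move/eqP; rewrite addrC addr_eq0 => /eqP ->; rewrite -mulrN.
    exact: var_idealX.
  set e := map_mx _ (b *m A) in bAE.
  have aAE : a *m A = - 'X_1 *: e.
    apply: (scale_row_inj (var_neq0 0)); apply/eqP.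
    by rewrite -subr_eq0 scaleNr scalerN opprK scalerA mulrC -scalerA -bAE E.
  have /exA [g gE] : e *m gradient f = 0.
    apply: (scale_row_inj (var_neq0 0)); rewrite scaler0 scalemxAl -bAE.
    by apply/exA; exists b.
  exists (fun i => if i == 0 then a + 'X_1 *: g else b - 'X_0 *: g); split.
    move=> i; case: eqP => _.
      by rewrite mulmxDl -scalemxAl -gE aAE scaleNr addNr.
    by rewrite mulmxBl -scalemxAl -gE bAE subrr.
  rewrite uE big_mkcond !big_ord_recl big_ord0 /= addr0.
  have -> : lift ord0 ord0 = 1 :> 'I_3 by apply: val_inj.
  rewrite addr0 !scalerDr scalerN !scalerA [_ * 'X_1]mulrC addrACA.
  by rewrite addrN addr0.
Qed.

Lemma syzygies_mod0 k : syzygies_mod k 0.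
Proof. by exists (fun=> 0); split=> [i|]; rewrite ?mul0mx ?big1 // => i _; rewrite scaler0. Qed.

Lemma syzygies_modN k u : syzygies_mod k u -> syzygies_mod k (- u).
Proof.
move=> [w [Kw ->]]; exists (fun i => - w i); split=> [i|]; first by rewrite mulNmx Kw oppr0.
by rewrite -sumrN; apply: eq_bigr => i _; rewrite scalerN.
Qed.

Lemma syzygies_modS k u : syzygies_mod k u -> syzygies_mod k.+1 u.
Proof.
move=> [w [Kw ->]]; exists (fun i : 'I_3 => if (i < k)%N then w i else 0); split.
  by move=> i; case: ifP => // _; rewrite mul0mx.
rewrite big_mkcond [RHS]big_mkcond; apply: eq_bigr => i _; rewrite ltnS.
by case: ltngtP => // _; rewrite scaler0.
Qed.

Lemma syzygies_mod_mul k r (B : 'M[S]_(r, m)) (t : 'rV_r) : B *m A = 0 ->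
  (forall j, var_ideal k (t 0 j)) -> syzygies_mod k (t *m B).
Proof.
move=> BA Ht; rewrite mulmx_sum_row; elim/big_ind: _ => [|x y|j _].
- exact: syzygies_mod0.
- exact: syzygies_modD.
- by apply: syzygies_modM => //; rewrite -row_mul BA row0.
Qed.

(** Linear independence of the rows modulo the maximal ideal times the module of
    syzygies of A. *)
Definition minimal_rows r (B : 'M[S]_(r, m)) := B *m A = 0 /\
  forall c : 'rV[K]_r, syzygies_mod 3 (map_mx (@mpolyC 3 K) c *m B) -> c = 0.

(** Independence is transported from the quotient by all three variables to the
    module itself, removing one variable of the regular sequence at a time. *)
Lemma minimal_rows_independent r (B : 'M[S]_(r, m)) (t : 'rV_r) :
  minimal_rows B -> t *m B = 0 -> t = 0.
Proof.
move=> [BA mB] tB0.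
(* Descending induction on k; the remainder modulo the k-th variable is settled
   by the case of k + 1, and the quotient has smaller size. *)
suff H n k : (k + n = 3)%N -> forall t : 'rV_r, syzygies_mod k (t *m B) ->
    forall j, var_ideal k (t 0 j).
  apply/rowP => j; rewrite mxE; apply: var_ideal0; apply: (H 3%N 0%N) => //.
  rewrite tB0; exact: syzygies_mod0.
elim: n k => [|n IHn] k kn {tB0}t.
  rewrite addn0 in kn; rewrite {k}kn => St.
  pose c := map_mx (mcoeff 0%MM) t.
  have c0 : c = 0.
    apply: mB.
    have -> : map_mx (@mpolyC 3 K) c *m B = t *m B - (t - map_mx (@mpolyC 3 K) c) *m B.
      by rewrite mulmxBl subKr.
    apply: syzygies_modD => //; apply: syzygies_modN.
    apply: syzygies_mod_mul => // j; apply: var_ideal3.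
    by rewrite !mxE mcoeffB mcoeffC eqxx mulr1 subrr.
  by move=> j; apply: var_ideal3; have /rowP/(_ j) := c0; rewrite !mxE.
have k3 : (k < 3)%N by rewrite -kn addnS ltnS leq_addr.
pose i := Ordinal k3.
have [N] : exists N, forall j, (msize (t 0%R j) <= N)%N.
  by exists (\max_j msize (t 0%R j))%N => j; apply: (leq_bigmax j).
elim: N t => [|N IHN] t tN St j.
  have /eqP : msize (t 0 j) = 0%N by apply/eqP; rewrite -leqn0 tN.
  by rewrite msize_poly_eq0 => /eqP -> l _; rewrite mcoeff0.
have Hk1 := IHn k.+1 _ t (syzygies_modS St); rewrite addSnnS in Hk1.
pose s := map_mx (mquo i) t.
have Ht' l : var_ideal k ((t - 'X_i *: s) 0 l).
  by rewrite !mxE; apply: (@var_ideal_quo _ i); apply: Hk1.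
have Ss : syzygies_mod k (s *m B).
  apply: (@syzygies_regular i); first by rewrite -mulmxA BA mulmx0.
  rewrite scalemxAl.
  have -> : ('X_i *: s) *m B = t *m B - (t - 'X_i *: s) *m B.
    by rewrite mulmxBl subKr.
  by apply: syzygies_modD => //; apply/syzygies_modN/syzygies_mod_mul.
have Hs : var_ideal k (s 0 j).
  by apply: IHN => // l; rewrite mxE; apply: msize_mquo.
have -> : t 0 j = (t - 'X_i *: s) 0 j + 'X_i * s 0 j by rewrite !mxE subrK.
apply: var_idealD => // l l0; rewrite mcoeffXM; case: eqP => // li.
apply: Hs => x xk; rewrite mnmBE l0 //.
Qed.

End SecondSyzygies.

(** * Linear independence over the fraction field *)

Section Rank.
Variable R : idomainType.
Local Notation F := {fraction R}.

Lemma fractionE (x : F) : exists a b : R, b != 0 /\ x = tofrac a / tofrac b.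
Proof.
have d0 : \d_(repr x) != 0 by apply: denom_ratioP.
exists \n_(repr x), \d_(repr x); split=> //.
have fd0 : tofrac \d_(repr x) != 0 by rewrite tofrac_eq0.
apply: (mulIf fd0); rewrite divfK // -[x in LHS]reprK.
unlock FracField.tofrac; rewrite -[LHS]FracField.pi_mul; apply/eqmodP.
rewrite /= FracField.equivfE /FracField.mulf.
by rewrite !numden_Ratio ?mulf_neq0 ?oner_eq0 // reprK !mulr1 mulrC.
Qed.

Lemma fraction_denominators n (x : 'I_n -> F) : exists2 c : R, c != 0 &
  exists y : 'I_n -> R, forall j, tofrac c * x j = tofrac (y j).
Proof.
have /choice[q qE] : forall j, exists q : R * R, q.2 != 0 /\ x j = tofrac q.1 / tofrac q.2.
  by move=> j; have [a [b [b0 xE]]] := fractionE (x j); exists (a, b).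
exists (\prod_j (q j).2); first by apply/prodf_neq0 => j _; case: (qE j).
exists (fun j => (q j).1 * \prod_(l | l != j) (q l).2) => j; have [q0 ->] := qE j.
have fq0 : tofrac (q j).2 != 0 by rewrite tofrac_eq0.
by rewrite (bigD1 j) //= !rmorphM /=; field.
Qed.

(** Denominators of a relation over the fraction field can be cleared. *)
Lemma independent_row_free m n (M : 'M[R]_(m, n)) :
  (forall u : 'rV_m, u *m M = 0 -> u = 0) -> row_free (map_mx (@tofrac R) M : 'M[F]_(m, n)).
Proof.
move=> indM; apply: inj_row_free => v vM.
have [c c0 [y yE]] := fraction_denominators (v 0).
have : \row_j y j = 0.
  apply: indM; apply/rowP => k; rewrite [RHS]mxE; apply/eqP; rewrite -tofrac_eq0.
  have /rowP/(_ k) : map_mx (@tofrac R) (\row_j y j *m M) = 0.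
    rewrite map_mxM (_ : map_mx _ (\row_j y j) = tofrac c *: v).
      by rewrite -scalemxAl vM scaler0.
    by apply/rowP => j; rewrite !mxE yE.
  by rewrite mxE [RHS]mxE => ->.
move=> /rowP y0; apply/rowP => j; rewrite mxE; apply/eqP.
have := yE j; have := y0 j; rewrite !mxE => -> /eqP; rewrite rmorph0 mulf_eq0.
by rewrite tofrac_eq0 (negPf c0).
Qed.

End Rank.

(** * Graded bases and minimal resolutions *)

Lemma sort_degrees r (c : 'I_r -> nat) : exists (p : 'S_r) (cs : seq nat),
  [/\ sorted leq cs, size cs = r & forall i : 'I_r, nth 0%N cs i = c (p i)].
Proof.
pose s := [tuple c i | i < r]; pose ts := sort_tuple leq s.
have /tuple_permP [p tsE] : perm_eq ts s by rewrite /= perm_sort.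
exists p, ts; split; first by apply: sort_sorted; exact: leq_total.
  exact: size_tuple.
move=> i; have lti : (i < size s)%N by rewrite size_tuple.
by rewrite tsE -(tnth_nth 0%N [tuple tnth s (p j) | j < r] i) !tnth_mktuple.
Qed.

Lemma mcoeff_hcomp (K : fieldType) (k : nat) (p : {mpoly K[3]}) m :
  (hcomp k p)@_m = if mdeg m == k then p@_m else 0.
Proof.
case: ifP => [/eqP mk|/negbT mk]; last first.
  exact: (dhomog_nemf_coeff (homogz_hcomp k p : _ \is k.-homog)).
have pN : (msize p <= msize p + k.+1)%N by apply: leq_addr.
have kN : (k < msize p + k.+1)%N by rewrite addnS ltnS leq_addl.
have /(congr1 (mcoeff m)) -> := pihomog_partitionE (mf := mdeg) pN.
rewrite [RHS]raddf_sum [RHS](bigD1 (Ordinal kN)) //= [X in _ + X]big1 ?addr0 // => i ik.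
apply: (dhomog_nemf_coeff (pihomogP _ _ _)); rewrite /= mk.
by apply: contraNneq ik => ki; apply/eqP/val_inj.
Qed.

Lemma col'_mulmx (R : pzRingType) m (j : 'I_m) (w : 'rV[R]_m) : w 0 j = 0 ->
  w = col' j w *m row' j 1%:M.
Proof.
move=> wj; apply/rowP => i; rewrite mxE; case: (unliftP j i) => [l|] ->.
  rewrite (bigD1 l) //= !mxE eqxx mulr1 big1 ?addr0 // => l' ll'.
  by rewrite !mxE (inj_eq (@lift_inj _ j)) (negPf ll') mulr0.
rewrite wj big1 // => l _.
by rewrite !mxE eq_sym (negPf (neq_lift j l)) mulr0.
Qed.

Section GradedBasis.
Variables (K : fieldType) (f : {mpoly K[3]}) (ds : seq nat).
Local Notation S := {mpoly K[3]}.
Local Notation m := (size ds).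
Variable A : 'M[S]_(m, 3).
Hypothesis minA : minimal_generators f A.
Local Notation a := (fun j : 'I_m => (nth 0%N ds j)%:Z).

Lemma generators_graded : graded_mx a (fun=> 0) A.
Proof. by move=> i j; rewrite subr0; case: minA => gA _ _; apply: gA. Qed.

Lemma generators_exact : exact_mx A (gradient f).
Proof. by case: minA => _ gen _ v; split=> [/D0_gradient/gen|/gen/D0_gradient]. Qed.

(** A syzygy with a nonzero constant entry would make a generator redundant. *)
Lemma syzygy_coef0 (u : 'rV[S]_m) j : u *m A = 0 -> (u 0 j)@_0%MM = 0.
Proof.
move=> uA; apply/eqP; have [_ _ /(_ j)] := minA; apply: contra_notT => uj0.
pose v := rcomp a (nth 0%N ds j) u; pose c := (u 0 j)@_0%MM.
have vA : v *m A = 0.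
  rewrite -(rcompM _ _ generators_graded) uA; apply/rowP => i.
  by rewrite !mxE hcomp0.
have vj : v 0 j = c%:MP.
  rewrite mxE subrr; apply/mpolyP => l; rewrite mcoeff_hcomp mcoeffC mdeg_eq0.
  by case: eqP => [->|_]; rewrite ?mulr1 ?mulr0.
case: minA => _ gen _.
move=> x; split=> [/gen [w ->]|[w ->]]; last first.
  by rewrite row'_mulmx mulmxA; apply/gen; exists (w *m row' j 1%:M).
pose w' := w - (c^-1 *: w 0 j) *: v.
have w'j : w' 0 j = 0.
  rewrite mxE [X in _ + X]mxE [X in - X]mxE vj mulrC mul_mpolyC scalerA divff //.
  by rewrite scale1r subrr.
exists (col' j w'); rewrite row'_mulmx mulmxA -col'_mulmx //.
by rewrite mulmxBl -scalemxAl vA scaler0 subr0.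
Qed.

(** The homogeneous families of syzygies that are linearly independent modulo the
    maximal ideal. *)
Let good r (c : 'I_r -> nat) (B : 'M[S]_(r, m)) :=
  minimal_rows A B /\ graded_mx (fun i => (c i)%:Z) a B.

(** Independence modulo the maximal ideal implies linear independence, and this
    bounds the size of the family by the rank of the ambient module. *)
Lemma good_le r c (B : 'M[S]_(r, m)) : good c B -> (r <= m)%N.
Proof.
case=> mB _; have := @independent_row_free _ _ _ B _.
move=> /(_ (fun t => minimal_rows_independent generators_exact mB)) /eqP <-.
exact: rank_leq_col.
Qed.

Lemma maximal_good : exists r c (B : 'M[S]_(r, m)),
  good c B /\ forall c' (B' : 'M[S]_(r + 1, m)), ~ good c' B'.
Proof.
apply: contrapT => /forallNP H.
suff P r : exists c (B : 'M[S]_(r, m)), good c B.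
  by have [c [B /good_le]] := P m.+1; rewrite ltnn.
elim: r => [|r [c [B gB]]].
  exists (fun=> 0%N), 0; split=> [|[]//]; split=> [|c _]; first by rewrite mul0mx.
  by apply/rowP => -[].
apply: contrapT => nex; apply: (H r); exists c, B; split=> // c'.
rewrite -(addn1 r) in nex.
by move=> B' gB'; apply: nex; exists c', B'.
Qed.

Lemma rcompZX k (i : 'I_3) (u : 'rV[S]_m) :
  rcomp a k ('X_i *: u) = 'X_i *: rcomp a (k - 1) u.
Proof.
apply/rowP => j; rewrite !mxE mulrC (@hcompM _ _ 1); last first.
  by rewrite /= dhomogX /= mdeg1.
by rewrite mulrC; congr (_ * hcomp _ _); ring.
Qed.

Lemma row_sum_rcomp (u : 'rV[S]_m) : exists N, u = \sum_(k < N) rcomp a k u.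
Proof.
pose n := (\max_j (msize (u 0%R j) + nth 0 ds j))%N.
exists n; apply/rowP => j; rewrite summxE.
have nj : (msize (u 0%R j) + nth 0 ds j <= n)%N by apply: (leq_bigmax j).
under eq_bigr do rewrite mxE.
rewrite -(subnK (leq_trans (leq_addl _ _) nj)) addnC big_split_ord /=.
rewrite [X in _ = X + _]big1 => [|i _]; last first.
  have : i%:Z - (nth 0%N ds j)%:Z < 0 by have := ltn_ord i; lia.
  by case: (i%:Z - _).
rewrite add0r {1}(@pihomog_partitionE _ _ mdeg (n - nth 0 ds j)%N (u 0 j)); last first.
  by rewrite leq_subRL ?(leq_trans (leq_addl _ _) nj) // addnC.
by apply: eq_bigr => i _; rewrite PoszD addrAC subrr add0r.
Qed.

(** Graded Nakayama: a maximal homogeneous family independent modulo the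
    maximal ideal generates, by induction on the degree. *)
Lemma good_generates r c (B : 'M[S]_(r, m)) : good c B ->
  (forall c' (B' : 'M[S]_(r + 1, m)), ~ good c' B') -> exact_mx B A.
Proof.
move=> [[BA indB] gB] maxB u; split=> [uA|[w ->]]; last first.
  by rewrite -mulmxA BA mulmx0.
suff H n (k : nat) v : (k < n)%N -> v *m A = 0 -> piece a k v ->
    exists w : 'rV_r, v = w *m B.
  have [N ->] := row_sum_rcomp u.
  elim/big_ind: _ => [|x y [w ->] [w' ->]|i _].
  - by exists 0; rewrite mul0mx.
  - by exists (w + w'); rewrite mulmxDl.
  - apply: (H i.+1 i) => //; last exact: piece_rcomp.
    rewrite -(rcompM _ _ generators_graded) uA; apply/rowP => l.
    by rewrite !mxE hcomp0.
elim: n k v => // n IHn k v; rewrite ltnS => kn vA pv.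
pose c' (i : 'I_(r + 1)) := if split i is inl j then c j else k.
have /not_andP [] := maxB c' (col_mx B v); last first.
  case=> i j; rewrite /c' mxE; case: splitP => l _; first exact: gB.
  by rewrite ord1; apply: pv.
move=> /not_andP []; first by case; rewrite mul_col_mx BA vA col_mx0.
(* A relation modulo the maximal ideal among the rows of B and v; its coefficient
   al at v is nonzero by independence, and the other terms involve syzygies of
   smaller degree. *)
move=> /existsNP [e /not_implyP [Se e0]].
move: Se; rewrite -[e]hsubmxK map_row_mx mul_row_col; set e1 := lsubmx e; set al := rsubmx e.
have -> : map_mx (@mpolyC 3 K) al *m v = (al 0 0)%:MP *: v.
  by rewrite mulmx_sum_row big_ord1 mxE row_id.
have [al0|al0] := eqVneq (al 0 0) 0.
  rewrite al0 mpolyC0 scale0r addr0 => /indB e10; case: e0.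
  rewrite -[e]hsubmxK -/e1 -/al e10 (_ : al = 0) ?row_mx0 //.
  by apply/rowP => j; rewrite ord1 al0 mxE.
move=> [w [Kw /(congr1 (rcomp a k))]].
have rD (x y : 'rV[S]_m) : rcomp a k (x + y) = rcomp a k x + rcomp a k y.
  by apply/rowP => j; rewrite !mxE hcompD.
have r0 : rcomp a k (0 : 'rV[S]_m) = 0 by apply/rowP => j; rewrite !mxE hcomp0.
rewrite rD (rcompM _ _ gB) (rcomp_id (u := _ *: v)); last first.
  by move=> j; rewrite mxE mul_mpolyC; apply: homogzZ.
rewrite (big_morph _ rD r0) => E.
have [t tE] : exists t : 'rV_r, \sum_(i < 3 | (i < 3)%N) rcomp a k ('X_i *: w i) = t *m B.
  elim/big_ind: _ => [|x y [x' ->] [y' ->]|i _].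
  - by exists 0; rewrite mul0mx.
  - by exists (x' + y'); rewrite mulmxDl.
  - rewrite rcompZX; suff [x ->] : exists x : 'rV_r, rcomp a (k%:Z - 1) (w i) = x *m B.
      by exists ('X_i *: x); rewrite scalemxAl.
    case: (k) kn => [|k'] kn.
      exists 0; rewrite mul0mx; apply/rowP => j; rewrite !mxE.
      by case E1 : (_ - _ - _) => [x|x] //; lia.
    have -> : k'.+1%:Z - 1 = k' by lia.
    apply: (IHn k') => //; last exact: piece_rcomp.
    rewrite -(rcompM _ _ generators_graded) Kw; apply/rowP => l.
    by rewrite !mxE hcomp0.
rewrite tE in E; set x := rcomp _ _ (map_mx _ _) in E.
exists ((al 0 0)^-1%:MP *: (t - x)).
rewrite -scalemxAl mulmxBl -E addrC addKr scalerA -mpolyCM mulVf // mpolyC1.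
by rewrite scale1r.
Qed.

(** The kernel of a minimal family of generators of D0 f is a free module. *)
Lemma graded_syzygy_basis : exists (cs : seq nat) (B : 'M[S]_(size cs, m)),
  [/\ sorted leq cs, graded_mx (fun i => (nth 0%N cs i)%:Z) a B, minimal_mx B,
      (forall w : 'rV_(size cs), w *m B = 0 -> w = 0) & exact_mx B A].
Proof.
have [r [c [B [gB maxB]]]] := maximal_good.
have exB := good_generates gB maxB.
have [p [cs [scs szcs csE]]] := sort_degrees c; subst r.
have [mB gr] := gB; have injB := fun t => minimal_rows_independent generators_exact mB (t := t).
exists cs, (row_perm p B); split=> //.
- by move=> i j; rewrite mxE csE.
- move=> i j; rewrite mxE.
  have := @syzygy_coef0 (row (p i) B) j; rewrite mxE; apply.
  by apply/exB; exists (delta_mx 0 (p i)); rewrite rowE.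
- move=> w; rewrite row_permE mulmxA => /injB /(congr1 (mulmx^~ (perm_mx p^-1%g))).
  by rewrite -mulmxA -perm_mxM mulgV perm_mx1 mulmx1 mul0mx.
- move=> u; split=> [/exB [w ->]|[w ->]].
    exists (w *m perm_mx p^-1%g).
    by rewrite row_permE -mulmxA [perm_mx _ *m _]mulmxA -perm_mxM mulVg perm_mx1 mul1mx.
  by apply/exB; exists (w *m perm_mx p); rewrite row_permE mulmxA.
Qed.

End GradedBasis.

(** * Exponents and degrees of second syzygies *)

Lemma sorted_nth_leq (s : seq nat) x y : sorted leq s -> (x <= y)%N ->
  (y < size s)%N -> (nth 0 s x <= nth 0 s y)%N.
Proof.
move=> ss xy ys; apply: (sorted_leq_nth leq_trans leqnn) => //.
by rewrite inE (leq_ltn_trans xy).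
Qed.

Section Exponents.
Variables (K : numFieldType) (d : nat) (f : {mpoly K[3]}).
Local Notation S := {mpoly K[3]}.
Hypotheses (d1 : (1 < d)%N) (redf : reduced_curve d f).

(** A prime common factor would contradict reducedness. *)
Lemma no_common_factor_unit (g : S) : (forall i, divides g f^`M(i)) -> g \is a GRing.unit.
Proof.
move=> gd; have g0 : g != 0.
  apply: contraTneq isT => g0.
  have [f0 hf _] := redf; have d0 : d%:R != 0 :> K by rewrite pnatr_eq0 -lt0n ltnW.
  suff : d%:R *: f = 0 by move/eqP; rewrite mscalerI (negPf d0) (negPf f0).
  rewrite -(euler_identity hf) big1 // => i _.
  by case: (gd i) => c ->; rewrite g0 !mulr0.
have [[|p s] fs] := factorial_mpoly g0; first exact: factors_nil fs.
have [pp [b _ gE]] := factors_cons fs.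
have [i ni] := reduced_gradient (ltnW d1) redf pp; case: ni.
by apply: divides_trans (gd i); exists b; rewrite gE mulrC.
Qed.

Lemma unit_const (g : S) : g \is a GRing.unit -> g@_0%MM != 0.
Proof. by move=> /andP[_]; rewrite unitfE. Qed.

Section Generators.
Variable ds : seq nat.
Variable A : 'M[S]_(size ds, 3).
Hypothesis minA : minimal_generators f A.

(** If two generators were proportional, dividing them by their coprime
    proportionality factors would give a single syzygy of which both are
    multiples; writing that syzygy in terms of the generators produces a
    relation with a nonzero constant entry. *)
Lemma generators_independent i j (s t : S) : i != j ->
  s *: row i A + t *: row j A = 0 -> s = 0 /\ t = 0.
Proof.
have syz0 (u : 'rV[S]_(size ds)) k : u *m A = 0 -> (u 0 k)@_0%MM = 0.
  exact: (syzygy_coef0 minA).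
have scal0 k (c : S) : c *: row k A = 0 -> c = 0.
  move=> cA; apply/eqP; apply: contraT => c0.
  have : delta_mx 0 k *m A = 0 :> 'rV_3.
    by rewrite -rowE; apply: (scale_row_inj c0); rewrite cA scaler0.
  by move/(syz0 _ k)/eqP; rewrite mxE !eqxx mcoeff1 eqxx oner_eq0.
move=> ij E.
have [t0|t0] := eqVneq t 0.
  by move: E; rewrite t0 scale0r addr0 => /scal0.
have [g [t' [s' [tE sE cop ft']]]] := lowest_terms s (factorial_mpoly t0).
have g0 : g != 0 by apply: contraNneq t0 => g0; rewrite tE g0 mul0r.
have {}E : s' *: row i A + t' *: row j A = 0.
  by apply: (scale_row_inj g0); rewrite scalerDr !scalerA -sE -tE E scaler0.
have t'0 : t' != 0 by apply: contraNneq t0 => t'0; rewrite tE t'0 mulr0.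
have /choice [v vE] : forall k, exists c, A i k = c * t'.
  move=> k; apply: (coprime_cancel ft' cop); exists (- A j k).
  have /rowP/(_ k) := E; rewrite !mxE => /eqP; rewrite addr_eq0 => /eqP ->.
  by rewrite mulNr mulrC.
pose v' := \row_k v k.
have AiE : row i A = t' *: v' by apply/rowP => k; rewrite !mxE vE mulrC.
have AjE : row j A = - s' *: v'.
  apply: (scale_row_inj t'0); apply/eqP; rewrite -subr_eq0 scalerA mulrN scaleNr opprK.
  by rewrite mulrC -scalerA -AiE addrC E.
have [u uE] : exists u : 'rV_(size ds), v' = u *m A.
  apply/(generators_exact minA); apply: (scale_row_inj t'0).
  rewrite scaler0 scalemxAl -AiE; apply/(generators_exact minA).
  by exists (delta_mx 0 i); rewrite rowE.
have Kj : (delta_mx 0 j + s' *: u) *m A = 0.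
  by rewrite mulmxDl -rowE -scalemxAl -uE AjE scaleNr addNr.
have Ki : (delta_mx 0 i - t' *: u) *m A = 0.
  by rewrite mulmxBl -rowE -scalemxAl -uE AiE subrr.
have := syz0 _ i Ki; have := syz0 _ i Kj; have := syz0 _ j Kj.
rewrite !mxE !eqxx (negPf ij) /= add0r mcoeffD mcoeffB mcoeff1 eqxx !rmorphM /= => H1 H2 H3.
exfalso; move/eqP: H2; rewrite mulf_eq0 => /orP[/eqP s0|/eqP u0].
  by move/eqP: H1; rewrite s0 mul0r addr0 oner_eq0.
by move/eqP: H3; rewrite u0 mulr0 subr0 oner_eq0.
Qed.

(** The Koszul syzygies are not all multiples of a single generator, so that a
    second generator occurs in degree at most d - 1. *)
Lemma second_exponent_le (i0 : 'I_(size ds)) : (forall j, j != i0 -> (d <= nth 0 ds j)%N) -> False.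
Proof.
move=> big; have [f0 hf _] := redf.
pose kos (i j : 'I_3) : 'rV[S]_3 := \row_k (if k == i then f^`M(j) else if k == j then - f^`M(i) else 0).
have kosE i j : i != j -> exists g, kos i j = g *: row i0 A.
  move=> ij; have : kos i j *m gradient f = 0.
    apply/rowP => x; rewrite ord1 !mxE (bigD1 i) //= (bigD1 j) 1?eq_sym //= !mxE eqxx.
    rewrite [j == i]eq_sym (negPf ij) eqxx big1 ?addr0 => [|k /andP[ki kj]]; last first.
      by rewrite !mxE (negPf ki) (negPf kj) mul0r.
    by rewrite mulNr mulrC subrr.
  move/(generators_exact minA) => [u uE].
  pose a := fun j : 'I_(size ds) => (nth 0%N ds j)%:Z.
  have {}uE : kos i j = rcomp a (d%:Z - 1) u *m A.
    rewrite -(rcompM _ _ (generators_graded minA)) -uE rcomp_id // => k.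
    rewrite mxE subr0; case: eqP => _; first exact: homog_deriv.
    case: eqP => _; last exact: homogz0.
    by apply/homogzN/homog_deriv.
  exists (rcomp a (d%:Z - 1) u 0 i0); rewrite uE mulmx_sum_row (bigD1 i0) //= big1 ?addr0 //.
  move=> j' j'i; rewrite mxE /a.
  have := big j' j'i; case E : (_ - _) => [n|n] dj; last by rewrite scale0r.
  by lia.
have zeros l : A i0 l != 0 \/ row i0 A = 0 -> forall i, i != l -> f^`M(i) = 0.
  move=> Al i il.
  have [j ji jl] : exists2 j : 'I_3, j != i & j != l.
    case: (i) (l) il => [[|[|[|//]]] ?] [[|[|[|//]]] ?] // _;
    by [exists 0|exists 1|exists ord_max].
  have [g kE] := kosE j i ji.
  have g0 : g *: row i0 A = 0.
    case: Al => [Al|->]; last by rewrite scaler0.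
    have /rowP/(_ l) := kE; rewrite !mxE [l == j]eq_sym (negPf jl) eq_sym (negPf il).
    by move/esym/eqP; rewrite mulf_eq0 (negPf Al) orbF => /eqP ->; rewrite scale0r.
  by have /rowP/(_ j) := kE; rewrite g0 !mxE eqxx.
have [l lz] : exists l, forall i, i != l -> f^`M(i) = 0.
  have [A0|A0] := eqVneq (row i0 A) 0; first by exists 0; apply: zeros; right.
  have [l Al] : exists l, A i0 l != 0.
    apply/existsP; apply: contraNT A0 => /existsPn A0.
    by apply/eqP/rowP => l; rewrite !mxE; apply/eqP; have := A0 l; rewrite negbK.
  by exists l; apply: zeros; left.
have /unit_const : f^`M(l) \is a GRing.unit.
  apply: no_common_factor_unit => i; have [->|/lz ->] := eqVneq i l; last exact: divides0.
  by exists 1; rewrite mul1r.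
have := homog_deriv l hf; have -> : d%:Z - 1 = d.-1 by lia.
move=> /dhomog_nemf_coeff -> //; first by rewrite eqxx.
by rewrite /= mdeg0; lia.
Qed.

(** Otherwise, for reasons of degree, the first j + 1 second syzygies would be
    relations between the first j + 2 generators only, leaving these with rank
    one, although two different generators are independent. *)
Lemma second_syzygy_degree (cs : seq nat) (B : 'M[S]_(size cs, size ds)) j :
  sorted leq ds -> sorted leq cs -> size ds = (size cs).+2 ->
  graded_mx (fun i => (nth 0%N cs i)%:Z) (fun j => (nth 0%N ds j)%:Z) B ->
  minimal_mx B -> (forall w : 'rV_(size cs), w *m B = 0 -> w = 0) ->
  B *m A = 0 -> (j < size cs)%N -> (nth 0 ds j.+2 < nth 0 cs j)%N.
Proof.
move=> sds scs sz gB mB injB BA jc; rewrite ltnNge; apply/negP => cd.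
have widen (i : 'I_j.+1) : (i < size cs)%N by apply: leq_trans (ltn_ord i) _.
pose w (i : 'I_j.+1) := Ordinal (widen i).
pose B1 := rowsub w B.
have winj : injective w by move=> x y /(congr1 val) /= xy; apply: val_inj.
have indB1 (t : 'rV_j.+1) : t *m B1 = 0 -> t = 0.
  rewrite /B1 rowsubE mulmxA => /injB /rowP H; apply/rowP => i.
  have := H (w i); rewrite !mxE (bigD1 i) //= !mxE eqxx mulr1 big1 ?addr0 // => l li.
  by rewrite !mxE (inj_eq winj) (negPf li) mulr0.
pose F := {fraction S}; pose tf := map_mx (@tofrac S).
have rB1 : \rank (tf _ _ B1) = j.+1 by apply/eqP; apply: (independent_row_free indB1).
pose W : 'M[F]_(size ds) := pid_mx j.+2.
have js : (j.+2 < size ds)%N by rewrite sz.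
have rW : \rank W = j.+2 by apply: rank_pid_mx; apply: ltnW.
have supp m (M : 'M[F]_(m, size ds)) : (forall i (k : 'I_(size ds)), (j.+2 <= k)%N -> M i k = 0) -> (M <= W)%MS.
  move=> M0; apply/submxP; exists M; apply/matrixP => i k; rewrite mxE (bigD1 k) //=.
  rewrite big1 ?addr0 => [|l lk]; last by rewrite mxE val_eqE (negPf lk) mulr0.
  rewrite mxE eqxx /=; case: ltnP => [_|/M0 ->]; first by rewrite mulr1.
  by rewrite mul0r.
have B1W : (tf _ _ B1 <= W :&: kermx (tf _ _ A))%MS.
  rewrite sub_capmx; apply/andP; split.
    apply: supp => i k jk; rewrite !mxE (_ : B _ _ = 0) ?rmorph0 //.
    have := gB (w i) k; have ck : (nth 0 cs (w i) <= nth 0 ds k)%N.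
      apply: leq_trans (leq_trans (sorted_nth_leq scs _ jc) cd) (sorted_nth_leq sds jk _) => //.
      exact: (ltn_ord i).
    case E : (_ - _) => [n|n] //= hn; have n0 : n = 0%N by lia.
    apply/mpolyP => x; rewrite mcoeff0; have [->|x0] := eqVneq x 0%MM; first exact: mB.
    by apply: (dhomog_nemf_coeff hn); rewrite n0 /= mdeg_eq0.
  apply/sub_kermxP; rewrite -map_mxM /B1 mul_rowsub_mx BA.
  by apply/matrixP => i k; rewrite !mxE rmorph0.
(* W has rank j + 2 and meets the kernel of A in rank at least j + 1. *)
have rWA : (\rank (W *m tf _ _ A) <= 1)%N.
  have := mxrank_mul_ker W (tf _ _ A); rewrite rW.
  have := mxrankS B1W; rewrite rB1.
  by move: (\rank (W :&: _)) (\rank (W *m _)) => x y; clear; lia.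
have sz2 : (1 < size ds)%N by rewrite sz.
pose i0 := Ordinal (ltnW sz2); pose i1 := Ordinal sz2.
pose e (i : 'I_2) := if i == 0 then i0 else i1.
have indE (t : 'rV_2) : t *m rowsub e A = 0 -> t = 0.
  rewrite mulmx_sum_row !big_ord_recl big_ord0 addr0 !row_rowsub /e /=.
  case/generators_independent => // t0 t1; apply/rowP => i; rewrite mxE.
  by case: (unliftP 0 i) => [k|] -> //; rewrite ord1.
have /eqP rE := independent_row_free indE.
suff : (1 < \rank (W *m tf _ _ A))%N by rewrite ltnNge rWA.
rewrite -[X in (X <= _)%N]rE; apply: mxrankS.
rewrite [X in (X <= _)%MS](_ : _ = rowsub e 1%:M *m tf _ _ A).
  apply: submxMr; apply: supp => i k jk; rewrite !mxE.
  by rewrite /e; case: ifP => _; rewrite -val_eqE /= ltn_eqF // (leq_trans _ jk).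
by rewrite -rowsubE /tf -map_mxsub.
Qed.

End Generators.
End Exponents.

(** * Uniqueness of exponents and the resolution in type two *)

(** A nonvanishing determinant has a nonvanishing term. *)
Lemma unitmx_perm (K : fieldType) n (P : 'M[K]_n) (d d' : 'I_n -> nat) :
  P \in unitmx -> (forall i j, P i j != 0 -> d i = d' j) ->
  perm_eq [tuple d i | i < n] [tuple d' i | i < n].
Proof.
rewrite unitmxE unitfE => Pu Pd; suff [s sE] : exists s : 'S_n, forall i, d i = d' (s i).
  apply/tuple_permP; exists s; congr val; apply: eq_from_tnth => i.
  by rewrite !tnth_mktuple.
apply: contrapT => /forallNP ns.
case/eqP: Pu; rewrite /determinant big1 // => s _.
have /existsNP [i di] := ns s; rewrite (bigD1 i) //=.
have [->|/Pd//] := eqVneq (P i (s i)) 0; by rewrite mul0r mulr0.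
Qed.

Lemma nth_tupleE (s : seq nat) : [tuple nth 0%N s i | i < size s] = s :> seq nat.
Proof.
apply: (@eq_from_nth _ 0%N) => [|i]; rewrite size_tuple // => ilt.
by rewrite -(tnth_nth 0%N _ (Ordinal ilt)) tnth_mktuple.
Qed.

Section Uniqueness.
Variables (K : fieldType) (f : {mpoly K[3]}).
Local Notation S := {mpoly K[3]}.

Lemma generators_transition ds ds' (A : 'M[S]_(size ds, 3)) (A' : 'M[S]_(size ds', 3)) :
  minimal_generators f A -> minimal_generators f A' ->
  exists P : 'M[S]_(size ds, size ds'), A = P *m A' /\
    graded_mx (fun i => (nth 0%N ds i)%:Z) (fun j => (nth 0%N ds' j)%:Z) P.
Proof.
move=> mA mA'; pose a' := fun j : 'I_(size ds') => (nth 0%N ds' j)%:Z.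
have /choice [p pE] : forall i, exists u : 'rV_(size ds'),
    row i A = u *m A' /\ piece a' (nth 0%N ds i) u.
  move=> i; have : row i A *m gradient f = 0.
    by apply/(generators_exact mA); exists (delta_mx 0 i); rewrite rowE.
  move/(generators_exact mA') => [u uE]; exists (rcomp a' (nth 0%N ds i) u).
  split; last exact: piece_rcomp.
  rewrite -(rcompM _ _ (generators_graded mA')) -uE rcomp_id // => j.
  by rewrite mxE; have := generators_graded mA i j.
exists (\matrix_i p i); split.
  by apply/row_matrixP => i; rewrite row_mul rowK; case: (pE i).
by move=> i j; case: (pE i) => _ /(_ j); rewrite mxE.
Qed.

(** Two minimal systems of generators are related by matrices that are inverse
    to each other modulo the maximal ideal; a nonzero term of the determinant
    matches the degrees. *)
Lemma exponents_unique ds ds' : exponents f ds -> exponents f ds' -> ds = ds'.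
Proof.
move=> [sds [A mA]] [sds' [A' mA']].
have [P [AE gP]] := generators_transition mA mA'.
have [Q [A'E gQ]] := generators_transition mA' mA.
have inv (es es' : seq nat) (E : 'M[S]_(size es, 3)) (E' : 'M[S]_(size es', 3)) X Y :
    minimal_generators f E -> E = X *m E' -> E' = Y *m E ->
    map_mx (mcoeff 0%MM) X *m map_mx (mcoeff 0%MM) Y = 1%:M.
  move=> mE EE E'E; rewrite -map_mxM; apply/matrixP => i j; rewrite mxE [RHS]mxE.
  have := @syzygy_coef0 _ _ _ _ mE (row i (X *m Y) - delta_mx 0 i) j.
  rewrite mulmxBl -rowE -row_mul -mulmxA -E'E -EE subrr => /(_ erefl).
  rewrite !mxE mcoeffB eqxx /= [j == i]eq_sym => /eqP; rewrite subr_eq0 => /eqP ->.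
  by case: eqP => _; rewrite ?mcoeff1 ?eqxx ?mcoeff0.
have PQ := inv ds ds' A A' P Q mA AE A'E; have QP := inv ds' ds A' A Q P mA' A'E AE.
have sz : size ds = size ds'.
  by apply/eqP; rewrite eqn_leq (mulmx1_min PQ) (mulmx1_min QP).
have pm : perm_eq ds ds'.
  pose d' (j : 'I_(size ds')) := nth 0%N ds' j.
  have degP i j : (map_mx (mcoeff 0%MM) P) i j != 0 -> nth 0%N ds i = d' j.
    rewrite mxE; have := gP i j; case E : (_ - _) => [n|n] /= hP; last by rewrite hP mcoeff0 eqxx.
    have [n0|n0] := eqVneq n 0%N; first by rewrite /d'; lia.
    by rewrite (dhomog_nemf_coeff hP) ?eqxx //= mdeg0 eq_sym.
  suff : perm_eq [tuple nth 0%N ds i | i < size ds] [tuple d' i | i < size ds'].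
    by rewrite nth_tupleE (nth_tupleE ds').
  move: d' degP PQ; move: (map_mx _ P) (map_mx _ Q).
  case: (size ds') / sz => P0 Q0 d' degP PQ.
  by apply: unitmx_perm degP; have [] := mulmx1_unit PQ.
exact: (sorted_eq leq_trans anti_leq sds sds' pm).
Qed.

End Uniqueness.

Lemma sum_ltn_nth (s t : seq nat) : size s = size t ->
  (forall j, (j < size t)%N -> (nth 0 s j < nth 0 t j)%N) ->
  (\sum_(x <- s) x + size t <= \sum_(x <- t) x)%N.
Proof.
elim: s t => [|x s IHs] [|y t] //; first by rewrite !big_nil.
move=> [st] lt; rewrite !big_cons /=; have /= := lt 0%N isT.
have := IHs t st (fun j => lt j.+1); lia.
Qed.

Section TypeTwo.
Variables (K : numFieldType) (d : nat) (f : {mpoly K[3]}).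
Hypotheses (d1 : (1 < d)%N) (redf : reduced_curve d f).
Local Notation S := {mpoly K[3]}.

(** Nonzero exponents are what makes the matrix of the generators minimal; the
    inequality says that the epsilons are positive. *)
Lemma exponents_resolution ds : exponents f ds -> (forall x, x \in ds -> (0 < x)%N) ->
  exists cs : seq nat, minimal_resolution d f ds [seq (d.-1 + c)%N | c <- cs] /\
    forall j, (j < size cs)%N -> (nth 0 ds j.+2 < nth 0 cs j)%N.
Proof.
move=> [sds [A mA]] ds0; have [f0 hf _] := redf.
have [cs [B [scs gB mB iB eB]]] := graded_syzygy_basis mA.
have BA : B *m A = 0.
  apply/row_matrixP => i; rewrite row0 row_mul; apply/eB.
  by exists (delta_mx 0 i); rewrite rowE.
pose cs' := [seq (d.-1 + c)%N | c <- cs].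
have szc : size cs = size cs' by rewrite size_map.
pose good n (M : 'M[S]_(n, size ds)) :=
  [/\ forall (i : 'I_n) (j : 'I_(size ds)), homogz ((nth 0%N cs i)%:Z - (nth 0%N ds j)%:Z) (M i j),
      minimal_mx M, (forall w : 'rV_n, w *m M = 0 -> w = 0) & exact_mx M A].
have [B' [gB' mB' iB' eB']] : exists B' : 'M_(size cs', size ds), good _ B'.
  by move: (size cs') szc => n szc; case: n / szc; exists B.
have gA := generators_graded mA; have eA := generators_exact mA.
pose Dc (i : 'I_(size cs')) := (nth 0%N cs' i)%:Z.
have gB'' : graded_mx (fun i : 'I_(size cs') => (nth 0%N cs' i)%:Z)
    (fun j : 'I_(size ds) => d%:Z + (nth 0%N ds j)%:Z - 1) B'.
  move=> i j; have := gB' i j; rewrite (nth_map 0%N) ?szc // PoszD.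
  by congr homogz; lia.
have gA' : graded_mx (fun j : 'I_(size ds) => d%:Z + (nth 0%N ds j)%:Z - 1)
    (fun _ : 'I_3 => d%:Z - 1) A.
  by move=> i j; have := gA i j; congr homogz; ring.
have gG := graded_gradient hf.
have res : resolution d f ds cs' by exists B', A.
have [sz _ _] := resolution_numerics d1 redf res.
exists cs; split; last first.
  move=> j jc; apply: (second_syzygy_degree d1 mA sds scs _ gB mB iB BA jc).
  by rewrite sz -szc.
split=> //.
  by rewrite sorted_map; apply: sub_sorted scs => x y /=; rewrite leq_add2l.
exists B', A; split=> //; split=> //.
- move=> i j; have := gA i j; rewrite subr0 /= => hA.
  apply: (dhomog_nemf_coeff hA); rewrite /= mdeg0 eq_sym -lt0n ds0 //.
  by rewrite mem_nth.
- move=> i j; have := gG i j; rewrite subr0 (_ : d%:Z - 1 = d.-1) /=; last by lia.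
  by move/dhomog_nemf_coeff; apply; rewrite /= mdeg0; lia.
Qed.

(** The linear relation between the degrees says that the differences between the
    degrees of the second syzygies and those of the generators from the third
    on sum up to 2; as they are positive, there are at most two of them, and
    the case of none is excluded. *)
Lemma curve_type2_resolution : curve_type d f 2 -> exists ds cs : seq nat,
  [/\ exponents f ds, minimal_resolution d f ds cs &
    (exists a b c, [/\ ds = [:: a; b; c], cs = [:: (d.-1 + c + 2)%N] & (a + b = d + 1)%N])
    \/ (exists a b c e, [/\ ds = [:: a; b; c; e], cs = [:: d.-1 + c + 1; d.-1 + e + 1]%N
                           & (a + b = d + 1)%N])].
Proof.
move=> [a [b [ds0 [exps]]]] tE; set ds := [:: a, b & ds0] in exps.
have abE : (a + b = d + 1)%N by lia.
have [sds [A mA]] := exps.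
have bd : (b < d)%N.
  rewrite ltnNge; apply/negP => db; apply: (second_exponent_le d1 redf mA (i0 := ord0)).
  case=> [[//|j] jlt] _ /=; apply: leq_trans db _.
  exact: (@sorted_nth_leq ds 1 j.+1 sds).
have a0 : (0 < a)%N by lia.
have ds_gt0 x : x \in ds -> (0 < x)%N.
  move=> /(nthP 0%N) [i ilt <-]; apply: leq_trans a0 _.
  exact: (@sorted_nth_leq ds 0 i sds).
have [cs [res cgt]] := exponents_resolution exps ds_gt0.
exists ds, [seq (d.-1 + c)%N | c <- cs]; split=> //.
have [sz sm _] := resolution_numerics d1 redf (minimal_resolution_resolution res).
rewrite size_map in sz; have {}sz : size ds0 = size cs by case: sz.
have cgt' j : (j < size cs)%N -> (nth 0 ds0 j < nth 0 cs j)%N by move=> /cgt.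
have lts := sum_ltn_nth sz cgt'.
have {}sm : (\sum_(x <- cs) x = \sum_(x <- ds0) x + 2)%N.
  have sumD (s : seq nat) : \sum_(x <- s) (d%:Z - 1 + x%:Z) =
      (d%:Z - 1) * (size s)%:Z + (\sum_(x <- s) x)%N%:Z.
    elim: s => [|x s IHs]; first by rewrite !big_nil mulr0.
    by rewrite !big_cons IHs /= -[(size s).+1]addn1 !PoszD; ring.
  have sumD' (s : seq nat) : \sum_(x <- s) (d.-1 + x)%N%:Z = \sum_(x <- s) (d%:Z - 1 + x%:Z).
    by apply: eq_bigr => x _; rewrite PoszD; congr (_ + _); lia.
  move: sm; rewrite big_map sumD' /ds !big_cons !sumD sz.
  move: (\sum_(x <- cs) x)%N (\sum_(x <- ds0) x)%N => X Y.
  by move: ((d%:Z - 1) * _) => Z; clear -abE d1; lia.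
have szcs : (size cs <= 2)%N by lia.
rewrite /ds {bd a0}; clear res lts exps sds mA A ds_gt0 cgt ds.
case: cs szcs sz sm cgt' => [|x [|y [|//]]] _ sz.
- by case: ds0 sz => //; rewrite !big_nil.
- case: ds0 sz => [|c [|//]] // _; rewrite !big_cons !big_nil => sm _.
  left; exists a, b, c; split=> //=.
  by congr [:: _]; lia.
- case: ds0 sz => [|c [|e [|//]]] // _; rewrite !big_cons !big_nil => sm cgt.
  have /= cx := cgt 0%N isT; have /= ey := cgt 1%N isT.
  right; exists a, b, c, e; split=> //=.
  by congr [:: _; _]; lia.
Qed.
End TypeTwo.

(** * Linear forms avoiding the singular points *)

Section Ideals.
Variable R : comNzRingType.
Implicit Types (I : R -> Prop) (p q g : R).

Definition is_ideal I := [/\ I 0, forall p q, I p -> I q -> I (p + q)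
  & forall p q, I q -> I (p * q)].

Definition adjoin I g p := exists c, I (p - c * g).

Section OneIdeal.
Variable I : R -> Prop.
Hypothesis idI : is_ideal I.

Lemma ideal0 : I 0. Proof. by case: idI. Qed.
Lemma idealD p q : I p -> I q -> I (p + q). Proof. by case: idI => _ + _; apply. Qed.
Lemma idealM p q : I q -> I (p * q). Proof. by case: idI => _ _; apply. Qed.
Lemma idealMr p q : I p -> I (p * q). Proof. by rewrite mulrC; apply: idealM. Qed.
Lemma idealN p : I p -> I (- p). Proof. by rewrite -mulN1r; apply: idealM. Qed.
Lemma idealB p q : I p -> I q -> I (p - q).
Proof. by move=> Ip Iq; apply: idealD => //; apply: idealN. Qed.
Lemma ideal_sum (T : Type) (r : seq T) (P : pred T) (F : T -> R) :
  (forall i, P i -> I (F i)) -> I (\sum_(i <- r | P i) F i).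
Proof. by move=> H; elim/big_ind: _; [apply: ideal0|apply: idealD|]. Qed.

Lemma ideal_congr p q : I (p - q) -> I p <-> I q.
Proof.
move=> H; split=> [Ip|Iq]; first by rewrite -[q](subKr p); apply: idealB.
by rewrite -[p](subrK q); apply: idealD.
Qed.

Lemma ideal_congrM p q p' q' : I (p - q) -> I (p' - q') -> I (p * p' - q * q').
Proof.
move=> H H'; have -> : p * p' - q * q' = p' * (p - q) + q * (p' - q') by ring.
by apply: idealD; apply: idealM.
Qed.

Lemma ideal_congrX p q n : I (p - q) -> I (p ^+ n - q ^+ n).
Proof.
move=> H; elim: n => [|n IHn]; first by rewrite subrr; apply: ideal0.
by rewrite !exprS; apply: ideal_congrM.
Qed.

Lemma ideal_congr_prod (T : Type) (r : seq T) (F G : T -> R) :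
  (forall i, I (F i - G i)) -> I (\prod_(i <- r) F i - \prod_(i <- r) G i).
Proof.
move=> H; elim: r => [|x r IHr]; first by rewrite !big_nil subrr; apply: ideal0.
by rewrite !big_cons; apply: ideal_congrM.
Qed.

Lemma is_ideal_adjoin g : is_ideal (adjoin I g).
Proof.
split=> [|p q [a Ha] [b Hb]|p q [a Ha]].
- by exists 0; rewrite mul0r subrr; apply: ideal0.
- exists (a + b); have -> : p + q - (a + b) * g = (p - a * g) + (q - b * g) by ring.
  exact: idealD.
- by exists (p * a); rewrite -mulrA -mulrBr; apply: idealM.
Qed.

Lemma adjoin_sub g p : I p -> adjoin I g p.
Proof. by move=> Ip; exists 0; rewrite mul0r subr0. Qed.

Lemma adjoin_gen g : adjoin I g g.
Proof. by exists 1; rewrite mul1r subrr; apply: ideal0. Qed.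

Definition nilpotent_mod p := exists n, I (p ^+ n).

Lemma nilpotent_modD p q : nilpotent_mod p -> nilpotent_mod q -> nilpotent_mod (p + q).
Proof.
move=> [n Hn] [m Hm]; exists (n + m)%N; rewrite exprDn; apply: ideal_sum => i _.
rewrite -mulr_natr; apply: idealMr.
have [mi|im] := leqP m i.
  by rewrite -(subnK mi) exprD; apply: idealM; apply: idealM.
have ni : (n <= n + m - i)%N by rewrite -addnBA ?leq_addr // ltnW.
by rewrite -(subnK ni) exprD mulrC; apply: idealM; apply: idealM.
Qed.

Lemma nilpotent_modM p q : nilpotent_mod q -> nilpotent_mod (p * q).
Proof. by move=> [n Hn]; exists n; rewrite exprMn; apply: idealM. Qed.

Lemma nilpotent_mod_sub p : I p -> nilpotent_mod p.
Proof. by exists 1; rewrite expr1. Qed.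

Lemma nilpotent_modX p n : nilpotent_mod (p ^+ n) -> nilpotent_mod p.
Proof. by move=> [m Hm]; exists (n * m)%N; rewrite exprM. Qed.

End OneIdeal.
End Ideals.

Section Surjective.
Variables (K : fieldType) (V V' : lmodType K) (phi : V -> V').
Hypothesis phiL : linear phi.

(** A surjection between spaces of equal finite dimension is injective; it is
    expressed on representatives. *)
Lemma qdim_surj_inj (P U : V -> Prop) (P' U' : V' -> Prop) n :
  subspace P -> subspace U -> subspace P' -> subspace U' ->
  (forall a, U a -> P a) ->
  (forall a, P a -> P' (phi a)) -> (forall a, U a -> U' (phi a)) ->
  (forall h, P' h -> exists2 a, P a & U' (h - phi a)) ->
  qdim P U n -> qdim P' U' n -> forall a, P a -> U' (phi a) -> U a.
Proof.
move=> sP sU sP' sU' UP PP' UU' surj dn dn'.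
have sW : subspace (fun a => P a /\ U' (phi a)).
  by apply: subspaceI => //; apply: subspace_preim.
have dW : qdim P (fun a => P a /\ U' (phi a)) n.
  by refine ((qdim_iso phiL sP sW sP' sU' _ _ _ _ _).2 dn') => // a Pa [].
have [b _ db] : exists2 b, (b <= n)%N & qdim (fun a => P a /\ U' (phi a)) U b.
  by apply: qdim_subspace dn => // a [].
have : n = (n + b)%N.
  apply: (qdim_uniq sP sU dn); apply: qdim_add dW db => // [a Ua|a []//].
  by split; [apply: UP|apply: UU'].
move=> nb; have b0 : b = 0%N by lia.
by rewrite b0 in db; move=> a Pa Ua; apply: (qdim0_sub sU db).
Qed.

End Surjective.

Section BinaryForms.
Variables (K : closedFieldType) (n : nat).
Local Notation S := {mpoly K[n]}.

(** The binary form associated with P, of degree N, evaluated at the pair (a, b). *)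
Definition homogenization (a b : S) (N : nat) (P : {poly K}) : S :=
  \sum_(i < N.+1) P`_i *: (a ^+ i * b ^+ (N - i)).

Lemma homogenization1 a b N : homogenization a b N 1 = b ^+ N.
Proof.
rewrite /homogenization big_ord_recl coef1 eqxx scale1r mul1r subn0.
by rewrite big1 ?addr0 // => i _; rewrite coef1 scale0r.
Qed.

Lemma homogenizationM a b N (P : {poly K}) r : (size P <= N.+1)%N ->
  homogenization a b N.+1 (('X - r%:P) * P) = (a - r *: b) * homogenization a b N P.
Proof.
move=> sP; rewrite mulrBl /homogenization.
under eq_bigr do rewrite coefB coefXM coefCM scalerBl.
rewrite sumrB mulrBl; congr (_ - _).
  rewrite big_ord_recl eqxx scale0r add0r mulr_sumr; apply: eq_bigr => i _.
  by rewrite lift0 /= subSS exprS -mulrA scalerAr.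
rewrite big_ord_recr /= nth_default // mulr0 scale0r addr0 -scalerAl mulr_sumr scaler_sumr.
apply: eq_bigr => i _; rewrite -scalerA; congr (_ *: _).
by rewrite -scalerAr mulrCA -exprS subSn // -ltnS.
Qed.

Lemma homogenization_prod a b M (rs : seq K) :
  homogenization a b (M + size rs) (\prod_(r <- rs) ('X - r%:P)) =
  b ^+ M * \prod_(r <- rs) (a - r *: b).
Proof.
elim: rs => [|r rs IHrs]; first by rewrite !big_nil addn0 homogenization1 mulr1.
rewrite !big_cons addnS homogenizationM ?IHrs; first by rewrite mulrCA.
by rewrite size_prod_XsubC ltnS leq_addl.
Qed.

End BinaryForms.

Section JacobianRing.
Variables (K : numClosedFieldType) (d : nat) (f : {mpoly K[3]}).
Local Notation S := {mpoly K[3]}.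
Hypotheses (d1 : (1 < d)%N) (redf : reduced_curve d f).
Variables (k0 t : nat).
Hypothesis dimJ : forall k : nat, (k0 <= k)%N -> qdim (homogz k) (jacobian_ideal f) t.

Lemma is_ideal_jacobian : is_ideal (jacobian_ideal f).
Proof.
split; [exact: jacobian0|exact: jacobianD|exact: jacobianM].
Qed.

Lemma jacobian_hcomp (k : int) p : jacobian_ideal f p -> jacobian_ideal f (hcomp k p).
Proof.
have [_ hf _] := redf; move=> [v ->]; rewrite hcomp_sum.
exists (\row_i hcomp (k - (d%:Z - 1)) (v 0 i)); apply: eq_bigr => i _.
by rewrite (hcompM _ _ (homog_deriv i hf)) mxE.
Qed.

(** In high degree there are more monomials in two linear forms than the
    dimension of the Jacobian ring, and a binary form splits. *)
Lemma binary_form (a b : S) : homogz 1 a -> homogz 1 b ->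
  exists M rs, jacobian_ideal f (b ^+ M * \prod_(r <- rs) (a - r *: b)).
Proof.
move=> ha hb; pose k := (k0 + t)%N.
pose e (i : 'I_k.+1) := a ^+ i * b ^+ (k - i).
have he i : homogz k (e i).
  have := dhomogM (dhomogMn i (ha : a \is 1.-homog)) (dhomogMn (k - i) (hb : b \is 1.-homog)).
  by rewrite !mul1n subnKC // -ltnS.
have sH := subspace_homogz K k; have sJ := subspace_jacobian f.
(* In degree k there are k + 1 > t products of powers of a and b. *)
have [c [Jc c0]] : exists c : 'rV[K]_k.+1, jacobian_ideal f (lincomb e c) /\ c <> 0.
  apply: contrapT => /forallNP nc.
  have fe : qfree (homogz k) (jacobian_ideal f) e.
    by split=> // c Jc; apply: contrapT => c0; apply: (nc c).
  have [] := qfree_le sH sJ (dimJ (leq_addr _ _)) fe; rewrite /k; lia.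
pose P := \poly_(i < k.+1) c 0 (inord i).
have P0 : P != 0.
  apply: contra_not_neq c0 => P0; apply/rowP => i; rewrite mxE.
  have /polyP/(_ i) := P0; rewrite coef_poly coef0 ltn_ord.
  by congr (c _ _ = _); apply: val_inj; rewrite /= inordK.
have [rs PE] := closed_field_poly_normal P.
have l0 : lead_coef P != 0 by rewrite lead_coef_eq0.
have sP : (size rs <= k)%N.
  have := size_poly k.+1 (fun i => c 0 (inord i)).
  by rewrite -/P PE size_scale // size_prod_XsubC ltnS.
exists (k - size rs)%N, rs; rewrite -homogenization_prod subnK //.
have HE : homogenization a b k P = lincomb e c.
  apply: eq_bigr => i _; rewrite coef_poly ltn_ord; congr (c _ _ *: _).
  by apply: val_inj; rewrite /= inordK.
have := jacobianZ (lead_coef P)^-1 Jc; rewrite -HE [in homogenization _ _ _ _]PE.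
congr jacobian_ideal; rewrite /homogenization scaler_sumr; apply: eq_bigr => i _.
by rewrite coefZ scalerA mulrA mulVf // mul1r.
Qed.

Definition point3 (a b c : K) : 'rV[K]_3 :=
  \row_i (if i == 0 then a else if i == 1 then b else c).

(** With m_0 (d + 1) + m_1 as exponent, distinct monomials of degree d have
    distinct powers along the curve (x^(d+1), x, 1), as in Kronecker
    substitution. *)
Lemma exists_nonroot : exists a b, f.@[point3 a b 1 0] != 0.
Proof.
have [f0 hf _] := redf; move/dhomogP: hf => hf.
pose w (m : 'X_{1..3}) := (m 0%R * d.+1 + m 1%R)%N.
pose g : {poly K} := \sum_(m <- msupp f) f@_m *: 'X^(w m).
have g0 : g != 0.
  apply/eqP => /polyP/(_ (w (mlead f))); rewrite coef0 /g coef_sum.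
  rewrite (bigD1_seq (mlead f)) ?mlead_supp ?msupp_uniq //=.
  rewrite coefZ coefXn eqxx mulr1 big1_seq ?addr0 => [/eqP|m /andP[ml mf]].
    by rewrite mleadc_eq0 (negPf f0).
  rewrite coefZ coefXn; case: eqP => [wE|_]; last by rewrite mulr0.
  case/eqP: ml; have := hf _ mf; have := hf _ (mlead_supp f0); rewrite /= !mdegE.
  rewrite !big_ord_recl !big_ord0 => dl dm.
  move: wE; rewrite /w.
  have -> : (1 : 'I_3) = lift ord0 ord0 by apply: val_inj.
  have -> : (0 : 'I_3) = ord0 by apply: val_inj.
  move=> wE.
  have m1 : (m (lift ord0 ord0) < d.+1)%N by rewrite -dm ltnS addnCA leq_addr.
  have M1 : (mlead f (lift ord0 ord0) < d.+1)%N by rewrite -dl ltnS addnCA leq_addr.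
  have e0 : m ord0 = mlead f ord0.
    by move/(congr1 (divn^~ d.+1)): wE; rewrite !divnMDl // !divn_small ?addn0.
  have e1 : m (lift ord0 ord0) = mlead f (lift ord0 ord0).
    by move: wE; rewrite e0 => /addnI.
  have e2 : m (lift ord0 (lift ord0 ord0)) = mlead f (lift ord0 (lift ord0 ord0)).
    by move: dm; rewrite -dl e0 e1 => /addnI /addnI; rewrite !addn0.
  apply/mnmP => i; case: (unliftP ord0 i) => [j|] -> //.
  case: (unliftP ord0 j) => [l|] -> //.
  by rewrite (ord1 l).
have /closed_nonrootP [x nx] := g0.
exists (x ^+ d.+1), x; apply: contraNneq nx => fx; rewrite /root; apply/eqP.
rewrite -[RHS]fx mevalE horner_sum; apply: eq_bigr => m _.
rewrite hornerZ hornerXn; congr (_ * _).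
rewrite /w mulnC exprD exprM !big_ord_recl big_ord0 !mxE /= expr1n !mulr1.
by congr (_ ^+ m _ * _ ^+ m _); apply: val_inj.
Qed.

(** Modulo I each variable is a multiple of l, so that a form becomes its value
    times a power of l. *)
Lemma ideal_subst I (q : 'I_3 -> K) (l g : S) (e : nat) : is_ideal I ->
  (forall i, I ('X_i - q i *: l)) -> g \is e.-homog -> I (g - g.@[q] *: l ^+ e).
Proof.
move=> idI Iq /dhomogP hg; rewrite mevalE scaler_suml {1}[g]mpolyE -sumrB.
rewrite big_seq; apply: (ideal_sum idI) => m /hg mE.
rewrite -scalerA -scalerBr -[_ *: _]mul_mpolyC; apply: (idealM idI).
rewrite mpolyXE_id -mE /= mdegE expr_sum.
have -> : (\prod_i q i ^+ m i) *: (\prod_i l ^+ m i) = \prod_i (q i *: l) ^+ m i.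
  under [RHS]eq_bigr do rewrite exprZn -mul_mpolyC.
  by rewrite big_split /= -mul_mpolyC rmorph_prod.
by apply: ideal_congr_prod => // i; apply: ideal_congrX.
Qed.

Lemma homogz_var (i : 'I_3) : homogz 1 ('X_i : S).
Proof. by rewrite /= dhomogX /= mdeg1. Qed.

(** Since f does not vanish at the point (a, b, 1), projection from it gives two
    linear forms l0 and l1 of which a product of combinations lies in J. A
    combination l different from those makes l1, then l0, then the last
    variable nilpotent modulo J and l, hence S / (J, l) finite dimensional. *)
Lemma exists_linear_form : exists l : S, homogz 1 l /\ exists k1 : nat,
  forall (k : nat) p, (k1 <= k)%N -> homogz k p ->
    exists2 q, homogz (k%:Z - 1) q & jacobian_ideal f (p - q * l).
Proof.
have [f0 hf _] := redf; have [a [b fab]] := exists_nonroot.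
pose z : S := 'X_ord_max.
pose l0 := 'X_0 - a *: z; pose l1 := 'X_1 - b *: z.
have hl (c : K) (i : 'I_3) : homogz 1 ('X_i - c *: z).
  by apply: homogzD; [|apply/homogzN/homogzZ]; apply: homogz_var.
have [M [rs Jrs]] := binary_form (hl a 0) (hl b 1); rewrite -/l0 -/l1 in Jrs.
(* Modulo l0 - s l1 the factors l0 - r l1 become nonzero multiples of l1. *)
have [s srs] : exists s, s \notin rs.
  have /closed_nonrootP [s] : \prod_(r <- rs) ('X - r%:P) != 0 :> {poly K}.
    by apply: monic_neq0; apply: monic_prod_XsubC.
  by rewrite root_prod_XsubC; exists s.
pose l := l0 - s *: l1.
have hl' : homogz 1 l by apply: homogzD; [|apply/homogzN/homogzZ]; apply: hl.
exists l; split=> //.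
have idJ := is_ideal_jacobian.
have [I [idI Il JI IJ]] : exists I : S -> Prop, [/\ is_ideal I, I l,
    forall p, jacobian_ideal f p -> I p & forall p, I p -> exists c, jacobian_ideal f (p - c * l)].
  exists (adjoin (jacobian_ideal f) l); split=> //; first exact: is_ideal_adjoin.
    exact: adjoin_gen.
  exact: adjoin_sub.
have IZ (c : K) p : I p -> I (c *: p) by move=> Ip; rewrite -mul_mpolyC; apply: idealM.
have nZ (c : K) p : nilpotent_mod I p -> nilpotent_mod I (c *: p).
  by move=> Np; rewrite -mul_mpolyC; apply: nilpotent_modM.
have n1 : nilpotent_mod I l1.
  exists (M + size rs)%N.
  have Jrs' := JI _ Jrs.
  have E : I (l1 ^+ M * \prod_(r <- rs) (l0 - r *: l1) -
              l1 ^+ M * \prod_(r <- rs) ((s - r) *: l1)).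
    apply: ideal_congrM => //; first by rewrite subrr; apply: ideal0.
    apply: ideal_congr_prod => // r.
    by rewrite (_ : _ - _ = l) // scalerBl opprB addrA subrK.
  have := (ideal_congr idI E).1 Jrs'.
  have -> : \prod_(r <- rs) ((s - r) *: l1) = (\prod_(r <- rs) (s - r)) *: l1 ^+ size rs.
    elim: (rs) => [|r rs' IHr]; first by rewrite !big_nil scale1r.
    by rewrite !big_cons IHr /= exprS -scalerAl -scalerAr scalerA.
  rewrite -scalerAr -exprD => /(IZ (\prod_(r <- rs) (s - r))^-1).
  rewrite scalerA mulVf ?scale1r //.
  rewrite prodf_seq_neq0; apply/allP => r rrs /=.
  by rewrite subr_eq0; apply: contraNneq srs => ->.
have n0 : nilpotent_mod I l0.
  have -> : l0 = l + s *: l1 by rewrite subrK.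
  by apply: (nilpotent_modD idI); [apply: nilpotent_mod_sub|apply: nZ].
have nz : nilpotent_mod I z.
  pose q := point3 a b 1 0.
  have := @ideal_subst (adjoin (adjoin I l0) l1) q z f d.
  have idI0 := is_ideal_adjoin idI l0; have idI1 := is_ideal_adjoin idI0 l1.
  case=> //; first last.
    move=> c1 [c0 H]; have : nilpotent_mod I (f.@[q] *: z ^+ d).
      have -> : f.@[q] *: z ^+ d =
          f + - (f - f.@[q] *: z ^+ d - c1 * l1 - c0 * l0) + - c1 * l1 + - c0 * l0 by ring.
      apply: (nilpotent_modD idI); last exact: nilpotent_modM.
      apply: (nilpotent_modD idI); last exact: nilpotent_modM.
      apply: nilpotent_mod_sub; apply: (idealD idI); last exact: (idealN idI).
      by apply: JI; apply: jacobian_self (ltnW d1) hf.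
    move=> /(nZ (f.@[q])^-1); rewrite scalerA mulVf // scale1r.
    exact: nilpotent_modX.
  move=> i; case: i => [[|[|[|//]]] ilt]; rewrite /q mxE /=.
  - rewrite (_ : Ordinal ilt = 0); last exact: val_inj.
    by apply: adjoin_sub => //; apply: adjoin_gen.
  - rewrite (_ : Ordinal ilt = 1); last exact: val_inj.
    exact: adjoin_gen.
  - rewrite (_ : Ordinal ilt = ord_max); last exact: val_inj.
    by rewrite scale1r subrr; apply: ideal0.
have nX (i : 'I_3) : nilpotent_mod I ('X_i : S).
  case: i => [[|[|[|//]]] ilt].
  - rewrite (_ : Ordinal ilt = 0); last exact: val_inj.
    have -> : 'X_0 = l0 + a *: z by rewrite subrK.
    by apply: (nilpotent_modD idI) => //; apply: nZ.
  - rewrite (_ : Ordinal ilt = 1); last exact: val_inj.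
    have -> : 'X_1 = l1 + b *: z by rewrite subrK.
    by apply: (nilpotent_modD idI) => //; apply: nZ.
  - by rewrite (_ : Ordinal ilt = ord_max); last exact: val_inj.
have [N NP] : exists N, forall i : 'I_3, I ('X_i ^+ N).
  have /choice [n nP] := nX; exists (\sum_i n i)%N => i.
  by rewrite (bigD1 i) //= exprD mulrC; apply: idealM.
exists (3 * N)%N => k p kN hp.
have Ip : I p.
  rewrite [p]mpolyE big_seq; apply: (ideal_sum idI) => m mp; apply: IZ.
  have [i Ni] : exists i, (N <= m i)%N.
    apply: contrapT => /forallNP nN.
    have := dhomog_mf hp mp; rewrite /= mdegE => mk.
    have : (\sum_(i < 3) m i < 3 * N)%N.
      have := nN 0; have := nN 1; have := nN ord_max.
      rewrite !big_ord_recl big_ord0.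
      have -> : lift ord0 (lift ord0 ord0) = ord_max :> 'I_3 by apply: val_inj.
      have -> : lift ord0 ord0 = 1 :> 'I_3 by apply: val_inj.
      have -> : ord0 = 0 :> 'I_3 by apply: val_inj.
      lia.
    by rewrite mk; lia.
  rewrite mpolyXE_id (bigD1 i) //= -(subnK Ni) exprD.
  by apply: idealMr => //; apply: idealM.
case/IJ: Ip => q Jq; exists (hcomp (k%:Z - 1) q); first exact: homogz_hcomp.
have := jacobian_hcomp k Jq.
have -> : hcomp k (p - q * l) = p - hcomp (k%:Z - 1) q * l.
  by rewrite hcompB (hcomp_id hp) (hcompM _ _ hl').
by [].
Qed.

End JacobianRing.

(** * Localization of the Jacobian ring at its points *)

Lemma mulr_linear (K : fieldType) n (l : {mpoly K[n]}) : linear (fun a => a * l).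
Proof. by move=> c u v; rewrite mulrDl scalerAl. Qed.

Lemma homogzX1 (K : fieldType) (x : {mpoly K[3]}) (N : nat) :
  homogz 1 x -> homogz N (x ^+ N).
Proof. by move=> hx; have := dhomogMn N (hx : x \is 1.-homog); rewrite mul1n. Qed.

Section Localization.
Variables (K : numClosedFieldType) (d : nat) (f : {mpoly K[3]}).
Local Notation S := {mpoly K[3]}.
Hypotheses (d1 : (1 < d)%N) (redf : reduced_curve d f).
Variables (k0 t : nat).
Hypothesis dimJ : forall k : nat, (k0 <= k)%N -> qdim (homogz k) (jacobian_ideal f) t.
Variables (l : S) (k1 : nat).
Hypothesis hl : homogz 1 l.
Hypothesis lsurj : forall (k : nat) p, (k1 <= k)%N -> homogz k p ->
    exists2 q, homogz (k%:Z - 1) q & jacobian_ideal f (p - q * l).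
Local Notation J := (jacobian_ideal f).
Local Notation kk := (k0 + k1)%N.
Implicit Types (p q : 'rV[K]_3).

Let idJ : is_ideal J := is_ideal_jacobian f.

Lemma mul_l_homog (k : nat) a : homogz k a -> homogz k.+1 (a * l).
Proof. by move=> ha; have := homogzM ha hl; rewrite -PoszD addn1. Qed.

Lemma mul_l_surj (k : nat) h : (kk <= k)%N -> homogz k.+1 h ->
  exists2 a, homogz k a & J (h - a * l).
Proof.
move=> kk_k hh; have [|a ha Ja] := lsurj _ hh.
  by apply: leq_trans (leq_trans (leq_addl _ _) kk_k) (leqnSn _).
by exists a => //; move: ha; rewrite -addn1 PoszD addrK.
Qed.

(** Multiplication by l is onto between spaces of the same dimension t. *)
Lemma mul_l_inj (k : nat) a : (kk <= k)%N -> homogz k a -> J (a * l) -> J a.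
Proof.
move=> kk_k ha Jal; have k0k := leq_trans (leq_addr k1 k0) kk_k.
have sH k' := subspace_homogz K k'; have sJ := subspace_jacobian f.
suff [] : homogz k a /\ J a by [].
apply: (qdim_surj_inj (mulr_linear l) (sH k) (subspaceI (sH k) sJ) (sH k.+1) sJ) ha Jal.
- by move=> b [].
- by move=> b hb; apply: mul_l_homog.
- by move=> b [_ Jb]; apply: idealMr.
- by move=> h hh; apply: mul_l_surj.
- by apply/(qdim_restrict _ _ (sH k)); apply: dimJ.
- by apply: dimJ; apply: leqW.
Qed.

Lemma mul_lX_inj (k N : nat) a : (kk <= k)%N -> homogz k a -> J (a * l ^+ N) -> J a.
Proof.
move=> kk_k ha; elim: N => [|N IHN]; first by rewrite mulr1.
rewrite exprSr mulrA => H; apply: IHN; apply: (mul_l_inj (k := k + N)) H.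
  exact: leq_trans kk_k (leq_addr _ _).
exact: homogzM ha (homogzX1 N hl).
Qed.

Definition zero_jacobian p := forall i, f^`M(i).@[p 0] = 0.

Lemma jacobian_eval p g : zero_jacobian p -> J g -> g.@[p 0] = 0.
Proof.
move=> Vp [v ->]; rewrite raddf_sum big1 // => i _ /=.
by rewrite mevalM Vp mulr0.
Qed.

Lemma l_neq0 p : zero_jacobian p -> p != 0 -> l.@[p 0] != 0.
Proof.
move=> Vp; apply: contraNneq => lp0; apply/eqP/rowP => i; rewrite mxE.
have [|q _] := lsurj (leqnSn k1) (_ : homogz k1.+1 ('X_i ^+ k1.+1)).
  exact/homogzX1/homogz_var.
move/(jacobian_eval Vp); rewrite mevalB mevalM lp0 mulr0 subr0 rmorphXn /= mevalXU.
by move/eqP; rewrite expf_eq0 => /andP[_ /eqP].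
Qed.

(** The contraction to S of the extension of J to the local ring at p. *)
Definition local_ideal p (a : S) := exists (e : nat) b,
  [/\ b \is e.-homog, b.@[p 0] != 0 & J (b * a)].

Lemma is_ideal_local p : is_ideal (local_ideal p).
Proof.
split=> [|a a' [e [b [hb bp Jb]]] [e' [b' [hb' bp' Jb']]]|a a' [e [b [hb bp Jb]]]].
- exists 0%N, 1; rewrite dhomog1 mulr0 meval1 oner_neq0; split=> //; exact: jacobian0.
- exists (e + e')%N, (b * b'); split; first exact: dhomogM.
    by rewrite mevalM mulf_neq0.
  have -> : b * b' * (a + a') = b' * (b * a) + b * (b' * a') by ring.
  by apply: idealD => //; apply: idealM.
- exists e, b; split=> //; have -> : b * (a * a') = a * (b * a') by ring.
  exact: idealM.
Qed.

Lemma subspace_local p : subspace (local_ideal p).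
Proof.
have idL := is_ideal_local p; split=> [|c u v Lu Lv]; first exact: ideal0.
by apply: idealD => //; rewrite -mul_mpolyC; apply: idealM.
Qed.

Lemma jacobian_local p a : J a -> local_ideal p a.
Proof.
move=> Ja; exists 0%N, 1; rewrite dhomog1 mul1r meval1 oner_neq0; split=> //.
Qed.

Lemma local_cancel p (e : nat) g a : g \is e.-homog -> g.@[p 0] != 0 ->
  local_ideal p (a * g) -> local_ideal p a.
Proof.
move=> hg gp [e' [b [hb bp Jb]]]; exists (e' + e)%N, (b * g).
split; [exact: dhomogM|by rewrite mevalM mulf_neq0|].
by have -> : b * g * a = b * (a * g) by ring.
Qed.

(** Multiplication by l identifies the quotients in consecutive degrees; they are
    nonzero because a power of l does not vanish at p, unlike J. *)
Lemma local_dim p : zero_jacobian p -> p != 0 ->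
  exists n : nat, (0 < n)%N /\ forall k : nat, (kk <= k)%N -> qdim (homogz k) (local_ideal p) n.
Proof.
move=> Vp p0; have lp := l_neq0 Vp p0; have idL := is_ideal_local p.
have sH k := subspace_homogz K k; have sL := subspace_local p; have sJ := subspace_jacobian f.
have [n _ dn] := qdim_quotient (sH kk) sJ sL (@jacobian_local p) (dimJ (leq_addr k1 k0)).
have H j : qdim (homogz (kk + j)%N) (local_ideal p) n.
  elim: j => [|j IHj]; first by rewrite addn0.
  rewrite addnS.
  refine ((qdim_iso (mulr_linear l) (sH _) sL (sH _) sL _ _ _ _ _).1 IHj) => [a|a _|a _|h hh].
  - exact: mul_l_homog.
  - exact: (@local_cancel p 1).
  - exact: idealMr.
  - have [a ha Ja] := mul_l_surj (leq_addr _ _) hh.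
    by exists a => //; apply: jacobian_local.
exists n; split; last by move=> k /subnKC <-.
rewrite lt0n; apply/eqP => n0; have := H 0%N; rewrite addn0 n0 => d0.
have [e [b [hb bp Jb]]] : local_ideal p (l ^+ kk).
  apply: (qdim0_sub sL d0).
  exact: homogzX1.
have := jacobian_eval Vp Jb; rewrite mevalM rmorphXn /= => /eqP.
by rewrite mulf_eq0 (negPf bp) expf_eq0 (negPf lp) andbF.
Qed.

(** A form not vanishing at p is invertible in the local ring at p. *)
Lemma local_mul_surj p (e k : nat) g h : zero_jacobian p -> p != 0 ->
  g \is e.-homog -> g.@[p 0] != 0 -> (kk <= k)%N -> homogz (k + e)%N h ->
  exists2 a, homogz k a & local_ideal p (h - a * g).
Proof.
move=> Vp p0 hg gp kk_k hh.
have [n [_ dn]] := local_dim Vp p0.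
have sH k := subspace_homogz K k; have sL := subspace_local p.
apply: (qdim_inj_surj (mulr_linear g) (sH k) sL (sH (k + e)%N) sL _ _ (dn k kk_k)) hh.
- by move=> a ha; apply: (dhomogM (ha : a \is k.-homog) hg).
- by move=> a _; apply: local_cancel hg gp.
- by apply: dn; apply: leq_trans kk_k (leq_addr _ _).
Qed.

Lemma P2_point_neq0 p : P2_point p -> p != 0.
Proof.
by rewrite /P2_point; apply: contra_eq_neq => ->; rewrite mxE eq_sym oner_neq0.
Qed.

Lemma chart_lt p (i : 'I_3) : (i < chart p)%N -> p 0 i = 0.
Proof.
rewrite /chart; case: eqP => [p0|//] /=; case: eqP => [p1|_].
  case: i => [[|[|[|//]]] ilt] // _.
    by rewrite (_ : Ordinal ilt = 0) //; apply: val_inj.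
  by rewrite (_ : Ordinal ilt = 1) //; apply: val_inj.
case: i => [[|//] ilt] _.
by rewrite (_ : Ordinal ilt = 0) //; apply: val_inj.
Qed.

Lemma chart_neq0 p (i : 'I_3) : p 0 i != 0 -> (chart p <= i)%N.
Proof. by rewrite leqNgt; apply: contraNN => /chart_lt ->. Qed.

Lemma P2_point_colinear p q : P2_point p -> P2_point q ->
  (forall i j, p 0 i * q 0 j = p 0 j * q 0 i) -> p = q.
Proof.
move=> pP qP pq.
have cc : chart p = chart q.
  have H (x y : 'rV[K]_3) : P2_point x -> P2_point y ->
      (forall i j, x 0 i * y 0 j = x 0 j * y 0 i) -> (chart y <= chart x)%N.
    move=> xP yP xy; apply: chart_neq0; apply: contraTneq isT => yx.
    have := xy (chart x) (chart y); rewrite xP yP yx mulr0 mulr1 => /eqP.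
    by rewrite oner_eq0.
  apply/val_inj/anti_leq; rewrite !H // => i j; by rewrite mulrC [RHS]mulrC pq.
apply/rowP => i; have := pq i (chart p); rewrite pP mul1r cc.
by rewrite (qP : q 0 (chart q) = 1) mulr1.
Qed.

(** Take a line lam through p that avoids q. A product of combinations of lam and l
    lies in J; those different from lam do not vanish at p, so that a power of
    lam lies in the local ideal at p. *)
Lemma separate_points p q : zero_jacobian p -> P2_point p -> P2_point q -> p != q ->
  exists (e : nat) h, [/\ h \is e.-homog, local_ideal p h & h.@[q 0] != 0].
Proof.
move=> Vp pP qP pq.
have [i [j ij]] : exists i j, p 0 i * q 0 j != p 0 j * q 0 i.
  apply: contrapT => /forallNP H; case/eqP: pq; apply: P2_point_colinear => // i j.
  by apply/eqP; have /forallNP/(_ j)/negP := H i; rewrite negbK.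
pose lam : S := p 0 i *: 'X_j - p 0 j *: 'X_i.
have hlam : homogz 1 lam.
  by apply: homogzD; [|apply: homogzN]; apply: homogzZ; apply: homogz_var.
have lamE x : lam.@[x 0] = p 0 i * x 0 j - p 0 j * x 0 i.
  by rewrite mevalB !mevalZ !mevalXU.
have [M [rs Jrs]] := binary_form d1 dimJ hlam hl.
suff H g s (e : nat) : g \is e.-homog -> g.@[p 0] != 0 ->
    J (g * lam ^+ s * \prod_(r <- rs) (lam - r *: l)) -> exists s', local_ideal p (lam ^+ s').
  have [||s' Ls'] := H (l ^+ M) 0%N (1 * M)%N (dhomogMn M hl).
  - by rewrite rmorphXn expf_neq0 // l_neq0 // P2_point_neq0.
  - by rewrite mulr1.
  exists (1 * s')%N, (lam ^+ s'); split=> //; first exact: dhomogMn.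
  by rewrite rmorphXn /= expf_neq0 // lamE subr_eq0.
elim: rs g s e {Jrs} => [|r rs IHrs] g s e hg gp.
  by rewrite big_nil mulr1 => Jg; exists s, e, g.
rewrite big_cons; have [->|r0] := eqVneq r 0.
  rewrite scale0r subr0 mulrA -[g * _ * lam]mulrA -exprSr; exact: IHrs hg gp.
have -> : g * lam ^+ s * ((lam - r *: l) * \prod_(j <- rs) (lam - j *: l)) =
    g * (lam - r *: l) * lam ^+ s * \prod_(j <- rs) (lam - j *: l) by ring.
apply: (IHrs _ _ (e + 1)%N).
  by apply: dhomogM hg _; apply: (homogzD hlam); apply/homogzN/homogzZ.
rewrite mevalM mulf_neq0 // mevalB mevalZ lamE mulrC subrr sub0r oppr_eq0.
by rewrite mulf_neq0 // l_neq0 // P2_point_neq0.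
Qed.

Section Nullstellensatz.
Variable I : S -> Prop.
Hypotheses (idI : is_ideal I) (JI : forall a, J a -> I a).

(** If every value r were excluded, the product of the powers of l obtained for the
    roots of a binary form in x and l would lie in P. *)
Lemma proper_root (x : S) (P : S -> Prop) : homogz 1 x -> is_ideal P ->
  (forall a, J a -> P a) -> (forall N, ~ P (l ^+ N)) ->
  exists r, forall N, ~ adjoin P (x - r *: l) (l ^+ N).
Proof.
move=> hx idP JP nP; have [M [rs Jrs]] := binary_form d1 dimJ hx hl.
apply: contrapT => /forallNP H.
have {}H r : exists N, adjoin P (x - r *: l) (l ^+ N).
  by have /existsNP [N /contrapT HN] := H r; exists N.
suff [N [c Nc]] : exists N c, P (l ^+ N - c * \prod_(r <- rs) (x - r *: l)).
  apply: (nP (M + N)%N); rewrite exprD.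
  rewrite -[l ^+ N](subrK (c * \prod_(r <- rs) (x - r *: l))) mulrDr.
  apply: (idealD idP); first exact: idealM.
  by rewrite mulrCA; apply: (idealM idP); apply: JP.
elim: rs {Jrs} => [|r rs [N [c Nc]]].
  exists 0%N, 1; rewrite big_nil mulr1 subrr; exact: ideal0.
have [N' [c' N'c']] := H r.
exists (N + N')%N, (c * c'); rewrite big_cons exprD.
have -> : c * c' * ((x - r *: l) * \prod_(j <- rs) (x - j *: l)) =
   (c * \prod_(j <- rs) (x - j *: l)) * (c' * (x - r *: l)) by ring.
exact: ideal_congrM.
Qed.

(** Splitting the binary forms in a coordinate and l, one can keep adjoining
    linear relations without ever reaching a power of l; the relations found
    are the coordinates of a zero. *)
Lemma nullstellensatz : (forall N, ~ I (l ^+ N)) -> exists q : 'rV[K]_3,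
  l.@[q 0] = 1 /\ forall (e : nat) g, g \is e.-homog -> I g -> g.@[q 0] = 0.
Proof.
move=> nI.
(* The coordinates of q are the values found for the three variables in turn. *)
have [a na] := proper_root (homogz_var K 0) idI JI nI.
set I0 := adjoin I _ in na; have idI0 : is_ideal I0 := is_ideal_adjoin idI _.
have II0 b : I b -> I0 b := adjoin_sub _ (p := b).
have [b nb] := proper_root (homogz_var K 1) idI0 (fun _ H => II0 _ (JI H)) na.
set I1 := adjoin I0 _ in nb; have idI1 : is_ideal I1 := is_ideal_adjoin idI0 _.
have I01 x : I0 x -> I1 x := adjoin_sub _ (p := x).
have [c nc] := proper_root (homogz_var K ord_max) idI1 (fun _ H => I01 _ (II0 _ (JI H))) nb.
set I2 := adjoin I1 _ in nc; have idI2 : is_ideal I2 := is_ideal_adjoin idI1 _.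
have I12 x : I1 x -> I2 x := adjoin_sub _ (p := x).
pose q := point3 a b c.
have Iq i : I2 ('X_i - q 0 i *: l).
  case: i => [[|[|[|//]]] ilt]; rewrite mxE /=.
  - rewrite (_ : Ordinal ilt = 0); last exact: val_inj.
    by apply/I12/I01; apply: adjoin_gen.
  - rewrite (_ : Ordinal ilt = 1); last exact: val_inj.
    by apply/I12; apply: adjoin_gen.
  - by rewrite (_ : Ordinal ilt = ord_max); [apply: adjoin_gen|exact: val_inj].
have key (e : nat) g : g \is e.-homog -> I2 g -> g.@[q 0] = 0.
  move=> hg Ig; apply/eqP; apply: contra_notT (nc e) => gq.
  have := ideal_subst idI2 Iq hg => H.
  have := (idealB idI2 Ig H); rewrite subKr => /(idealM idI2 (g.@[q 0])^-1%:MP).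
  by rewrite mul_mpolyC scalerA mulVf // scale1r.
exists q; split; last by move=> e g hg Ig; apply: key hg _; apply/I12/I01/II0.
apply/eqP; rewrite -subr_eq0; apply: contraT => lq.
have := ideal_subst idI2 Iq (hl : l \is 1.-homog); rewrite expr1.
rewrite -{1}[l]scale1r -scalerBl => /(idealM idI2 (1 - l.@[q 0])^-1%:MP).
rewrite mul_mpolyC scalerA mulVf ?scale1r => [Il|]; first by case: (nc 1%N).
by rewrite -opprB oppr_eq0.
Qed.

End Nullstellensatz.

Lemma meval_scale (e : nat) g (c : K) (v : 'I_3 -> K) : g \is e.-homog ->
  g.@[fun i => c * v i] = c ^+ e * g.@[v].
Proof.
move=> /dhomogP hg; rewrite !mevalE mulr_sumr big_seq [RHS]big_seq.
apply: eq_bigr => m /hg mE; rewrite mulrCA -mE /= mdegE expr_sum -big_split /=.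
by congr (_ * _); apply: eq_bigr => i _; rewrite exprMn.
Qed.

(** Apply the Nullstellensatz to the annihilator of a modulo J: a zero of it would
    be a singular point at which a is not locally in J, and if it contains a
    power of l then a lies in J, as multiplication by l is injective. *)
Lemma jacobian_of_local (k : nat) a : (kk <= k)%N -> homogz k a ->
  (forall p, P2_point p -> zero_jacobian p -> local_ideal p a) -> J a.
Proof.
move=> kk_k ha La; have [_ hf _] := redf.
pose I b := J (b * a).
have idI : is_ideal I.
  split=> [|b c Ib Ic|b c Ic]; rewrite /I.
  - by rewrite mul0r; apply: jacobian0.
  - by rewrite mulrDl; apply: jacobianD.
  - by rewrite -mulrA; apply: jacobianM.
have JI b : J b -> I b by move=> Jb; rewrite /I mulrC; apply: jacobianM.
have [[N IN]|/forallNP nI] := pselect (exists N, I (l ^+ N)).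
  by apply: (@mul_lX_inj k N) => //; rewrite mulrC.
exfalso; have [q [lq qI]] := nullstellensatz idI JI nI.
have Vq : zero_jacobian q.
  move=> i; apply: (qI d.-1).
    by have := homog_deriv i hf; rewrite (_ : d%:Z - 1 = d.-1) //; lia.
  by apply/JI/jacobian_deriv.
have hl1 := hl : l \is 1.-homog.
have q0 : exists i, q 0 i != 0.
  apply: contrapT => /forallNP q0.
  have : l.@[q 0] = 0.
    have <- : l.@[fun i => 0 * q 0 i] = 0 by rewrite (meval_scale _ _ hl1) expr1 mul0r.
    by apply: meval_eq => i; rewrite mul0r; apply: contrapT => qi; apply: (q0 i); apply/eqP.
  by rewrite lq => /eqP; rewrite oner_eq0.
pose c := q 0 (chart q).
have c0 : c != 0.
  rewrite /c /chart; case: ifP => // /negbFE/eqP h0; case: ifP => // /negbFE/eqP h1.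
  case: q0 => -[[|[|[|//]]] ilt].
  - by rewrite (_ : Ordinal ilt = 0) ?h0 ?eqxx //; apply: val_inj.
  - by rewrite (_ : Ordinal ilt = 1) ?h1 ?eqxx //; apply: val_inj.
  - by rewrite (_ : Ordinal ilt = ord_max) //; apply: val_inj.
pose p := c^-1 *: q.
have pE i : p 0 i = c^-1 * q 0 i by rewrite mxE.
have cpq : chart p = chart q.
  by rewrite /chart !pE !mulf_eq0 invr_eq0 (negPf c0).
have evp (e : nat) g : g \is e.-homog -> g.@[p 0] = c^-1 ^+ e * g.@[q 0].
  by move=> hg; rewrite -(meval_scale _ _ hg); apply: meval_eq.
have [||e [b [hb bp Jb]]] := La p.
- by rewrite /P2_point cpq pE mulVf.
- move=> i; have hi : f^`M(i) \is d.-1.-homog.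
    by have := homog_deriv i hf; rewrite (_ : d%:Z - 1 = d.-1) //; lia.
  by rewrite (evp _ _ hi) Vq mulr0.
by case/eqP: bp; rewrite (evp _ _ hb) (qI e b hb Jb) mulr0.
Qed.

(** Chinese remainder theorem: points are separated by forms that lie in the
    local ideal of one of them and are invertible at the other. *)
Lemma local_chinese (s : seq 'rV[K]_3) (n : 'rV[K]_3 -> nat) : uniq s ->
  (forall p, p \in s -> P2_point p /\ zero_jacobian p) ->
  (forall p, p \in s -> forall k : nat, (kk <= k)%N -> qdim (homogz k) (local_ideal p) (n p)) ->
  exists k2, forall k : nat, (k2 <= k)%N ->
    qdim (homogz k) (fun a => forall p, p \in s -> local_ideal p a) (\sum_(p <- s) n p)%N.
Proof.
have sH k := subspace_homogz K k.
have sI (s' : seq 'rV[K]_3) : subspace (fun a : S => forall p, p \in s' -> local_ideal p a).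
  split=> [p _|c u v Lu Lv p ps]; first exact: sub0 (subspace_local p).
  by apply: (subspace_local p).2; [apply: Lu|apply: Lv].
elim: s => [|p s IHs] /=.
  move=> _ _ _; exists 0%N => k _; rewrite big_nil.
  by apply: qdim0 => // v _ p; rewrite in_nil.
move=> /andP[ps us] Vs dn.
have [pP Vp] : P2_point p /\ zero_jacobian p by apply: Vs; rewrite mem_head.
have [q qs|q qs|k2 H2] := IHs us; [by apply: Vs; rewrite inE qs orbT| |].
  by apply: dn; rewrite inE qs orbT.
(* Multiples of h vanish locally at the points of s and fill the quotient at p. *)
have [e [h [hh Lh hp]]] : exists (e : nat) h, [/\ h \is e.-homog,
    forall q, q \in s -> local_ideal q h & h.@[p 0] != 0].
  have {dn} : forall q, q \in s -> [/\ P2_point q, zero_jacobian q & q != p].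
    move=> q qs; have [qP Vq] : P2_point q /\ zero_jacobian q by apply: Vs; rewrite inE qs orbT.
    by split=> //; apply: contraNneq ps => <-.
  elim: (s) => [|q s' IHs'] Hs'.
    by exists 0%N, 1; split; rewrite ?dhomog1 ?meval1 ?oner_eq0.
  have [r rs'|e [h [hh Lh hp]]] := IHs'; first by apply: Hs'; rewrite inE rs' orbT.
  have [qP Vq qp] := Hs' q (mem_head _ _).
  have [e' [h' [hh' Lh' hp']]] := separate_points Vq qP pP qp.
  exists (e + e')%N, (h * h'); split; first exact: dhomogM.
    move=> r; rewrite inE => /orP[/eqP ->|rs'].
      exact: (idealM (is_ideal_local q)).
    by apply: (idealMr (is_ideal_local r)); apply: Lh.
  by rewrite mevalM mulf_neq0.
exists (k2 + kk + e)%N => k kge.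
have p0 := P2_point_neq0 pP; have sL := subspace_local p.
rewrite big_cons addnC.
have sHs : subspace (fun a => homogz k a /\ forall q, q \in s -> local_ideal q a).
  exact: subspaceI.
have sHps : subspace (fun a => homogz k a /\ forall q, q \in p :: s -> local_ideal q a).
  exact: subspaceI.
apply/(qdim_restrict _ _ (sH k)).
apply: (qdim_add (sH k) sHs sHps).
- by move=> a [ha La]; split=> // q qs; apply: La; rewrite inE qs orbT.
- by move=> a [].
- by apply/(qdim_restrict _ _ (sH k)); apply: H2; lia.
have kkk : (kk <= k)%N by lia.
refine ((@qdim_iso _ _ _ id _ _ _ _ _ sHs sHps (sH k) sL _ _ _ _ _).2 (dn p (mem_head _ _) k kkk)) => //.
- by move=> a [].
- move=> a [ha La] Lpa; split=> // q; rewrite inE => /orP[/eqP -> //|]; exact: La.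
- by move=> a _ [_]; apply; rewrite mem_head.
- move=> x hx; have ke : k = (k - e + e)%N by rewrite subnK //; lia.
  have [||a ha Lxa] := local_mul_surj (e := e) (k := (k - e)%N) (g := h) (h := x) Vp p0 hh hp.
  + by lia.
  + by rewrite -ke.
  exists (a * h) => //; split.
    by rewrite ke; apply: (dhomogM (ha : a \is (k - e).-homog) hh).
  by move=> q qs; apply: (idealM (is_ideal_local q)); apply: Lh.
Qed.

Lemma singular_zero p : singular_point f p <-> P2_point p /\ zero_jacobian p.
Proof.
split=> [[pP _ Vp]|[pP Vp]] //; split=> //.
have [_ hf _] := redf; apply: (jacobian_eval Vp).
exact: jacobian_self (ltnW d1) hf.
Qed.

(** The singular points are finite in number because each of them contributes
    to the dimension of the Jacobian ring in high degree. *)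
Theorem jacobian_decomposition : exists (s : seq 'rV[K]_3) (n : 'rV[K]_3 -> nat),
  [/\ uniq s, forall p, p \in s <-> singular_point f p,
      forall p, p \in s -> forall k : nat, (kk <= k)%N -> qdim (homogz k) (local_ideal p) (n p)
    & t = (\sum_(p <- s) n p)%N].
Proof.
have /choice [n nP] : forall p, exists m : nat, singular_point f p ->
    (0 < m)%N /\ forall k : nat, (kk <= k)%N -> qdim (homogz k) (local_ideal p) m.
  move=> p; have [/singular_zero [pP Vp]|np] := pselect (singular_point f p); last by exists 0%N.
  by have [m mP] := local_dim Vp (P2_point_neq0 pP); exists m.
have sH k := subspace_homogz K k; have sJ := subspace_jacobian f.
have bound s : uniq s -> (forall p, p \in s -> singular_point f p) ->
    exists k2, forall k : nat, (k2 <= k)%N ->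
    qdim (homogz k) (fun a => forall p, p \in s -> local_ideal p a) (\sum_(p <- s) n p)%N.
  move=> us sP; apply: local_chinese => // p ps; first exact/singular_zero/sP.
  by have [_ H] := nP p (sP p ps).
have sI (s : seq 'rV[K]_3) : subspace (fun a : S => forall p, p \in s -> local_ideal p a).
  split=> [p _|c u v Lu Lv p ps]; first exact: sub0 (subspace_local p).
  by apply: (subspace_local p).2; [apply: Lu|apply: Lv].
have size_le s : uniq s -> (forall p, p \in s -> singular_point f p) -> (size s <= t)%N.
  move=> us sP; have [k2 H2] := bound s us sP.
  have [m mt dm] := qdim_quotient (sH (k0 + k2)%N) sJ (sI s)
    (fun a Ja p _ => jacobian_local p Ja) (dimJ (leq_addr k2 k0)).
  apply: leq_trans mt; rewrite -(qdim_uniq (sH _) (sI s) (H2 _ (leq_addl k0 k2)) dm).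
  rewrite -sum1_size big_seq [X in (_ <= X)%N]big_seq.
  by apply: leq_sum => p /sP /nP [].
have [s [us sP smax]] : exists s, [/\ uniq s, forall p, p \in s -> singular_point f p &
    forall p, singular_point f p -> p \in s].
  apply: contrapT => nex.
  have H m : exists s, [/\ uniq s, forall p, p \in s -> singular_point f p & size s = m].
    elim: m => [|m [s [us sP sm]]]; first by exists [::].
    have [p [Pp ps]] : exists p, singular_point f p /\ p \notin s.
      apply: contrapT => /forallNP np; apply: nex; exists s; split=> // p Pp.
      by apply: contrapT => ps; apply: (np p); split=> //; apply/negP.
    exists (p :: s); split=> /=; rewrite ?ps ?sm // => q.
    by rewrite inE => /orP[/eqP ->|/sP].
  by have [s [us sP st]] := H t.+1; have := size_le s us sP; rewrite st ltnn.
exists s, n; split=> //; first by move=> p; split=> [/sP|/smax].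
  by move=> p /sP /nP [].
have [k2 H2] := bound s us sP.
have kge : (k2 <= k0 + k1 + k2)%N by apply: leq_addl.
apply: (qdim_uniq (sH (kk + k2)%N) sJ _ _); first by apply: dimJ; lia.
apply/(qdim_restrict _ _ (sH _)); have /(qdim_restrict _ _ (sH _)) := H2 _ kge.
apply: qdim_equiv => // a; split=> -[ha La]; split=> //.
  apply: (jacobian_of_local (k := kk + k2)) => //; first exact: leq_addr.
  by move=> p pP Vp; apply/La/smax/singular_zero.
by move=> p _; apply: jacobian_local.
Qed.

End Localization.

(** * Tjurina numbers *)

(** An alias of the function field, which gets the structure of a vector space over
    the field of constants. *)
Definition fracK (K : fieldType) n : Type := {fraction {mpoly K[n]}}.

Section FractionSpace.
Variables (K : fieldType) (n : nat).

HB.instance Definition _ := GRing.Zmodule.on (fracK K n).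

Definition fracK_scale (c : K) (v : fracK K n) : fracK K n := tofrac c%:MP * v.

Fact fracK_scaleA a b v : fracK_scale a (fracK_scale b v) = fracK_scale (a * b) v.
Proof. by rewrite /fracK_scale mulrA -rmorphM mpolyCM. Qed.
Fact fracK_scale1 : left_id 1 fracK_scale.
Proof. by move=> v; rewrite /fracK_scale mpolyC1 rmorph1 mul1r. Qed.
Fact fracK_scaleDr : right_distributive fracK_scale +%R.
Proof. by move=> a u v; rewrite /fracK_scale mulrDr. Qed.
Fact fracK_scaleDl v : {morph fracK_scale^~ v : a b / a + b}.
Proof. by move=> a b; rewrite /fracK_scale mpolyCD rmorphD mulrDl. Qed.

HB.instance Definition _ := GRing.Zmodule_isLmodule.Build K (fracK K n)
  fracK_scaleA fracK_scale1 fracK_scaleDr fracK_scaleDl.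

End FractionSpace.

Section FractionArithmetic.
Variable R : idomainType.
Implicit Types a b c : R.

Lemma tofrac_inj : injective (@tofrac R).
Proof. by move=> x y xy; apply/eqP; rewrite -tofrac_eq xy eqxx. Qed.

Lemma frac_add a b a' b' : b != 0 -> b' != 0 ->
  tofrac a / tofrac b + tofrac a' / tofrac b' = tofrac (a * b' + a' * b) / tofrac (b * b').
Proof. by move=> b0 b'0; rewrite tofracD !tofracM addf_div ?tofrac_eq0. Qed.

Lemma frac_mul a b a' b' :
  (tofrac a / tofrac b) * (tofrac a' / tofrac b') = tofrac (a * a') / tofrac (b * b').
Proof. by rewrite !tofracM mulf_div. Qed.

Lemma frac_clear a b c : b != 0 -> tofrac (b * c) * (tofrac a / tofrac b) = tofrac (a * c).
Proof.
move=> b0; have fb : tofrac b != 0 by rewrite tofrac_eq0.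
by rewrite !tofracM mulrC -mulrA mulKf.
Qed.

End FractionArithmetic.

Section LocalRing.
Variables (K : fieldType) (n : nat) (q : 'rV[K]_n).
Local Notation P := {mpoly K[n]}.
Local Notation F := {fraction P}.

Lemma eval_neq0 (b : P) : b.@[q 0] != 0 -> b != 0.
Proof. by apply: contraNneq => ->; rewrite meval0. Qed.

Lemma local_ring_tofrac (a : P) : local_ring q (tofrac a).
Proof. by exists a, 1; rewrite meval1 oner_neq0 rmorph1 divr1. Qed.

Lemma local_ringD (x y : F) : local_ring q x -> local_ring q y -> local_ring q (x + y).
Proof.
move=> [a [b [b0 ->]]] [a' [b' [b'0 ->]]].
exists (a * b' + a' * b), (b * b'); rewrite mevalM mulf_neq0 //; split=> //.
by apply: frac_add; apply: eval_neq0.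
Qed.

Lemma local_ringM (x y : F) : local_ring q x -> local_ring q y -> local_ring q (x * y).
Proof.
move=> [a [b [b0 ->]]] [a' [b' [b'0 ->]]].
exists (a * a'), (b * b'); rewrite mevalM mulf_neq0 //; split=> //.
exact: frac_mul.
Qed.

Lemma local_ringN (x : F) : local_ring q x -> local_ring q (- x).
Proof. by rewrite -mulN1r -(rmorphN1 (@tofrac P)); apply/local_ringM/local_ring_tofrac. Qed.

Lemma local_ringV (b : P) : b.@[q 0] != 0 -> local_ring q (tofrac b)^-1.
Proof. by move=> b0; exists 1, b; rewrite rmorph1 mul1r. Qed.

Lemma local_denominators m (x : 'I_m -> F) : (forall k, local_ring q (x k)) ->
  exists2 c : P, c.@[q 0] != 0 & exists y : 'I_m -> P, forall k, tofrac c * x k = tofrac (y k).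
Proof.
move=> /choice [a aP]; have /choice [b bP] := aP.
exists (\prod_k b k); first by rewrite rmorph_prod; apply/prodf_neq0 => k _; case: (bP k).
exists (fun k => a k * \prod_(l | l != k) b l) => k; have [b0 ->] := bP k.
by rewrite (bigD1 k) //=; apply/frac_clear/eval_neq0.
Qed.

Lemma subspace_local_ring : subspace (local_ring q : fracK K n -> Prop).
Proof.
split=> [|c x y Lx Ly]; first by rewrite -[0](rmorph0 (@tofrac P)); apply: local_ring_tofrac.
by apply: local_ringD => //; apply: local_ringM => //; apply: local_ring_tofrac.
Qed.

End LocalRing.

Section Chart.
Variables (K : fieldType) (i : 'I_3).
Local Notation S := {mpoly K[3]}.
Local Notation P := {mpoly K[2]}.
Local Notation deh := (@dehomogenize K i).

Definition chart_mon (m : 'X_{1..3}) : 'X_{1..2} := [multinom m (lift i j) | j < 2].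

(** The missing exponent makes the total degree equal to N. *)
Definition homog_mon (N : nat) (m : 'X_{1..2}) : 'X_{1..3} :=
  [multinom if unlift i k is Some j then m j else (N - mdeg m)%N | k < 3].

Fact dehomogenize_additive : additive deh.
Proof. by move=> a b; rewrite /dehomogenize rmorphB. Qed.

Fact dehomogenize_multiplicative : multiplicative deh.
Proof. by split=> [a b|]; rewrite /dehomogenize ?rmorphM ?rmorph1. Qed.

HB.instance Definition _ := GRing.isAdditive.Build S P deh dehomogenize_additive.
HB.instance Definition _ := GRing.isMultiplicative.Build S P deh dehomogenize_multiplicative.

Lemma dehomogenizeX (m : 'X_{1..3}) : deh 'X_[m] = 'X_[chart_mon m].
Proof.
rewrite /dehomogenize comp_mpolyX (bigD1_ord i) //= tnth_mktuple unlift_none expr1n mul1r.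
rewrite mpolyXE_id; apply: eq_bigr => j _.
by rewrite tnth_mktuple liftK mnmE.
Qed.

Lemma dehomogenizeZ c a : deh (c *: a) = c *: deh a.
Proof. exact: comp_mpolyZ. Qed.

Lemma homog_monK N m : chart_mon (homog_mon N m) = m.
Proof. by apply/mnmP => j; rewrite !mnmE liftK. Qed.

Lemma mdeg_chart m : mdeg m = (m i + mdeg (chart_mon m))%N.
Proof. by rewrite !mdegE (bigD1_ord i) //=; congr addn; apply: eq_bigr => j _; rewrite mnmE. Qed.

Lemma mdeg_homog_mon N m : (mdeg m <= N)%N -> mdeg (homog_mon N m) = N.
Proof. by move=> mN; rewrite mdeg_chart homog_monK mnmE unlift_none subnK. Qed.

Definition homogenize (N : nat) (a : P) : S := \sum_(m <- msupp a) a@_m *: 'X_[homog_mon N m].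

Lemma homogenizeK N : cancel (homogenize N) deh.
Proof.
move=> a; rewrite /homogenize (raddf_sum deh) [RHS]mpolyE; apply: eq_bigr => m _ /=.
by rewrite dehomogenizeZ dehomogenizeX homog_monK.
Qed.

Lemma homog_homogenize N a : (msize a <= N.+1)%N -> homogenize N a \is N.-homog.
Proof.
move=> aN; rewrite /homogenize big_seq; apply: rpred_sum => m ma.
rewrite rpredZ // dhomogX /= mdeg_homog_mon //.
by rewrite -ltnS; apply: leq_trans aN; apply: msize_mdeg_lt.
Qed.

(** The total degree determines the exponent that is forgotten. *)
Lemma dehomogenize_inj (N : nat) (a : S) : a \is N.-homog -> deh a = 0 -> a = 0.
Proof.
move=> /dhomogP ha /(congr1 (fun b => fun m => b@_m)) E; apply/mpolyP => m; rewrite mcoeff0.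
have [ma|/memN_msupp_eq0//] := boolP (m \in msupp a).
have := congr1 (fun F => F (chart_mon m)) E; rewrite mcoeff0 => <-.
rewrite {2}[a]mpolyE (raddf_sum deh) raddf_sum /= (bigD1_seq m) ?msupp_uniq //=.
rewrite dehomogenizeZ dehomogenizeX mcoeffZ mcoeffX eqxx mulr1 big1_seq ?addr0 // => l /andP[lm la].
rewrite dehomogenizeZ dehomogenizeX mcoeffZ mcoeffX; case: eqP => [lE|]; last by rewrite mulr0.
case/eqP: lm; apply/mnmP => k.
have := ha _ la; rewrite -(ha _ ma) /= !mdeg_chart lE => /addIn li.
case: (unliftP i k) => [j|] -> //.
by have /mnmP/(_ j) := lE; rewrite !mnmE.
Qed.

Lemma dehomogenize_eval (p : 'rV[K]_3) a : p 0 i = 1 ->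
  (deh a).@[affine_coord i p 0] = a.@[p 0].
Proof.
move=> pi1; rewrite /dehomogenize comp_mpoly_meval; apply: meval_eq => k.
rewrite tnth_mktuple; case: (unliftP i k) => [j|] ->; last by rewrite meval1 pi1.
by rewrite mevalXU mxE.
Qed.

Lemma dehomogenize_deriv a j : deh a^`M(lift i j) = (deh a)^`M(j).
Proof.
rewrite {1}[a]mpolyE [in RHS](mpolyE a) (raddf_sum (mderiv (lift i j))) !(raddf_sum deh).
rewrite (raddf_sum (mderiv j)) /=; apply: eq_bigr => m _.
rewrite mderivZ !dehomogenizeZ mderivZ dehomogenizeX !mderivX.
rewrite !dehomogenizeZ dehomogenizeX mnmE; congr (_ *: (_ *: 'X_[_])).
by apply/mnmP => k; rewrite !mnmE (inj_eq (@lift_inj _ i)).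
Qed.

Lemma dehomogenize_var k : deh 'X_k = if unlift i k is Some j then 'X_j else 1.
Proof. by rewrite /dehomogenize comp_mpolyXU -tnth_nth tnth_mktuple. Qed.

End Chart.

Section LocalAlgebra.
Variables (R : idomainType) (L : {fraction R} -> Prop).
Hypotheses (LD : forall x y, L x -> L y -> L (x + y)) (LM : forall x y, L x -> L y -> L (x * y)).
Hypotheses (LN : forall x, L x -> L (- x)) (Lfrac : forall a, L (tofrac a)).

(** Two ideals coincide if g is replaced by a unit multiple of g corrected by the
    other generators. The computation takes place over an arbitrary domain,
    where the operations on fractions are those of an abstract field. *)
Lemma local_combination n (D E g : R) (x y : 'I_n -> R) h : E * D = 1 ->
  (exists u w, [/\ L u, forall k, L (w k)
     & h = u * tofrac g + \sum_k w k * tofrac (y k)])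
  <-> exists u w, [/\ L u, forall k, L (w k)
     & h = u * tofrac (D * g - \sum_k x k * y k) + \sum_k w k * tofrac (y k)].
Proof.
move=> ED; split=> -[u [w [Lu Lw ->]]].
  exists (u * tofrac E), (fun k => w k + u * tofrac (E * x k)); split=> [|k|].
  - exact: LM.
  - by apply: LD => //; apply: LM.
  rewrite -mulrA -tofracM mulrBr mulrA ED mul1r tofracB mulrBr -addrA; congr (_ + _).
  rewrite tofracM rmorph_sum !mulr_sumr -sumrN -big_split; apply: eq_bigr => k _ /=.
  by rewrite mulrDl !tofracM; ring.
exists (u * tofrac D), (fun k => w k - u * tofrac (x k)); split=> [|k|].
- exact: LM.
- by apply: LD => //; apply: LN; apply: LM.
rewrite tofracB tofracM mulrBr mulrA -addrA; congr (_ + _).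
rewrite rmorph_sum mulr_sumr -sumrN -big_split; apply: eq_bigr => k _ /=.
by rewrite mulrBl !tofracM; ring.
Qed.

Lemma frac_combination n (B A : R) (V Y : 'I_n -> R) : B != 0 ->
  B * A = \sum_k V k * Y k -> tofrac A = \sum_k (tofrac (V k) / tofrac B) * tofrac (Y k).
Proof.
move=> B0 E; have fB : tofrac B != 0 by rewrite tofrac_eq0.
apply: (mulfI fB); rewrite -tofracM E rmorph_sum mulr_sumr; apply: eq_bigr => k _ /=.
by rewrite tofracM mulrA [tofrac B * _]mulrC divfK.
Qed.

Lemma combination_frac n (c A : R) (y Y : 'I_n -> R) (w : 'I_n -> {fraction R}) :
  (forall k, tofrac c * w k = tofrac (y k)) -> tofrac A = \sum_k w k * tofrac (Y k) ->
  c * A = \sum_k y k * Y k.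
Proof.
move=> wy E; apply: tofrac_inj; rewrite tofracM E mulr_sumr rmorph_sum.
by apply: eq_bigr => k _ /=; rewrite mulrA wy tofracM.
Qed.

Lemma frac_sub (a b c : R) : b != 0 ->
  tofrac a / tofrac b - tofrac c = (tofrac b)^-1 * tofrac (a - c * b).
Proof. by move=> b0; rewrite tofracB tofracM mulrBr (mulrC (_^-1)) (mulrC (tofrac c)) mulKf ?tofrac_eq0. Qed.

End LocalAlgebra.

Section TjurinaIdeal.
Variables (K : numClosedFieldType) (d : nat) (f : {mpoly K[3]}) (i : 'I_3) (q : 'rV[K]_2).
Hypotheses (d0 : (0 < d)%N) (hf : f \is d.-homog).
Local Notation P := {mpoly K[2]}.
Local Notation F := {fraction P}.
Local Notation deh := (@dehomogenize K i).
Local Notation T := (tjurina_ideal (deh f) q).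

Lemma dehomogenize_euler :
  deh f^`M(i) = d%:R *: deh f - \sum_j 'X_j * (deh f)^`M(j).
Proof.
have dehM a b : deh (a * b) = deh a * deh b by exact: (rmorphM deh).
apply/eqP; rewrite eq_sym subr_eq; apply/eqP.
rewrite -dehomogenizeZ -(euler_identity hf) (raddf_sum deh) (bigD1_ord i) //=.
rewrite dehM dehomogenize_var unlift_none mul1r; congr (_ + _).
by apply: eq_bigr => j _; rewrite dehM dehomogenize_var liftK dehomogenize_deriv.
Qed.

(** By Euler's identity the partial derivative in the direction of the chart
    coordinate is, up to the other derivatives, a nonzero multiple of the
    equation; so the Tjurina ideal is the extension of J. *)
Lemma tjurina_idealE (h : F) : T h <-> exists2 w : 'I_3 -> F,
  forall k, local_ring q (w k) & h = \sum_k w k * tofrac (deh f^`M(k)).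
Proof.
have ED : d%:R^-1%:MP * d%:R%:MP = 1 :> P.
  by rewrite -mpolyCM mulVf ?mpolyC1 // pnatr_eq0 -lt0n.
have := @local_combination P (local_ring q) _ _ _ _ 2 d%:R%:MP d%:R^-1%:MP (deh f)
  (fun j => 'X_j) (fun j => (deh f)^`M(j)) h ED.
move=> /(_ (@local_ringD _ _ q) (@local_ringM _ _ q) (@local_ringN _ _ q) (@local_ring_tofrac _ _ q)).
rewrite mul_mpolyC -dehomogenize_euler // => E; apply: (iff_trans E) => {E}.
have sumE (w : 'I_3 -> F) : \sum_k w k * tofrac (deh f^`M(k)) =
    w i * tofrac (deh f^`M(i)) + \sum_j w (lift i j) * tofrac (deh f)^`M(j).
  by rewrite (bigD1_ord i) //; congr (_ + _); apply: eq_bigr => j _; rewrite dehomogenize_deriv.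
split=> [[u [w [Lu Lw ->]]]|[w Lw ->]].
  exists (fun k => if unlift i k is Some j then w j else u).
    by move=> k; case: unliftP.
  by rewrite sumE unlift_none; congr (_ + _); apply: eq_bigr => j _; rewrite liftK.
by exists (w i), (fun j => w (lift i j)); split.
Qed.

Lemma tjurina_idealM (x h : F) : local_ring q x -> T h -> T (x * h).
Proof.
move=> Lx /tjurina_idealE[w Lw ->]; apply/tjurina_idealE.
exists (fun k => x * w k); first by move=> k; apply: local_ringM.
by rewrite mulr_sumr; apply: eq_bigr => k _; rewrite mulrA.
Qed.

Lemma subspace_tjurina : subspace (T : fracK K 2 -> Prop).
Proof.
split=> [|c x y Tx Ty].
  apply/tjurina_idealE; exists (fun _ => tofrac 0); first by move=> k; apply: local_ring_tofrac.
  by rewrite big1 // => k _; rewrite tofrac0 mul0r.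
have /tjurina_idealE[w Lw wE] := tjurina_idealM (local_ring_tofrac q c%:MP) Tx.
have /tjurina_idealE[w' Lw' w'E] := Ty.
apply/tjurina_idealE; exists (fun k => w k + w' k); first by move=> k; apply: local_ringD.
rewrite /GRing.scale /= /fracK_scale wE w'E -big_split; apply: eq_bigr => k _.
by rewrite mulrDl.
Qed.

End TjurinaIdeal.

Section TjurinaPoint.
Variables (K : numClosedFieldType) (d : nat) (f : {mpoly K[3]}).
Local Notation S := {mpoly K[3]}.
Local Notation P := {mpoly K[2]}.
Local Notation F := {fraction P}.
Hypotheses (d1 : (1 < d)%N) (redf : reduced_curve d f).
Variables (p : 'rV[K]_3) (pP : P2_point p).
Local Notation i := (chart p).
Local Notation q := (affine_coord i p).
Local Notation deh := (@dehomogenize K i).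
Local Notation T := (tjurina_ideal (deh f) q).

Let hf : f \is d.-homog. Proof. by case: redf. Qed.
Let d0 : (0 < d)%N := ltnW d1.
Let dehM (a b : S) : deh (a * b) = deh a * deh b. Proof. exact: (rmorphM deh). Qed.
Let dehB (a b : S) : deh (a - b) = deh a - deh b. Proof. exact: (rmorphB deh). Qed.

Lemma tjurina_of_local a : local_ideal f p a -> T (tofrac (deh a)).
Proof.
move=> [e [b [hb bp [v E]]]]; have bq : (deh b).@[q 0] != 0 by rewrite dehomogenize_eval.
apply/(tjurina_idealE i q d0 hf).
exists (fun k => tofrac (deh (v 0 k)) / tofrac (deh b)); first by move=> k; exists (deh (v 0 k)), (deh b).
apply: frac_combination; first exact: eval_neq0 bq.
by rewrite -dehM E (raddf_sum deh); apply: eq_bigr => k _ /=; rewrite dehM.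
Qed.

(** A relation with common denominator c in the chart is homogenized in a degree
    large enough for all its terms. *)
Lemma local_of_tjurina (k : nat) a : homogz k a -> T (tofrac (deh a)) -> local_ideal f p a.
Proof.
move=> ha /(tjurina_idealE i q d0 hf)[w Lw E].
have [c cq [y yE]] := local_denominators Lw.
have {}E := combination_frac yE E.
(* The extra degrees d and k + 1 give both sides of the relation the degree
   N + d + k. *)
pose N := (msize c + \sum_j msize (y j))%N.
have cN : (msize c <= (N + d).+1)%N by rewrite /N -addnA -addnS leq_addr.
have yN j : (msize (y j) <= (N + k.+1).+1)%N.
  by rewrite -addnS /N (bigD1 j) //= addnCA -addnA leq_addr.
exists (N + d)%N, (homogenize i (N + d) c); split; first exact: homog_homogenize.
  by rewrite -(dehomogenize_eval _ pP) homogenizeK.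
exists (\row_j homogenize i (N + k.+1) (y j)).
under eq_bigr do rewrite mxE.
apply/eqP; rewrite -subr_eq0; apply/eqP; apply: (@dehomogenize_inj K i (N + d + k)).
  rewrite rpredB ?dhomogM ?homog_homogenize //; apply: rpred_sum => j _.
  have -> : (N + d + k = N + k.+1 + d.-1)%N by clear -d0; lia.
  apply: dhomogM; first exact: homog_homogenize.
  by have := homog_deriv j hf; have -> : d%:Z - 1 = d.-1 by clear -d0; lia.
rewrite dehB dehM homogenizeK E (raddf_sum deh) -sumrB big1 // => j _ /=.
by rewrite dehM homogenizeK subrr.
Qed.

Variables (k0 t : nat) (l : S) (k1 : nat).
Hypothesis dimJ : forall k : nat, (k0 <= k)%N -> qdim (homogz k) (jacobian_ideal f) t.
Hypothesis hl : homogz 1 l.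
Hypothesis lsurj : forall (k : nat) a, (k1 <= k)%N -> homogz k a ->
    exists2 b, homogz (k%:Z - 1) b & jacobian_ideal f (a - b * l).

(** A fraction is represented by a form of the given degree k since the
    denominator can be divided out in the local quotient. *)
Lemma local_ring_homog (k : nat) (h : F) : zero_jacobian f p -> (k0 + k1 <= k)%N ->
  local_ring q h -> exists2 a, homogz k a & T (h - tofrac (deh a)).
Proof.
move=> Vp kk_k [a0 [b0 [bq ->]]]; pose N := (msize a0 + msize b0)%N.
have aN : (msize a0 <= N.+1)%N by rewrite /N -addnS leq_addr.
have bN : (msize b0 <= N.+1)%N by rewrite /N -addSn leq_addl.
have [||a ha La] := local_mul_surj dimJ hl lsurj Vp (P2_point_neq0 pP)
  (homog_homogenize i bN) _ kk_k (h := 'X_i ^+ k * homogenize i N a0).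
- by rewrite -(dehomogenize_eval _ pP) homogenizeK.
- by apply: (dhomogM (homogzX1 _ (homogz_var K i))); apply: homog_homogenize.
exists a => //; rewrite frac_sub ?(eval_neq0 bq) //; apply: (tjurina_idealM d0 hf) => //.
  exact: local_ringV.
have := tjurina_of_local La; rewrite dehB !dehM !homogenizeK (rmorphXn deh) /= dehomogenize_var.
by rewrite unlift_none expr1n mul1r.
Qed.

Lemma point_tjurina_of_local n (k : nat) : zero_jacobian f p -> (k0 + k1 <= k)%N ->
  qdim (homogz k) (local_ideal f p) n -> point_tjurina f p n.
Proof.
move=> Vp kk_k dimL.
pose phi (a : S) : fracK K 2 := tofrac (deh a).
have phi_linear : linear phi.
  move=> c u v; have dehD (a b : S) : deh (a + b) = deh a + deh b by exact: (raddfD deh).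
  by rewrite /phi dehD dehomogenizeZ -mul_mpolyC tofracD tofracM.
have [] := qdim_iso phi_linear (subspace_homogz K k) (subspace_local f p)
  (subspace_local_ring q) (subspace_tjurina i q d0 hf) _ _ _ _ n.
- by move=> a _; apply: local_ring_tofrac.
- by move=> a; apply: local_of_tjurina.
- by move=> a _; apply: tjurina_of_local.
- by move=> h; apply: local_ring_homog.
by move=> /(_ dimL).
Qed.

End TjurinaPoint.

Theorem total_tjurina_jacobian (K : numClosedFieldType) (d : nat) (f : {mpoly K[3]}) (k0 t : nat) :
  (1 < d)%N -> reduced_curve d f ->
  (forall k : nat, (k0 <= k)%N -> qdim (homogz k) (jacobian_ideal f) t) ->
  total_tjurina f t.
Proof.
move=> d1 redf dimJ; have [l [hl [k1 lsurj]]] := exists_linear_form d1 redf dimJ.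
have [s [n [us sP nP tE]]] := jacobian_decomposition d1 redf dimJ hl lsurj.
exists s, n; split=> // p ps.
have [pP Vp] := (singular_zero d1 redf p).1 ((sP p).1 ps).
exact: (point_tjurina_of_local d1 redf pP dimJ hl lsurj Vp (leqnn _) (nP p ps _ (leqnn _))).
Qed.

(** * Tjurina numbers and type two *)

Section TypeTwo.
Variables (K : numClosedFieldType) (d : nat) (f : {mpoly K[3]}).
Hypotheses (d1 : (1 < d)%N) (redf : reduced_curve d f).
Local Notation D := (d%:Z - 1).

(** The dimension in each high degree is determined by the degrees, hence
    constant. *)
Lemma total_tjurina_resolution (ds cs : seq nat) : minimal_resolution d f ds cs ->
  exists2 tau : nat, total_tjurina f tau &
    2 * tau%:Z = \sum_(x <- ds) (D + x%:Z) ^+ 2 - \sum_(c <- cs) c%:Z ^+ 2 - 3 * D ^+ 2.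
Proof.
move=> /minimal_resolution_resolution /(resolution_numerics d1 redf)[_ _ [k0 dimJ]].
have [tau _ tauE] := dimJ k0 (leqnn _); exists tau => //.
apply: (total_tjurina_jacobian (k0 := k0) d1 redf) => k kk0.
have [t dimt tE] := dimJ k kk0.
suff -> : tau = t by [].
by move: tauE; rewrite -tE; lia.
Qed.

Lemma curve_type_of_minimal (a b : nat) (ds cs : seq nat) : (a + b = d + 1)%N ->
  minimal_resolution d f [:: a, b & ds] cs -> curve_type d f 2.
Proof.
move=> ab /minimal_resolution_exponents exps; exists a, b, ds; split=> //; lia.
Qed.

(** The sum of the epsilons equals the type, by the linear relation between the
    degrees of a resolution. *)
Lemma curve_type2_of_epsilons (eps : seq int) : eps = [:: 2] \/ eps = [:: 1; 1] ->
  epsilons d f eps -> curve_type d f 2.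
Proof.
move=> epsE [ds [cs [res szcs csE]]].
have [szds sumE _] := resolution_numerics d1 redf (minimal_resolution_resolution res).
case: epsE => E; rewrite {}E in szcs csE.
  case: cs szcs csE res szds sumE => [//|c [|//]] _ /(_ 0%N erefl) /= cE.
  case: ds cE => [//|a [//|b [//|x [|//]]]] /= cE res _; rewrite !big_cons !big_nil => sumE.
  by apply: curve_type_of_minimal res; lia.
case: cs szcs csE res szds sumE => [//|c [//|c' [|//]]] _ csE.
have /= := csE 0%N erefl; have /= := csE 1%N erefl; move=> {csE}.
case: ds => [//|a [//|b [//|x [//|y [|//]]]]] /= c'E cE res _; rewrite !big_cons !big_nil => sumE.
by apply: curve_type_of_minimal res; lia.
Qed.

Lemma curve_type2_cases : curve_type d f 2 ->
  [/\ syzygy_curve f 3, epsilons d f [:: 2]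
    & forall d1 d2 d3 : nat, exponents f [:: d1; d2; d3] ->
      exists2 tau : nat, total_tjurina f tau &
        tau%:Z = d1%:Z ^+ 2 + d1%:Z * d2%:Z + d2%:Z ^+ 2
                 - 2 * d1%:Z - 2 * d2%:Z - 2 * d3%:Z]
  \/
  [/\ syzygy_curve f 4, epsilons d f [:: 1; 1]
    & forall d1 d2 d3 d4 : nat, exponents f [:: d1; d2; d3; d4] ->
      exists2 tau : nat, total_tjurina f tau &
        tau%:Z = d1%:Z ^+ 2 + d1%:Z * d2%:Z + d2%:Z ^+ 2
                 - 2 * d1%:Z - 2 * d2%:Z - d3%:Z - d4%:Z + 1].
Proof.
move=> /(curve_type2_resolution d1 redf)[ds [cs [exps res cases]]].
have [tau tjf tauE] := total_tjurina_resolution res.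
case: cases => [[a [b [c [dsE csE ab]]]]|[a [b [c [e [dsE csE ab]]]]]]; [left|right];
  rewrite {}dsE {}csE in exps res tauE; move: tauE; rewrite !big_cons !big_nil => tauE; split.
- by exists [:: a; b; c].
- exists [:: a; b; c], [:: (d.-1 + c + 2)%N]; split=> // -[|//] _ /=; lia.
- move=> x y z /(exponents_unique exps)[<- <- <-]; exists tau => //.
  have DE : (d.-1 + c + 2)%:Z = D + c%:Z + 2 by lia.
  have dE : d%:Z = a%:Z + b%:Z - 1 by lia.
  by apply: (@mulfI int 2) => //; rewrite tauE DE dE; ring.
- by exists [:: a; b; c; e].
- exists [:: a; b; c; e], [:: d.-1 + c + 1; d.-1 + e + 1]%N; split=> // -[|[|//]] _ /=; lia.
- move=> x y z w /(exponents_unique exps)[<- <- <- <-]; exists tau => //.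
  have DE n : (d.-1 + n + 1)%:Z = D + n%:Z + 1 by lia.
  have dE : d%:Z = a%:Z + b%:Z - 1 by lia.
  by apply: (@mulfI int 2) => //; rewrite tauE !DE dE; ring.
Qed.

End TypeTwo.

Theorem proposition1p12 (R : realType) (d : nat) (f : {mpoly R[i][3]}) :
  (3 <= d)%N -> reduced_curve d f ->
  (curve_type d f 2 ->
     [/\ syzygy_curve f 3, epsilons d f [:: 2]
       & forall d1 d2 d3 : nat, exponents f [:: d1; d2; d3] ->
         exists2 tau : nat, total_tjurina f tau &
           tau%:Z = d1%:Z ^+ 2 + d1%:Z * d2%:Z + d2%:Z ^+ 2
                    - 2 * d1%:Z - 2 * d2%:Z - 2 * d3%:Z]
     \/
     [/\ syzygy_curve f 4, epsilons d f [:: 1; 1]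
       & forall d1 d2 d3 d4 : nat, exponents f [:: d1; d2; d3; d4] ->
         exists2 tau : nat, total_tjurina f tau &
           tau%:Z = d1%:Z ^+ 2 + d1%:Z * d2%:Z + d2%:Z ^+ 2
                    - 2 * d1%:Z - 2 * d2%:Z - d3%:Z - d4%:Z + 1])
  /\
  (~ free_curve f ->
     (syzygy_curve f 3 /\ epsilons d f [:: 2]) \/
     (syzygy_curve f 4 /\ epsilons d f [:: 1; 1]) ->
     curve_type d f 2).
Proof.
move=> d3 redf; have d1 := ltnW d3; split; first exact: curve_type2_cases.
by move=> _ [[_]|[_]]; apply: curve_type2_of_epsilons => //; [left|right].
Qed.
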